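(* Let $n,k\ge 1$ be integers and $s\in(0,1)$. Let $\omega^n\subset\mathbb{R}^n$ be a bounded Lipschitz domain and let $B^k_1\subset\mathbb{R}^k$ be a bounded, open and convex neighbourhood of the origin. For $\ell\in(0,\infty)$ put $B^k_\ell=\ell B^k_1$ and $\Omega^{n+k}_\ell=\omega^n\times B^k_\ell\subset\mathbb{R}^{n+k}$, with points written $(x,t)$, $x\in\mathbb{R}^n$, $t\in\mathbb{R}^k$. For a given $f_\infty\in L^2(\omega^n)$, let $u_\ell\in\widetilde H^s(\Omega^{n+k}_\ell)$ be the (unique) weak solution of $$(-\Delta_{\mathbb{R}^{n+k}})^su_\ell=f_\infty\ \text{ in }\Omega^{n+k}_\ell,\qquad u_\ell\equiv0\ \text{ in }\mathbb{R}^{n+k}\setminus\overline{\Omega^{n+k}_\ell},$$ where $f_\infty=f_\infty(x)$ is regarded as a function on $\Omega^{n+k}_\ell$ which is constant in the $t$-variable, and let $u_\infty\in\widetilde H^s(\omega^n)$ be the (unique) weak solution of $$(-\Delta_{\mathbb{R}^n})^su_\infty=f_\infty\ \text{ in }\omega^n,\qquad u_\infty\equiv0\ \text{ in }\mathbb{R}^n\setminus\overline{\omega^n}.$$ Let $\rho_\ell(v)(x)=\dfrac{1}{|B^k_\ell|}\displaystyle\int_{B^k_\ell}v(x,t)\,dt$ be the averaging operator. Then $$\rho_\ell(u_\ell)\to u_\infty\quad\text{strongly in }\widetilde H^s(\omega^n),\text{ as }\ell\to\infty.$$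
   Context: All functions are real-valued. For an integer $d\ge1$ and $s\in(0,1)$, define for $u\in L^2(\mathbb{R}^d)$ $$\mathcal{E}^s_d(u)=\frac{C_{d,s}}{2}\iint_{\mathbb{R}^d\times\mathbb{R}^d}\frac{(u(z)-u(\eta))^2}{|z-\eta|^{d+2s}}\,dz\,d\eta,\qquad C_{d,s}=\frac{s2^{2s}}{\Gamma(1-s)}\frac{\Gamma\left(\frac{d+2s}{2}\right)}{\pi^{d/2}};$$ equivalently $\mathcal{E}^s_d(u)=\int_{\mathbb{R}^d}|\xi|^{2s}|\mathcal{F}_d[u](\xi)|^2\,d\xi$, where $\mathcal{F}_d$ is the unitary Fourier transform on $\mathbb{R}^d$. $H^s(\mathbb{R}^d)=\{u\in L^2(\mathbb{R}^d): \mathcal{E}^s_d(u)<\infty\}$. For a Lipschitz domain $U\subset\mathbb{R}^d$, $\widetilde H^s(U)=\{u\in H^s(\mathbb{R}^d): u\equiv 0 \text{ on } \mathbb{R}^d\setminus\overline U\}$. If $U$ is bounded, $\widetilde H^s(U)$ is a Hilbert space with norm $\|u\|_{\widetilde H^s(U)}=\mathcal{E}^s_d(u)^{1/2}$. For $f\in L^2(U)$, $u$ is a weak solution of $(-\Delta_{\mathbb{R}^d})^su=f$ in $U$, $u=0$ in $\mathbb{R}^d\setminus\overline U$, if $u\in\widetilde H^s(U)$ and $\int_{\mathbb{R}^d}|\xi|^{2s}\mathcal{F}_d[u]\overline{\mathcal{F}_d[\varphi]}\,d\xi=\int_Uf\varphi\,dz$ for every $\varphi\in\widetilde H^s(U)$.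 The operator $\rho_\ell$ maps $\widetilde H^s(\Omega^{n+k}_\ell)$ into $\widetilde H^s(\omega^n)$. *)

(* Defs.v *)
From HB Require Import structures.
From mathcomp Require Import all_boot all_order all_algebra.
From mathcomp Require Import all_classical all_reals all_analysis.
From mathcomp Require Import complex.

Set Implicit Arguments.
Unset Strict Implicit.
Unset Printing Implicit Defensive.
Import Order.TTheory GRing.Theory Num.Theory.
Import numFieldNormedType.Exports.
Local Open Scope classical_set_scope.
Local Open Scope ring_scope.

Definition measure_rV_display : measure_display -> measure_display.
Proof. exact. Qed.

(* On row vectors we take the sigma-algebra generated by the coordinates, as
   the library does for tuples; for T = R it is the Borel sigma-algebra. *)
Section measurable_rV.
Context {d} {T : sigmaRingType d}.
Variable n : nat.

Let coors : 'I_n -> 'rV[T]_n -> T := fun i v => v ord0 i.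

Let rV_set0 : g_sigma_preimage coors set0.
Proof. exact: sigma_algebra0. Qed.

Let rV_setC A : g_sigma_preimage coors A -> g_sigma_preimage coors (~` A).
Proof. exact: sigma_algebraC. Qed.

Let rV_bigcup (F : _^nat) : (forall i, g_sigma_preimage coors (F i)) ->
  g_sigma_preimage coors (\bigcup_i (F i)).
Proof. exact: sigma_algebra_bigcup. Qed.

HB.instance Definition _ := @isMeasurable.Build (measure_rV_display d)
  'rV[T]_n (g_sigma_preimage coors) rV_set0 rV_setC rV_bigcup.

End measurable_rV.

Section lebesgue_rV.
Variable R : realType.

Lemma measurable_coord n (i : 'I_n) :
  measurable_fun [set: 'rV[R]_n] (fun v : 'rV[R]_n => v ord0 i).
Proof.
move=> _ Y mY; rewrite setTI; apply: sub_sigma_algebra => /=.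
rewrite -bigcup_seq/=; exists i => /=; first by rewrite mem_index_enum.
by exists Y => //; rewrite setTI.
Qed.

Lemma measurable_fun_rV d (T : measurableType d) n (f : T -> 'rV[R]_n) :
  (forall i, measurable_fun setT (fun x => f x ord0 i)) ->
  measurable_fun setT f.
Proof.
move=> mf _ Y mY; rewrite setTI.
pose G := [set A : set 'rV[R]_n | measurable (f @^-1` A)].
suff : G Y by [].
apply: mY; split => /=.
- split; rewrite /G /=.
  + by rewrite preimage_set0.
  + by move=> A mA; rewrite setTD preimage_setC; exact: measurableC.
  + by move=> F mF; rewrite preimage_bigcup; exact: bigcup_measurable.
- rewrite -bigcup_seq => A [i _ [B mB <-]]; rewrite /G /= setTI.
  by have := mf i measurableT B mB; rewrite setTI.
Qed.

Definition cons_rV n (p : measurableTypeR R * 'rV[R]_n) : 'rV[R]_n.+1 :=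
  row_mx (p.1%:M : 'rV[R]_1) p.2.

Lemma cons_rV0 n (p : measurableTypeR R * 'rV[R]_n) : cons_rV p ord0 ord0 = p.1.
Proof.
have -> : ord0 = @lshift 1 n ord0 :> 'I_n.+1 by exact: val_inj.
by rewrite [LHS](@row_mxEl _ 1 1 n) mxE eqxx.
Qed.

Lemma cons_rVS n (p : measurableTypeR R * 'rV[R]_n) i :
  cons_rV p ord0 (lift ord0 i) = p.2 ord0 i.
Proof.
have -> : lift ord0 i = @rshift 1 n i by exact: val_inj.
by rewrite [LHS](@row_mxEr _ 1 1 n).
Qed.

Lemma measurable_cons_rV n : measurable_fun setT (@cons_rV n).
Proof.
apply: measurable_fun_rV => i; case: (unliftP ord0 i) => [j ->|->].
  under eq_fun do rewrite cons_rVS.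
  exact: (measurableT_comp (measurable_coord j) measurable_snd).
by under eq_fun do rewrite cons_rV0; exact: measurable_fst.
Qed.

Definition uncons_rV n (v : 'rV[R]_n.+1) : measurableTypeR R * 'rV[R]_n :=
  (v ord0 ord0, \row_i v ord0 (lift ord0 i)).

Lemma cons_rVK n : cancel (@cons_rV n) (@uncons_rV n).
Proof.
move=> [x v]; rewrite /uncons_rV cons_rV0; congr pair.
by apply/rowP => i; rewrite mxE cons_rVS.
Qed.

Lemma measurable_uncons_rV n : measurable_fun setT (@uncons_rV n).
Proof.
apply/measurable_fun_pairP; split; first exact: measurable_coord.
apply: measurable_fun_rV => i; under eq_fun do rewrite mxE.
exact: measurable_coord.
Qed.

Section cons_measure.
Variables (n : nat) (mu : {sigma_finite_measure set 'rV[R]_n -> \bar R}).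

Definition cons_measure : set 'rV[R]_n.+1 -> \bar R :=
  pushforward (@lebesgue_measure R \x mu)%E (@cons_rV n).

Let cons_measure0 : cons_measure set0 = 0%E.
Proof. by rewrite /cons_measure /pushforward preimage_set0 measure0. Qed.

Let cons_measure_ge0 A : (0 <= cons_measure A)%E.
Proof. by rewrite /cons_measure /pushforward measure_ge0. Qed.

Let cons_measure_sigma_additive : semi_sigma_additive cons_measure.
Proof.
have mf A : measurable A -> measurable (@cons_rV n @^-1` A).
  by move=> mA; rewrite -[X in measurable X]setTI; exact: measurable_cons_rV.
move=> F mF tF mUF; rewrite /cons_measure /pushforward preimage_bigcup.
apply: measure_semi_sigma_additive.
- by move=> i; exact: (mf _ (mF i)).
- apply/trivIsetP => /= i j _ _ ij; rewrite -preimage_setI.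
  by move/trivIsetP : tF => /(_ _ _ _ _ ij) ->//; rewrite preimage_set0.
- by rewrite -preimage_bigcup; exact: mf.
Qed.

HB.instance Definition _ := isMeasure.Build _ _ _ cons_measure
  cons_measure0 cons_measure_ge0 cons_measure_sigma_additive.

Lemma cons_measureE A : cons_measure A = (@lebesgue_measure R \x mu)%E (@cons_rV n @^-1` A).
Proof. by []. Qed.

Let cons_measure_sigma_finite : sigma_finite setT cons_measure.
Proof.
have /sigma_finiteP[F [TF ndF Foo]] := sigma_finiteT (@lebesgue_measure R).
have /sigma_finiteP[G [TG ndG Goo]] := sigma_finiteT mu.
exists (fun i => @uncons_rV n @^-1` (F i `*` G i)).
  rewrite predeqE => v; split => // _.
  have [i _ Fi] : (\bigcup_i F i) (uncons_rV v).1 by rewrite -TF.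
  have [j _ Gj] : (\bigcup_i G i) (uncons_rV v).2 by rewrite -TG.
  exists (maxn i j) => //; split.
  - by move: Fi; exact/subsetPset/ndF/leq_maxl.
  - by move: Gj; exact/subsetPset/ndG/leq_maxr.
move=> i; have [mF Fi] := Foo i; have [mG Gi] := Goo i; split.
  rewrite -[X in measurable X]setTI.
  by apply: measurable_uncons_rV => //; exact: measurableX.
rewrite cons_measureE -comp_preimage.
rewrite (_ : @uncons_rV n \o @cons_rV n = id); last first.
  by apply/funext => p /=; exact: cons_rVK.
by rewrite preimage_id product_measure1E// lte_mul_pinfty// ge0_fin_numE.
Qed.

HB.instance Definition _ := @Measure_isSigmaFinite.Build _ _ _ cons_measure
  cons_measure_sigma_finite.

End cons_measure.

(* R^0 is a single point, of measure 1. *)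
Fixpoint lebesgue_rV n : {sigma_finite_measure set 'rV[R]_n -> \bar R} :=
  if n is m.+1 then cons_measure (lebesgue_rV m) else \d_(0 : 'rV[R]_0).

End lebesgue_rV.

(* Certifies [lebesgue_rV]: on measurable boxes it is the product of the
   side lengths. *)
Lemma lebesgue_rV_box (R : realType) n (A : 'I_n -> set R) :
  (forall i, measurable (A i)) ->
  @lebesgue_rV R n [set v : 'rV[R]_n | forall i, A i (v ord0 i)] =
  (\prod_(i < n) lebesgue_measure (A i))%E.
Proof.
elim: n A => [|n IH] A mA.
  by rewrite big_ord0 /= diracE mem_set//= => -[].
rewrite big_ord_recl -IH// -product_measure1E//=; last first.
  rewrite (_ : mkset _ = \bigcap_(i in [set: 'I_n])
      ((fun v : 'rV[R]_n => v ord0 i) @^-1` A (lift ord0 i))).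
    apply: fin_bigcap_measurable => // i _.
    by rewrite -[X in measurable X]setTI; exact: measurable_coord.
  by apply/seteqP; split => [v Av i _|v Av i]; [exact: Av|exact: Av].
  exact: (mA ord0).
rewrite cons_measureE; congr (_ _); apply/seteqP; split => [[x v] /= Axv|].
  split => [|i /=]; first by have := Axv ord0; rewrite cons_rV0.
  by have := Axv (lift ord0 i); rewrite cons_rVS.
move=> [x v] [/= Ax Av] i; case: (unliftP ord0 i) => [j ->|->].
  by rewrite cons_rVS; exact: Av.
by rewrite cons_rV0.
Qed.

Section fractional.
Variable R : realType.

(* Gamma(x) for x > 0, as Euler's integral. *)
Definition Gamma (x : R) : R :=
  \int[@lebesgue_measure R]_(t in `]0, +oo[) (t `^ (x - 1) * expR (- t)).

Definition C_frac (d : nat) (s : R) : R :=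
  s * 2 `^ (2 * s) / Gamma (1 - s) *
  (Gamma ((d%:R + 2 * s) / 2) / pi `^ (d%:R / 2)).

Definition dotv d (x y : 'rV[R]_d) : R := \sum_(i < d) x ord0 i * y ord0 i.

(* The Euclidean norm: the library's norm on matrices is the sup norm. *)
Definition enorm d (x : 'rV[R]_d) : R := Num.sqrt (dotv x x).

Definition L2 d (U : set 'rV[R]_d) (f : 'rV[R]_d -> R) : Prop :=
  f \_ U \in Lfun (lebesgue_rV R d) 2%:E.

Definition energy d (s : R) (u : 'rV[R]_d -> R) : \bar R :=
  ((C_frac d s / 2)%:E *
   \int[lebesgue_rV R d \x lebesgue_rV R d]_p
     ((u p.1 - u p.2) ^+ 2 / enorm (p.1 - p.2) `^ (d%:R + 2 * s))%:E)%E.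

Definition Hs d (s : R) (u : 'rV[R]_d -> R) : Prop :=
  L2 setT u /\ (energy s u < +oo)%E.

Definition Htilde d (s : R) (U : set 'rV[R]_d) (u : 'rV[R]_d -> R) : Prop :=
  Hs s u /\ {ae lebesgue_rV R d, forall z, ~ closure U z -> u z = 0}.

(* Extended-real valued, so that no junk value can arise outside Hs. *)
Definition Htilde_norm d (s : R) (u : 'rV[R]_d -> R) : \bar R :=
  (energy s u `^ 2^-1)%E.

Definition Cintegral d (T : measurableType d) (mu : {measure set T -> \bar R})
    (f : T -> R[i]) : R[i] :=
  ((\int[mu]_x complex.Re (f x)) +i* (\int[mu]_x complex.Im (f x)))%C.

(* The unitary Fourier transform, given by its integral formula, which is its
   value on L1 `&` L2. It is only applied to elements of Htilde s U with U
   bounded, which vanish off a bounded set and so are in L1. *)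
Definition fourier d (u : 'rV[R]_d -> R) (xi : 'rV[R]_d) : R[i] :=
  ((2 * pi) `^ (- (d%:R / 2)))%:C%C *
  Cintegral (lebesgue_rV R d) (fun x =>
    (cos (dotv x xi) -i* sin (dotv x xi))%C * (u x)%:C%C).

(* For bounded U. *)
Definition weak_solution d (s : R) (U : set 'rV[R]_d)
    (f u : 'rV[R]_d -> R) : Prop :=
  Htilde s U u /\
  forall phi, Htilde s U phi ->
    Cintegral (lebesgue_rV R d) (fun xi =>
      (enorm xi `^ (2 * s))%:C%C * fourier u xi * conjc (fourier phi xi)) =
    (\int[lebesgue_rV R d]_(z in U) (f z * phi z))%:C%C.

(* Near each boundary point p, U is the strict epigraph, in some direction e,
   of a Lipschitz function g on the hyperplane orthogonal to e; g may be
   taken on the whole space since it only matters on that hyperplane. *)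
Definition lipschitz_boundary d (U : set 'rV[R]_d) : Prop :=
  forall p, (closure U `\` interior U) p ->
  exists (e : 'rV[R]_d) (r : R) (g : 'rV[R]_d -> R^o),
    [/\ enorm e = 1, 0 < r, lipschitz g &
        forall z, enorm (z - p) < r ->
          (U z <-> g (z - dotv z e *: e) < dotv z e)].

Definition lipschitz_domain d (U : set 'rV[R]_d) : Prop :=
  [/\ open U, connected U, U !=set0 & lipschitz_boundary U].

Definition dilate k (l : R) (B : set 'rV[R]_k) : set 'rV[R]_k :=
  [set l *: t | t in B].

Definition cylinder n k (A : set 'rV[R]_n) (B : set 'rV[R]_k) :
    set 'rV[R]_(n + k) :=
  [set z | A (lsubmx z) /\ B (rsubmx z)].

Definition average n k (B : set 'rV[R]_k) (v : 'rV[R]_(n + k) -> R)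
    (x : 'rV[R]_n) : R :=
  (fine (lebesgue_rV R k B))^-1 * \int[lebesgue_rV R k]_(t in B) v (row_mx x t).

End fractional.

(* Main.v *)
(** Write K_d = (2 pi)^-d, let P u be the squared modulus of the unnormalised
    Fourier transform of u, and let E_d(u) = K_d \int |xi|^(2s) P u, which is
    comparable to the Gagliardo energy. Let w be the average of u_l over
    B = l B_1. Plancherel in t and Jensen's inequality give
    |B| E_n(w) <= E_(n+k)(u_l), since |xi| <= |(xi, tau)|; in particular w is
    admissible. The equation for u_l tested with u_l itself gives
    E_(n+k)(u_l) = |B| \int f w, and the equation for u_oo tested with w gives
    \int f w = <u_oo, w>, so that E_n(w - u_oo) <= \int f u_oo - \int f w. For
    the opposite bound on \int f w, test the equation for u_l with
    v(x, t) = u_oo(x) q(t / l), where q is a Lipschitz cutoff supported in B_1: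
    P v factorises, (|xi|^2 + |tau|^2)^s <= |xi|^(2s) + |tau|^(2s), and the cost
    of the cutoff is O(l^(k - 2s)). From
    2 <u_l, v> <= E_(n+k)(u_l) + E_(n+k)(v) one obtains
    \int f w >= \int f u_oo |B_1|^-1 \int (2 q - q^2) - O(l^(-2s)), and it
    remains to let l tend to infinity and then q to the indicator of B_1. *)

Require Import Defs.
From HB Require Import structures.
From mathcomp Require Import all_boot all_order all_algebra.
From mathcomp Require Import all_classical all_reals all_analysis.
From mathcomp Require Import ring lra.
From mathcomp Require Import complex measurable_realfun.
Import Order.TTheory GRing.Theory Num.Theory.
Import numFieldNormedType.Exports.
Set Implicit Arguments.
Unset Strict Implicit.
Unset Printing Implicit Defensive.
Local Open Scope classical_set_scope.
Local Open Scope ring_scope.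

(** * Real-valued integration *)

(** Two facts decide the layout. The weak formulation is an identity between Fourier transforms,
    while admissibility is a condition on the Gagliardo integral. The estimates live on the Fourier
    side, where the constants (2 pi)^d of the dimensions n, k and n + k cancel exactly, and meet the
    Gagliardo side only through two-sided bounds with crude constants. The lower bound serves to see
    that admissible functions have finite Fourier energy; the upper bound turns smallness of E_n(w -
    u_oo) into smallness of the norm. The transform is an integral formula, so every function to
    which Plancherel is applied must lie in L1 and L2; for the solutions, bounded support provides
    this. Plancherel is proved by Abel summation on the line and by induction on the dimension. The
    induction step contains a partial form, valid at almost every frequency of the first factor, and
    it is this form that compares u_l with its average. *)

Lemma meas_comp d1 d2 d3 (T1 : measurableType d1) (T2 : measurableType d2)
    (T3 : measurableType d3) (h : T2 -> T3) (f : T1 -> T2) D :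
  measurable_fun setT h -> measurable_fun D f ->
  measurable_fun D (fun x => h (f x)).
Proof. by move=> mh mf; exact: measurableT_comp mh mf. Qed.

Lemma meas_norm d (T : measurableType d) (R : realType) D (f : T -> R) :
  measurable_fun D f -> measurable_fun D (fun x => `|f x|).
Proof. by move=> mf; apply: measurableT_comp mf; exact: normr_measurable. Qed.

(** The second-order patterns [@?f x] recover the factors of an integrand written with a bound
    variable, which is why [meas_comp] and [meas_norm] are stated pointwise and not with [\o]. *)
Ltac meas1 := lazymatch goal with
  | |- measurable_fun _ (fun x => (@?f x)%:E) => apply/measurable_EFinP
  | |- measurable_fun _ (EFin \o _) => apply/measurable_EFinP
  | |- measurable_fun _ (fun x => @?f x + @?g x) => apply: (@measurable_funD _ _ _ _ f g)
  | |- measurable_fun _ (fun x => - @?f x) => apply: (@measurable_funN _ _ _ _ f)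
  | |- measurable_fun _ (fun x => @?f x * @?g x) => apply: (@measurable_funM _ _ _ _ f g)
  | |- measurable_fun _ (fun x => @?f x ^+ ?n) => apply: (@measurable_funX _ _ _ _ f n)
  | |- measurable_fun _ (fun x => `| @?f x |) => apply: (@meas_norm _ _ _ _ f)
  | |- measurable_fun _ (fun x => cos (@?f x)) => apply: (@meas_comp _ _ _ _ _ _ cos f); first exact: continuous_measurable_fun (@continuous_cos _)
  | |- measurable_fun _ (fun x => sin (@?f x)) => apply: (@meas_comp _ _ _ _ _ _ sin f); first exact: continuous_measurable_fun (@continuous_sin _)
  | |- measurable_fun _ (fun x => expR (@?f x)) => apply: (@meas_comp _ _ _ _ _ _ expR f); first exact: measurable_expR
  | |- measurable_fun _ (fun x => (@?f x) `^ ?p) => apply: (@meas_comp _ _ _ _ _ _ (fun y => y `^ p) f); first exact: measurable_powR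
  | |- measurable_fun _ (fun x => (@?f x).1) => apply: (@meas_comp _ _ _ _ _ _ fst f); first exact: measurable_fst
  | |- measurable_fun _ (fun x => (@?f x).2) => apply: (@meas_comp _ _ _ _ _ _ snd f); first exact: measurable_snd
  | |- measurable_fun _ fst => exact: measurable_fst
  | |- measurable_fun _ snd => exact: measurable_snd
  | |- measurable_fun _ (fun x => (@?f x, @?g x)) => apply: (@measurable_fun_pair _ _ _ _ _ _ f g)
  | |- measurable_fun _ (fun x => x) => exact: measurable_id
  | |- measurable_fun _ (fun _ => ?c) => exact: measurable_cst
  end.
Ltac meas := repeat first [match goal with H : ?G |- ?G => exact H end | meas1 | assumption].

Section generic.
Context d (T : measurableType d) (R : realType) (m : {measure set T -> \bar R}).
Implicit Types f g a b c : T -> R.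

Lemma ge0_le_intR f g : measurable_fun setT f -> measurable_fun setT g ->
  (forall x, 0 <= f x) -> (forall x, f x <= g x) ->
  (\int[m]_x (f x)%:E <= \int[m]_x (g x)%:E)%E.
Proof.
move=> mf mg f0 fg; apply: ge0_le_integral => //; try by meas.
- by move=> x _; rewrite lee_fin.
- by move=> x _; rewrite lee_fin.
Qed.

Lemma ge0_intD f g : measurable_fun setT f -> measurable_fun setT g ->
  (forall x, 0 <= f x) -> (forall x, 0 <= g x) ->
  (\int[m]_x (f x + g x)%:E = \int[m]_x (f x)%:E + \int[m]_x (g x)%:E)%E.
Proof.
move=> mf mg f0 g0; rewrite -ge0_integralD//; try by meas.
- by move=> x _; rewrite lee_fin.
- by move=> x _; rewrite lee_fin.
Qed.

Lemma ge0_intZ (k : R) f : measurable_fun setT f ->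
  (forall x, 0 <= f x) -> 0 <= k ->
  (\int[m]_x (k * f x)%:E = k%:E * \int[m]_x (f x)%:E)%E.
Proof.
move=> mf f0 k0; under eq_integral do rewrite EFinM.
apply: ge0_integralZl_EFin => //; first by move=> x _; rewrite lee_fin.
by meas.
Qed.

Lemma int_ge0 f : (forall x, 0 <= f x) -> (0 <= \int[m]_x (f x)%:E)%E.
Proof. by move=> f0; apply: integral_ge0 => x _; rewrite lee_fin. Qed.

Lemma integrableR f : measurable_fun setT f ->
  (\int[m]_x `|f x|%:E < +oo)%E -> m.-integrable setT (EFin \o f).
Proof. by move=> mf fi; apply/integrableP; split => //; meas. Qed.

Lemma integrableR_meas f : m.-integrable setT (EFin \o f) -> measurable_fun setT f.
Proof. by move=> /measurable_int/measurable_EFinP. Qed.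

Lemma ge0_integrableR f : measurable_fun setT f -> (forall x, 0 <= f x) ->
  (\int[m]_x (f x)%:E < +oo)%E -> m.-integrable setT (EFin \o f).
Proof.
move=> mf f0 fi; apply: integrableR => //; under eq_integral do rewrite ger0_norm//.
exact: fi.
Qed.

Lemma integrableR_lty f : m.-integrable setT (EFin \o f) ->
  (\int[m]_x `|f x|%:E < +oo)%E.
Proof. by move=> /integrableP[]. Qed.

Lemma integrable_le f g : measurable_fun setT f ->
  m.-integrable setT (EFin \o g) -> (forall x, `|f x| <= g x) ->
  m.-integrable setT (EFin \o f).
Proof.
move=> mf ig fg; apply: le_integrable ig => //; first by meas.
move=> x _ /=; rewrite lee_fin (le_trans (fg x))//; exact: ler_norm.
Qed.

Lemma integrable_mulb f c : m.-integrable setT (EFin \o f) ->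
  measurable_fun setT c -> (forall x, `|c x| <= 1) ->
  m.-integrable setT (EFin \o (fun x => f x * c x)).
Proof.
move=> fi mc c1; have mf := integrableR_meas fi.
apply: (@integrable_le _ (fun x => `|f x|)) => //; first by meas.
  apply: integrableR; first by meas.
  by under eq_integral do rewrite normr_id; exact: integrableR_lty.
by move=> x; rewrite normrM ler_piMr.
Qed.

Lemma integrableDR f g : m.-integrable setT (EFin \o f) ->
  m.-integrable setT (EFin \o g) ->
  m.-integrable setT (EFin \o (fun x => f x + g x)).
Proof.
by move=> fi gi; exact: (integrableD measurableT fi gi).
Qed.

Lemma integrableNR f : m.-integrable setT (EFin \o f) ->
  m.-integrable setT (EFin \o (fun x => - f x)).
Proof. by move=> fi; exact: (integrableN fi). Qed.

Lemma integrableZR k f : m.-integrable setT (EFin \o f) ->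
  m.-integrable setT (EFin \o (fun x => k * f x)).
Proof. by move=> fi; exact: (integrableZl measurableT k fi). Qed.

Lemma Rint_EFin f : m.-integrable setT (EFin \o f) ->
  (\int[m]_x (f x)%:E)%E = (\int[m]_x f x)%:E.
Proof. by move=> fi; rewrite /Rintegral fineK//; exact: integrable_fin_num. Qed.

(* Membership in L1 and L2, on which the integral formula for the Fourier
   transform makes sense and Plancherel's identity holds. *)
Definition nice f := m.-integrable setT (EFin \o f) /\
  (\int[m]_x (f x ^+ 2)%:E < +oo)%E.

Lemma nice_meas f : nice f -> measurable_fun setT f.
Proof. by case=> /integrableR_meas. Qed.

Lemma nice_sqr f : nice f -> m.-integrable setT (EFin \o (fun x => f x ^+ 2)).
Proof.
move=> nf; have mf := nice_meas nf; apply: ge0_integrableR; first by meas.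
  by move=> x; exact: sqr_ge0.
by case: nf.
Qed.

Lemma L2_mul f g : measurable_fun setT f -> measurable_fun setT g ->
  (\int[m]_x (f x ^+ 2)%:E < +oo)%E -> (\int[m]_x (g x ^+ 2)%:E < +oo)%E ->
  m.-integrable setT (EFin \o (fun x => f x * g x)).
Proof.
move=> mf mg f2 g2.
apply: (@integrable_le _ (fun x => f x ^+ 2 + g x ^+ 2)); first by meas.
  apply: integrableDR; apply: ge0_integrableR => //; by [meas|move=> x; exact: sqr_ge0].
move=> x; rewrite ler_norml; nra.
Qed.

Lemma nice_mul f g : nice f -> nice g ->
  m.-integrable setT (EFin \o (fun x => f x * g x)).
Proof.
move=> nf ng; apply: L2_mul; [exact: nice_meas|exact: nice_meas|by case: nf|by case: ng].
Qed.

Lemma L2D f g : measurable_fun setT f -> measurable_fun setT g ->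
  (\int[m]_x ((f x + g x) ^+ 2)%:E <=
   2%:E * \int[m]_x (f x ^+ 2)%:E + 2%:E * \int[m]_x (g x ^+ 2)%:E)%E.
Proof.
move=> mf mg; rewrite -!ge0_intZ//; try by [meas|move=> x; exact: sqr_ge0].
rewrite -ge0_intD; try by [meas|move=> x; rewrite mulr_ge0// sqr_ge0].
apply: ge0_le_intR; try by [meas|move=> x; exact: sqr_ge0].
by move=> x; have := sqr_ge0 (f x - g x); nra.
Qed.

Lemma L2D_lty f g : measurable_fun setT f -> measurable_fun setT g ->
  (\int[m]_x (f x ^+ 2)%:E < +oo)%E -> (\int[m]_x (g x ^+ 2)%:E < +oo)%E ->
  (\int[m]_x ((f x + g x) ^+ 2)%:E < +oo)%E.
Proof.
move=> mf mg f2 g2; apply: le_lt_trans (L2D mf mg) _.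
have fin h : (\int[m]_x (h x ^+ 2)%:E < +oo)%E ->
    (2%:E * \int[m]_x (h x ^+ 2)%:E < +oo)%E.
  by move=> h2; rewrite lte_mul_pinfty.
by apply: lte_add_pinfty; exact: fin.
Qed.

Lemma niceZ k f : nice f -> nice (fun x => k * f x).
Proof.
move=> nf; have mf := nice_meas nf; split; first by case: nf => fi _; exact: integrableZR.
under eq_integral do rewrite exprMn.
rewrite ge0_intZ ?sqr_ge0//; [|by meas|by move=> x; exact: sqr_ge0].
by rewrite lte_mul_pinfty ?lee_fin ?sqr_ge0//; case: nf.
Qed.

Lemma niceD f g : nice f -> nice g -> nice (fun x => f x + g x).
Proof.
move=> nf ng; have mf := nice_meas nf; have mg := nice_meas ng; split.
  by case: nf ng => fi _ [gi _]; exact: integrableDR.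
by apply: L2D_lty => //; [case: nf|case: ng].
Qed.

Lemma niceB f g : nice f -> nice g -> nice (fun x => f x - g x).
Proof.
move=> nf ng; have -> : (fun x => f x - g x) = (fun x => f x + (-1) * g x).
  by apply/funext => x; rewrite mulN1r.
by apply: niceD => //; exact: niceZ.
Qed.

Lemma nice_mulb f c : nice f -> measurable_fun setT c -> (forall x, `|c x| <= 1) ->
  nice (fun x => f x * c x).
Proof.
move=> nf mc c1; have mf := nice_meas nf.
split; first by apply: integrable_mulb => //; case: nf.
case: nf => _; apply: le_lt_trans; apply: ge0_le_intR; try by [meas|move=> x; exact: sqr_ge0].
move=> x; rewrite exprMn ler_piMr ?sqr_ge0// -real_normK ?num_real// expr_le1//.
Qed.

Lemma ae_eq_intR f g : measurable_fun setT f -> measurable_fun setT g ->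
  {ae m, forall x, f x = g x} ->
  (\int[m]_x (f x)%:E = \int[m]_x (g x)%:E)%E.
Proof.
move=> mf mg fg; apply: ae_eq_integral => //; try by meas.
by move: fg; apply: filterS => x -> _.
Qed.

Lemma ae_le_intR f g : measurable_fun setT f -> measurable_fun setT g ->
  (forall x, 0 <= f x) -> (forall x, 0 <= g x) ->
  {ae m, forall x, f x <= g x} ->
  (\int[m]_x (f x)%:E <= \int[m]_x (g x)%:E)%E.
Proof.
move=> mf mg f0 g0 fg; apply: ae_ge0_le_integral => //; try by [meas|move=> x _; rewrite lee_fin].
by move: fg; apply: filterS => x + _; rewrite lee_fin.
Qed.

End generic.

(** * Integrals along a map that carries one measure to another *)

Section transfer.
Context d1 d2 (X : measurableType d1) (Y : measurableType d2) (R : realType).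
Variables (phi : X -> Y) (mX : {measure set X -> \bar R}) (mY : {measure set Y -> \bar R}).
Hypothesis mphi : measurable_fun setT phi.
Hypothesis phiE : forall A, measurable A -> mY A = mX (phi @^-1` A).

Let pf : {measure set Y -> \bar R} :=
  measure_function_pushforward__canonical__measure_function_Measure mX mphi.

Lemma ge0_int_transfer (f : Y -> \bar R) : measurable_fun setT f ->
  (forall y, (0 <= f y)%E) -> (\int[mY]_y f y = \int[mX]_x f (phi x))%E.
Proof.
move=> mf f0; rewrite (@eq_measure_integral _ _ _ _ pf).
  by rewrite /pf ge0_integral_pushforward.
by move=> A mA _; rewrite phiE.
Qed.

Lemma integrable_transfer (f : Y -> R) : mY.-integrable setT (EFin \o f) ->
  mX.-integrable setT (EFin \o (fun x => f (phi x))).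
Proof.
move=> fi; have mf := integrableR_meas fi.
apply: integrableR; first exact: (meas_comp mf mphi).
rewrite -(@ge0_int_transfer (fun y => `|f y|%:E)); first exact: integrableR_lty.
  by meas.
by move=> y; rewrite lee_fin.
Qed.

Lemma Rint_transfer (f : Y -> R) : mY.-integrable setT (EFin \o f) ->
  \int[mY]_y f y = \int[mX]_x f (phi x).
Proof.
move=> fi; have mf := integrableR_meas fi.
rewrite /Rintegral; congr fine.
rewrite (@eq_measure_integral _ _ _ _ pf).
  rewrite /pf (@integral_pushforward _ _ _ _ _ _ mphi _ _ (EFin \o f))//.
    by meas.
  exact: (integrable_transfer fi).
by move=> A mA _; rewrite phiE.
Qed.

End transfer.

(** * Fubini and Tonelli for real-valued integrands *)

Section fubini_real.
Context d1 d2 (X : measurableType d1) (Y : measurableType d2) (R : realType).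
Variables (m1 : {sigma_finite_measure set X -> \bar R})
  (m2 : {sigma_finite_measure set Y -> \bar R}).
Implicit Types F : X * Y -> R.

Lemma meas_slice1 F x : measurable_fun setT F -> measurable_fun setT (fun y => F (x, y)).
Proof. by move=> mF; apply: (meas_comp mF); exact: pair1_measurable. Qed.

Lemma meas_slice2 F y : measurable_fun setT F -> measurable_fun setT (fun x => F (x, y)).
Proof. by move=> mF; apply: (meas_comp mF); exact: pair2_measurable. Qed.

Lemma meas_eint1 (F : X * Y -> \bar R) : measurable_fun setT F ->
  (forall p, (0 <= F p)%E) -> measurable_fun setT (fun x => \int[m2]_y F (x, y))%E.
Proof. by move=> mF F0; exact: (@measurable_fun_fubini_tonelli_F _ _ _ _ _ m2 F). Qed.

Lemma meas_eint2 (F : X * Y -> \bar R) : measurable_fun setT F ->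
  (forall p, (0 <= F p)%E) -> measurable_fun setT (fun y => \int[m1]_x F (x, y))%E.
Proof. by move=> mF F0; exact: (@measurable_fun_fubini_tonelli_G _ _ _ _ _ m1 F). Qed.

(** The inner integral is [fine] of a difference of two Tonelli integrals, of the positive and of
    the negative part, and each of these operations is measurable; slices that fail to be integrable
    do no harm. *)
Lemma meas_Rint1 F : measurable_fun setT F ->
  measurable_fun setT (fun x => \int[m2]_y F (x, y)).
Proof.
move=> mF; apply: (meas_comp (h := fine)); first exact: fine_measurable.
under eq_fun do rewrite integralE.
have mE : measurable_fun setT (fun p => (F p)%:E) by meas.
have mp := meas_eint1 (measurable_funepos mE) (fun p => funepos_ge0 _ p).
have mn := meas_eint1 (measurable_funeneg mE) (fun p => funeneg_ge0 _ p).
have := emeasurable_funB mp mn; apply: eq_measurable_fun => x _.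
by congr (_ - _)%E; apply: eq_integral => y _; rewrite ?funeposE ?funenegE.
Qed.

Lemma meas_Rint2 F : measurable_fun setT F ->
  measurable_fun setT (fun y => \int[m1]_x F (x, y)).
Proof.
move=> mF; apply: (meas_comp (h := fine)); first exact: fine_measurable.
under eq_fun do rewrite integralE.
have mE : measurable_fun setT (fun p => (F p)%:E) by meas.
have mp := meas_eint2 (measurable_funepos mE) (fun p => funepos_ge0 _ p).
have mn := meas_eint2 (measurable_funeneg mE) (fun p => funeneg_ge0 _ p).
have := emeasurable_funB mp mn; apply: eq_measurable_fun => x _.
by congr (_ - _)%E; apply: eq_integral => y _; rewrite ?funeposE ?funenegE.
Qed.

Section integrable.
Variable F : X * Y -> R.
Hypothesis iF : (m1 \x m2)%E.-integrable setT (EFin \o F).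
Let mF : measurable_fun setT F. Proof. exact: integrableR_meas iF. Qed.

Lemma ae_slice1 :
  {ae m1, forall x, m2.-integrable setT (EFin \o (fun y => F (x, y)))}.
Proof. exact: (ae_integrable1 iF). Qed.

Lemma ae_slice2 :
  {ae m2, forall y, m1.-integrable setT (EFin \o (fun x => F (x, y)))}.
Proof. exact: (ae_integrable2 iF). Qed.

(** Only almost everywhere: where the slice is not integrable the extended integral is infinite, and
    its [fine] is the default value 0. *)
Lemma ae_Rint1 :
  {ae m1, forall x, (\int[m2]_y (F (x, y))%:E = (\int[m2]_y F (x, y))%:E)%E}.
Proof. by move: ae_slice1; apply: filterS => x ?; rewrite -Rint_EFin. Qed.

Lemma integrable_Rint1 :
  m1.-integrable setT (EFin \o (fun x => \int[m2]_y F (x, y))).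
Proof.
have := integrable_fubini_F iF => /integrableP[mI Ilt].
apply: integrableR; first exact: meas_Rint1.
move: Ilt; apply: le_lt_trans.
rewrite le_eqVlt; apply/orP; left; apply/eqP.
apply: ae_eq_integral => //.
- by apply/measurable_EFinP/meas_norm/meas_Rint1.
- exact: measurableT_comp.
by move: ae_Rint1; apply: filterS => x /= e _; rewrite /fubini_F /= e.
Qed.

Lemma Rint_fubini1 :
  \int[m1]_x \int[m2]_y F (x, y) = \int[(m1 \x m2)%E]_z F z.
Proof.
rewrite /Rintegral; congr fine.
rewrite -(integral12_prod_meas1 iF).
apply: ae_eq_integral => //.
- by apply/measurable_EFinP/meas_Rint1.
- exact: measurable_fubini_F iF.
by move: ae_Rint1; apply: filterS => x /= e _; rewrite /fubini_F /= e.
Qed.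

Lemma ae_Rint2 :
  {ae m2, forall y, (\int[m1]_x (F (x, y))%:E = (\int[m1]_x F (x, y))%:E)%E}.
Proof. by move: ae_slice2; apply: filterS => y ?; rewrite -Rint_EFin. Qed.

Lemma integrable_Rint2 :
  m2.-integrable setT (EFin \o (fun y => \int[m1]_x F (x, y))).
Proof.
apply: integrableR; first exact: meas_Rint2.
have mn : measurable_fun setT (fun p => `|F p|%:E) by meas.
have := iF; rewrite integrable21ltyP; last exact: measurable_int iF.
apply: le_lt_trans.
apply: ge0_le_integral => //.
- by apply/measurable_EFinP/meas_norm/meas_Rint2.
- exact: (meas_eint2 mn).
(* [fine] sends infinite values to 0, so the real integral is dominated by the extended one for
   every [y], integrable slice or not. *)
move=> y _; apply: (@le_trans _ _ `|\int[m1]_x (F (x, y))%:E|%E).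
  by rewrite /Rintegral; case: (\int[m1]_x (F (x, y))%:E)%E => //=; rewrite normr0 leey.
by apply: le_abse_integral => //; apply/measurable_EFinP; exact: meas_slice2.
Qed.

Lemma Rint_fubini2 :
  \int[m2]_y \int[m1]_x F (x, y) = \int[(m1 \x m2)%E]_z F z.
Proof.
rewrite /Rintegral; congr fine.
rewrite -(integral21_prod_meas1 iF).
apply: ae_eq_integral => //.
- by apply/measurable_EFinP/meas_Rint2.
- exact: measurable_fubini_G iF.
by move: ae_Rint2; apply: filterS => x /= e _; rewrite /fubini_G /= e.
Qed.

Lemma Rint_fubini :
  \int[m1]_x \int[m2]_y F (x, y) = \int[m2]_y \int[m1]_x F (x, y).
Proof. by rewrite Rint_fubini1 Rint_fubini2. Qed.

End integrable.

Lemma tonelli1 (F : X * Y -> \bar R) : measurable_fun setT F ->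
  (forall p, (0 <= F p)%E) ->
  (\int[m1 \x m2]_p F p = \int[m1]_x \int[m2]_y F (x, y))%E.
Proof. by move=> mF F0; rewrite fubini_tonelli1. Qed.

Lemma tonelli2 (F : X * Y -> \bar R) : measurable_fun setT F ->
  (forall p, (0 <= F p)%E) ->
  (\int[m1 \x m2]_p F p = \int[m2]_y \int[m1]_x F (x, y))%E.
Proof. by move=> mF F0; rewrite fubini_tonelli2. Qed.

Lemma meas_tensor (f : X -> R) (g : Y -> R) : measurable_fun setT f -> measurable_fun setT g ->
  measurable_fun setT (fun p : X * Y => f p.1 * g p.2).
Proof.
move=> mf mg; apply: measurable_funM.
  by apply: (meas_comp mf); meas.
by apply: (meas_comp mg); meas.
Qed.

Section tensor.
Variables (f : X -> R) (g : Y -> R).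

Lemma ge0_int_tensor : measurable_fun setT f -> measurable_fun setT g ->
  (forall x, 0 <= f x) -> (forall x, 0 <= g x) ->
  (\int[m1 \x m2]_p (f p.1 * g p.2)%:E =
   \int[m1]_x (f x)%:E * \int[m2]_y (g y)%:E)%E.
Proof.
move=> mf mg f0 g0; rewrite tonelli1; last 2 first.
- by apply/measurable_EFinP; exact: meas_tensor.
- by move=> p; rewrite lee_fin mulr_ge0.
under eq_integral do rewrite /= ge0_intZ//.
rewrite ge0_integralZr//; by [meas | move=> x _; rewrite lee_fin | exact: int_ge0].
Qed.

Lemma integrable_tensor : m1.-integrable setT (EFin \o f) ->
  m2.-integrable setT (EFin \o g) ->
  (m1 \x m2)%E.-integrable setT (EFin \o (fun p => f p.1 * g p.2)).
Proof.
move=> fi gi; have mf := integrableR_meas fi; have mg := integrableR_meas gi.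
apply: integrableR; first exact: meas_tensor.
under eq_integral do rewrite normrM.
rewrite tonelli1; last 2 first.
- apply/measurable_EFinP; apply: (@meas_tensor (fun x => `|f x|) (fun y => `|g y|)).
    by meas.
  by meas.
- by move=> p; rewrite lee_fin mulr_ge0.
have mng : measurable_fun setT (fun y => `|g y|) by meas.
under eq_integral do rewrite /= ge0_intZ//.
rewrite ge0_integralZr//; try by [meas | move=> x _; rewrite lee_fin | exact: int_ge0].
rewrite lte_mul_pinfty//; first exact: int_ge0.
  rewrite ge0_fin_numE ?int_ge0//; exact: integrableR_lty.
exact: integrableR_lty.
Qed.

Lemma Rint_tensor : m1.-integrable setT (EFin \o f) ->
  m2.-integrable setT (EFin \o g) ->
  \int[(m1 \x m2)%E]_p (f p.1 * g p.2) = (\int[m1]_x f x) * (\int[m2]_y g y).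
Proof.
move=> fi gi; rewrite -Rint_fubini1; last exact: integrable_tensor.
under eq_Rintegral do rewrite /= RintegralZl//=.
by rewrite RintegralZr.
Qed.

End tensor.
End fubini_real.

Section convergence.
Context d (T : measurableType d) (R : realType) (m : {measure set T -> \bar R}).

(** Stated for any filter, as it serves both for sequences and for [l --> +oo]. *)
Lemma cvge0_le (I : Type) (F : set_system I) {FF : Filter F} (f : I -> \bar R) :
  (forall i, (0 <= f i)%E) ->
  (forall e : R, 0 < e -> \forall i \near F, (f i <= e%:E)%E) -> f @ F --> 0%E.
Proof.
move=> f0 fe; apply/fine_cvgP; split.
  have := fe 1 ltr01; apply: filterS => i fi.
  by rewrite ge0_fin_numE// (le_lt_trans fi)// ltry.
apply/cvgr0Pnorm_le => e e0; have := fe e e0; apply: filterS => i fi /=.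
have ff : f i \is a fin_num by rewrite ge0_fin_numE// (le_lt_trans fi)// ltry.
by rewrite ger0_norm ?fine_ge0// -lee_fin fineK.
Qed.

Lemma cvge0_near (I : Type) (F : set_system I) {FF : Filter F} (f : I -> \bar R) :
  f @ F --> 0%E -> forall e : R, 0 < e -> \forall i \near F, (f i <= e%:E)%E.
Proof.
move=> /fine_cvgP[ff /cvgr0Pnorm_le f0] e e0; have := f0 e e0.
move: ff; apply: filterS2 => i fi fe; rewrite -(fineK fi) lee_fin.
exact: le_trans (ler_norm _) fe.
Qed.

Lemma dct0 (f_ : nat -> T -> R) (g : T -> R) :
  (forall n, measurable_fun setT (f_ n)) ->
  {ae m, forall x, f_ ^~ x @ \oo --> (0 : R)} ->
  m.-integrable setT (EFin \o g) ->
  (forall n x, `|f_ n x| <= g x) ->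
  (fun n => \int[m]_x (f_ n x)%:E)%E @ \oo --> 0%E.
Proof.
move=> mf f0 ig fg.
have mfE n : measurable_fun setT (fun x => (f_ n x)%:E).
  by apply/measurable_EFinP; exact: mf.
have cE : {ae m, forall x, setT x -> (fun n => (f_ n x)%:E) @ \oo --> 0%E}.
  by move: f0; apply: filterS => x fx _; apply/fine_cvgP; split => //; exact: nearW.
have bE : {ae m, forall x (n : nat), setT x -> (`|(f_ n x)%:E| <= (EFin \o g) x)%E}.
  by apply: aeW => x n _ /=; rewrite lee_fin.
have [_ _] := dominated_convergence measurableT mfE (measurable_cst _) cE ig bE.
by rewrite integral0.
Qed.

End convergence.

Section product_sigma_finite.
Context d1 d2 (X : measurableType d1) (Y : measurableType d2) (R : realType).
Variables (m1 : {sigma_finite_measure set X -> \bar R})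
  (m2 : {sigma_finite_measure set Y -> \bar R}).

(* The library registers [m1 \x m2] as sigma-finite only for (sub)probability
   measures, hence this alias. *)
Definition prodm : set (X * Y) -> \bar R := (m1 \x m2)%E.

HB.instance Definition _ := Measure.on prodm.

Let product_sigma_finite : sigma_finite setT prodm.
Proof.
have /sigma_finiteP[F [TF ndF Foo]] := sigma_finiteT m1.
have /sigma_finiteP[G [TG ndG Goo]] := sigma_finiteT m2.
exists (fun i => F i `*` G i).
  rewrite predeqE => -[x y]; split => // _.
  have [i _ Fi] : (\bigcup_i F i) x by rewrite -TF.
  have [j _ Gj] : (\bigcup_i G i) y by rewrite -TG.
  exists (maxn i j) => //; split.
  - by move: Fi; exact/subsetPset/ndF/leq_maxl.
  - by move: Gj; exact/subsetPset/ndG/leq_maxr.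
move=> i; have [mF Fi] := Foo i; have [mG Gi] := Goo i; split.
  exact: measurableX.
by rewrite /prodm product_measure1E// lte_mul_pinfty// ge0_fin_numE.
Qed.

HB.instance Definition _ := @Measure_isSigmaFinite.Build _ _ _
  prodm product_sigma_finite.

End product_sigma_finite.

(** * The Plancherel identity on the line *)

Section real_line.
Variable R : realType.
Local Notation leb := (@lebesgue_measure R).
Implicit Types (f : R -> \bar R).

(** Uniqueness of Lebesgue measure: [c] times the image measure under [x |-> c * x + h] gives every
    interval []a, b]] its length. *)
Lemma ge0_int_affine (c h : R) f : 0 < c -> measurable_fun setT f ->
  (forall x, (0 <= f x)%E) ->
  (\int[leb]_x f (c * x + h)%R = c^-1%:E * \int[leb]_x f x)%E.
Proof.
move=> c0 mf f0.
pose phi : measurableTypeR R -> measurableTypeR R := fun x => c * x + h.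
have mphi : measurable_fun setT phi.
  by apply: measurable_funD => //; exact: measurable_funM.
pose p : {measure set (measurableTypeR R) -> \bar R} :=
  measure_function_pushforward__canonical__measure_function_Measure leb mphi.
have c0' : 0 <= c by exact: ltW.
pose nu : {measure set (measurableTypeR R) -> \bar R} := mscale (NngNum c0') p.
have nuE A : measurable A -> leb A = nu A.
  apply: lebesgue_measure_unique => _ [[a b]] _ <-.
  have pE : phi @^-1` `]a, b]%classic = `](a - h) / c, (b - h) / c]%classic.
    apply/seteqP; split => x /=; rewrite !in_itv/= /phi
      ltr_pdivrMr// ler_pdivlMr// ltrBlDr lerBrDr mulrC//.
  have -> : nu `]a, b]%classic = mule c%:E (leb `](a - h) / c, (b - h) / c]%classic).
    by rewrite -pE.
  rewrite !lebesgue_measure_itv/= !lte_fin ltr_pM2r ?invr_gt0// ltrD2r.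
  case: ifPn => _; last by rewrite mule0.
  by rewrite -!EFinB -EFinM; congr EFin; field; rewrite gt_eqF.
rewrite [in RHS](eq_measure_integral nu); last by move=> A mA _; exact: nuE.
rewrite /nu ge0_integral_mscale//= muleA -EFinM mulVf ?gt_eqF// mul1e.
by rewrite /p ge0_integral_pushforward.
Qed.

Lemma ge0_int_opp f : measurable_fun setT f ->
  (forall x, (0 <= f x)%E) ->
  (\int[leb]_x f (- x)%R = \int[leb]_x f x)%E.
Proof.
move=> mf f0.
apply: esym.
have mopp : measurable_fun setT (-%R : measurableTypeR R -> measurableTypeR R).
  exact: oppr_measurable.
apply: (ge0_int_transfer (mX := leb) (mY := leb) mopp) => // A mA.
exact: (esym (lebesgue_measureN mA)).
Qed.

End real_line.

(** * The Poisson kernel as a cosine transform *)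

Section poisson.
Variable R : realType.
Local Notation leb := (@lebesgue_measure R).

(** [pi] times the Poisson kernel of the upper half-plane at height [e]. *)
Definition pk (e h : R) : R := e / (e ^+ 2 + h ^+ 2).

Lemma pk_ge0 e h : 0 <= e -> 0 <= pk e h.
Proof. by move=> e0; rewrite divr_ge0// addr_ge0// sqr_ge0. Qed.

Lemma int_pk1 : (\int[leb]_x ((1 + x ^+ 2)^-1)%:E = pi%:E)%E.
Proof.
have cf : continuous (fun x : R => (1 + x ^+ 2)^-1).
  move=> x; apply: cvgV; first by rewrite gt_eqF// ltr_pwDl// sqr_ge0.
  apply: cvgD; first exact: cvg_cst.
  exact: exprn_continuous.
have f0 x : (0 <= (1 + x ^+ 2)^-1 :> R) by rewrite invr_ge0 addr_ge0// sqr_ge0.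
rewrite ge0_symfun_integralT//; last by move=> x /=; rewrite sqrrN.
rewrite -set_itvcy (@ge0_continuous_FTC2y _ _ atan 0 (pi / 2))//.
- by rewrite atan0 sube0 -EFinM; congr EFin; field.
- exact: continuous_subspaceT.
- exact: cvgy_atan.
- by apply: cvg_at_right_filter; exact: continuous_atan.
- by move=> x _; rewrite derive1_atan.
Qed.

Lemma int_pk e : 0 < e -> (\int[leb]_x (pk e x)%:E = pi%:E)%E.
Proof.
move=> e0; have e0' : e != 0 by rewrite gt_eqF.
have aff := @ge0_int_affine R e^-1 0 (fun x => (e^-1 * (1 + x ^+ 2)^-1)%:E).
have ei0 : 0 < e^-1 by rewrite invr_gt0.
have mf : measurable_fun setT (fun x : R => (1 + x ^+ 2)^-1).
  apply: continuous_measurable_fun => x.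
  apply: cvgV; first by rewrite gt_eqF// ltr_pwDl// sqr_ge0.
  by apply: cvgD; [exact: cvg_cst|exact: exprn_continuous].
have f0 x : (0 <= (1 + x ^+ 2)^-1 :> R) by rewrite invr_ge0 addr_ge0// sqr_ge0.

transitivity (\int[leb]_x (e^-1 * (1 + (e^-1 * x + 0) ^+ 2)^-1)%:E)%E.
  apply: eq_integral => x _; congr EFin; rewrite /pk addr0.
  by field; rewrite e0' /= gt_eqF// ltr_pwDl// ?exprn_gt0// sqr_ge0.
rewrite aff//; first last.
- by move=> x; rewrite lee_fin mulr_ge0// invr_ge0 ltW.
- by meas.
rewrite invrK ge0_intZ//; last by rewrite invr_ge0 ltW.
by rewrite muleA -EFinM mulfV// mul1e int_pk1.
Qed.

(* The Abel weight on the half-line, whose cosine transform is [pk e]. *)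
Definition wk (e x : R) : R := expR (- (e * x)) * \1_`[0, +oo[ x.

Lemma wk_ge0 e x : 0 <= wk e x.
Proof. by rewrite mulr_ge0// ?expR_ge0. Qed.

Lemma meas_wk e : measurable_fun setT (wk e).
Proof. by rewrite /wk; meas; exact: measurable_indic. Qed.

(** The factor [1 + cos] keeps the integrand nonnegative, as required by the fundamental theorem of
    calculus on a half-line used here; [Rint_wk_cos] removes the 1 by comparing with [h = 0]. *)
Lemma int_wk_gen (e h : R) : 0 < e ->
  (\int[leb]_x (wk e x * (1 + cos (h * x)))%:E = (e^-1 + pk e h)%:E)%E.
Proof.
move=> e0.
transitivity (\int[leb]_(x in `[0%R, +oo[) (expR (- (e * x)) * (1 + cos (h * x)))%:E)%E.
  rewrite [RHS]integral_mkcond; apply: eq_integral => x _.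
  rewrite /patch /wk; case: ifPn => xA; rewrite indicE.
    by rewrite xA mulr1.
  by rewrite (negbTE xA) mulr0 mul0r.
(* A primitive that vanishes at infinity; [- F 0] is [e^-1 + pk e h]. *)
pose F (x : R) := - (expR (- (e * x)) * e^-1) +
  expR (- (e * x)) * ((h * sin (h * x) - e * cos (h * x)) / (e ^+ 2 + h ^+ 2)).
have D0 : e ^+ 2 + h ^+ 2 != 0 by rewrite gt_eqF// ltr_pwDl// ?exprn_gt0// sqr_ge0.
have dF (x : R) : is_derive x 1 F (expR (- (e * x)) * (1 + cos (h * x))).
  rewrite /F.
  have dM (c : R) : is_derive x 1 (fun x => c * x) c.
    by apply: is_derive_eq; rewrite /GRing.scale/= mulr1.
  have dE : is_derive x 1 (fun x => expR (- (e * x))) (- e * expR (- (e * x))).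
    have d1 : is_derive x 1 (fun x => - (e * x)) (- e).
      by have := @is_deriveN _ _ _ (fun x => e * x) x 1 e (dM e).
    rewrite mulrC; exact: (@is_derive1_comp _ expR (fun x => - (e * x)) x).
  have dS : is_derive x 1 (fun x => sin (h * x)) (h * cos (h * x)).
    have dh := dM h.
    rewrite mulrC; exact: (@is_derive1_comp _ sin (fun x => h * x) x).
  have dC : is_derive x 1 (fun x => cos (h * x)) (- h * sin (h * x)).
    have dh := dM h.
    rewrite mulNr mulrC -mulNr; exact: (@is_derive1_comp _ cos (fun x => h * x) x).
  apply: is_derive_eq; rewrite /GRing.scale/=.
  by field; rewrite D0 gt_eqF.
have cf : continuous (fun x : R => expR (- (e * x)) * (1 + cos (h * x))).
  move=> x; apply: cvgM.
    apply: continuous_comp; last exact: continuous_expR.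
    by apply: cvgN; exact: mulrl_continuous.
  apply: cvgD; first exact: cvg_cst.
  by apply: continuous_comp; [exact: mulrl_continuous|exact: continuous_cos].
have F0 : F x @[x --> +oo] --> (0 : R).
  have E0 : expR (- (e * x)) @[x --> +oo] --> (0 : R).
    apply: (@cvg_comp _ _ _ (fun x => e * x) (fun x => expR (- x)) _ +oo).
      by apply: gt0_cvgMry.
    exact: cvgr_expR.
  have -> : (0 : R) = - (0 * e^-1) + 0 by rewrite mul0r oppr0 addr0.
  apply: cvgD; first by apply: cvgN; apply: cvgM => //; exact: cvg_cst.
  pose M := (`|h| + e) / (e ^+ 2 + h ^+ 2).
  have ME : M * expR (- (e * x)) @[x --> +oo] --> (0 : R).
    by rewrite -(mulr0 M); apply: cvgM => //; exact: cvg_cst.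
  have bnd x : `|expR (- (e * x)) * ((h * sin (h * x) - e * cos (h * x)) / (e ^+ 2 + h ^+ 2))|
      <= M * expR (- (e * x)).
    rewrite normrM ger0_norm ?expR_ge0// [leRHS]mulrC ler_wpM2l ?expR_ge0//.
    have D1 : `|e ^+ 2 + h ^+ 2| = e ^+ 2 + h ^+ 2 by rewrite ger0_norm ?addr_ge0 ?sqr_ge0.
    rewrite normrM normfV D1 /M.
    rewrite ler_wpM2r ?invr_ge0 ?addr_ge0 ?sqr_ge0//.
    rewrite (le_trans (ler_normB _ _))// !normrM lerD//.
      by rewrite ler_piMr// ler_norml sin_geN1 sin_le1.
    by rewrite (ger0_norm (ltW e0)) ler_piMr ?(ltW e0)// ler_norml cos_geN1 cos_le1.
  apply: (@squeeze_cvgr _ _ _ _ (fun x => - (M * expR (- (e * x)))) (fun x => M * expR (- (e * x)))).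
  - by near=> x; have := bnd x; rewrite ler_norml.
  - by rewrite -oppr0; exact: cvgN.
  - exact: ME.
rewrite (@ge0_continuous_FTC2y _ _ F 0 0)//.
- rewrite -EFinB; congr EFin; rewrite /F !mulr0 oppr0 expR0 sin0 cos0 /pk.
  by field; rewrite D0 gt_eqF.
- exact: continuous_subspaceT.
- by apply: cvg_at_right_filter; apply: differentiable_continuous; apply/derivable1_diffP; case: (dF 0).
- by move=> x _; rewrite derive1E; case: (dF x).
Unshelve. all: by end_near. Qed.

Lemma integrable_wk e : 0 < e -> leb.-integrable setT (EFin \o wk e).
Proof.
move=> e0; apply: ge0_integrableR; [exact: meas_wk|exact: wk_ge0|].
apply: (@le_lt_trans _ _ (\int[leb]_x (wk e x * (1 + cos (0 * x)))%:E)%E).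
  apply: ge0_le_intR; [exact: meas_wk| |exact: wk_ge0|].
    by have mw := meas_wk e; meas.
  by move=> x; rewrite mul0r cos0 ler_peMr ?wk_ge0// lerDl.
by rewrite int_wk_gen// ltry.
Qed.

Lemma Rint_wk_cos e h : 0 < e -> \int[leb]_x (wk e x * cos (h * x)) = pk e h.
Proof.
move=> e0; have iw := integrable_wk e0; have mw := meas_wk e.
have ic k : leb.-integrable setT (EFin \o (fun x => wk e x * cos (k * x))).
  apply: integrable_mulb => //; first by meas.
  by move=> x; rewrite ler_norml cos_geN1 cos_le1.
have E k : \int[leb]_x wk e x + \int[leb]_x (wk e x * cos (k * x)) = e^-1 + pk e k.
  rewrite -RintegralD//.
  rewrite /Rintegral; under eq_integral do rewrite -{1}[wk e _]mulr1 -mulrDr.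
  by rewrite int_wk_gen.
have E0 := E 0.
have w0 : \int[leb]_x (wk e x * cos (0 * x)) = \int[leb]_x wk e x.
  by apply: eq_Rintegral => x _; rewrite mul0r cos0 mulr1.
have : \int[leb]_x wk e x = e^-1.
  move: E0; rewrite w0 /pk expr0n/= addr0 expr2 invfM mulrA mulfV ?gt_eqF// mul1r; lra.
by move=> H; move: (E h); rewrite H => /addrI.
Qed.

End poisson.

(** * Continuity of translations in L2 *)

Section translation.
Variable R : realType.
Local Notation leb := (@lebesgue_measure R).
Implicit Types a b : R -> R.

Lemma near_ltr (x c : R) : x < c -> \forall y \near x, y < c.
Proof. by move=> xc; exact: (cvgr_lt x cvg_id). Qed.

Lemma near_gtr (x c : R) : c < x -> \forall y \near x, c < y.
Proof. by move=> xc; exact: (cvgr_gt x cvg_id). Qed.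

Definition tdiff a (h : R) : \bar R := (\int[leb]_x ((a (x + h) - a x) ^+ 2)%:E)%E.

(** Continuity at 0 along sequences: the form in which dominated convergence delivers it and
    [defect_cvg0] consumes it. *)
Definition tcont a := forall u : nat -> R, u @ \oo --> (0 : R) ->
  (fun n => tdiff a (u n)) @ \oo --> 0%E.

Lemma tdiff_ge0 a h : (0 <= tdiff a h)%E.
Proof. by apply: int_ge0 => x; exact: sqr_ge0. Qed.

Lemma meas_shift a (h : R) : measurable_fun setT a ->
  measurable_fun setT (fun x : R => a (x + h)).
Proof. by move=> ma; apply: (meas_comp ma); meas. Qed.

Lemma int_shift (f : R -> \bar R) h : measurable_fun setT f ->
  (forall x, (0 <= f x)%E) -> (\int[leb]_x f (x + h)%R = \int[leb]_x f x)%E.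
Proof.
move=> mf f0; have := @ge0_int_affine R 1 h f ltr01 mf f0.
by rewrite invr1 mul1e => <-; under [in RHS]eq_integral do rewrite mul1r.
Qed.

Lemma int_sqr_shift a h : measurable_fun setT a ->
  (\int[leb]_x (a (x + h) ^+ 2)%:E = \int[leb]_x (a x ^+ 2)%:E)%E.
Proof.
move=> ma; apply: (@int_shift (fun x => (a x ^+ 2)%:E)).
  by meas.
by move=> x; rewrite lee_fin sqr_ge0.
Qed.

Lemma tdiff_le a h : measurable_fun setT a ->
  (tdiff a h <= 4%:E * \int[leb]_x (a x ^+ 2)%:E)%E.
Proof.
move=> ma; have ms := meas_shift h ma.
have mn : measurable_fun setT (fun x => - a x) by meas.
apply: le_trans (L2D leb ms mn) _.
under [X in (_ + _ * X <= _)%E]eq_integral do rewrite sqrrN.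
rewrite int_sqr_shift// -ge0_muleDl// -EFinD.
by rewrite (_ : 2 + 2 = 4)//; lra.
Qed.

Lemma tcont_closed a : measurable_fun setT a ->
  (forall e, 0 < e -> exists b, [/\ measurable_fun setT b, tcont b &
     (\int[leb]_x ((a x - b x) ^+ 2)%:E <= e%:E)%E]) -> tcont a.
Proof.
move=> ma ab u u0; apply: cvge0_le => [n|e e0]; first exact: tdiff_ge0.
(* [tdiff a] is at most [2 * tdiff (a - b) + 2 * tdiff b], and [tdiff_le] bounds [tdiff (a - b)] by
   4 times the squared error: [2 * 4 + 2 = 10]. *)
have e10 : 0 < e / 10 by rewrite divr_gt0.
have [b [mb tb abe]] := ab _ e10.
have tn : \forall n \near \oo, (tdiff b (u n) <= (e / 10)%:E)%E.
  by apply: cvge0_near => //; exact: tb.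
near=> n; have tn1 : (tdiff b (u n) <= (e / 10)%:E)%E by near: n.
have mc : measurable_fun setT (fun x => a x - b x) by meas.
have E x : a (x + u n) - a x = ((a (x + u n) - b (x + u n)) - (a x - b x)) +
    (b (x + u n) - b x) by ring.
rewrite /tdiff; under eq_integral do rewrite E.
have ms := meas_shift (u n) mc; have msb := meas_shift (u n) mb.
apply: le_trans (L2D leb _ _) _; try by meas.
have := tdiff_le (u n) mc; rewrite /tdiff => H1.
apply: (@le_trans _ _ (2%:E * (4%:E * (e / 10)%:E) + 2%:E * (e / 10)%:E)%E).
  apply: leeD; apply: lee_wpmul2l => //; apply: le_trans H1 _.
  exact: lee_wpmul2l.
by rewrite -!EFinM -EFinD lee_fin; lra.
Unshelve. all: by end_near. Qed.

(** Dominated convergence: the truncated function is continuous off the two endpoints, and its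
    increments along a bounded sequence of steps all vanish outside one interval [[- L, L]]. *)
Lemma tcont_cutoff (g : R -> R) (N : R) M : continuous g -> (forall x, `|g x| <= M) ->
  tcont (fun x => g x * \1_`[- N, N] x).
Proof.
move=> cg gM u u0.
have [K [_ uK]] := cvg_seq_bounded (cvgP _ u0).
have {}uK n : `|u n| <= `|K| + 1 by apply: uK; [rewrite (le_lt_trans (ler_norm _))// ltrDl|].
pose L := `|N| + `|K| + 1.
have M0 : 0 <= M by exact: le_trans (gM 0).
have mg : measurable_fun setT g by exact: continuous_measurable_fun.
pose b := fun x => g x * \1_`[- N, N] x.
have mb : measurable_fun setT b.
  by apply: measurable_funM => //; exact: measurable_indic.
have bM x : `|b x| <= M * \1_`[- N, N] x.
  by rewrite /b normrM (ger0_norm (_ : 0 <= \1_`[- N, N] x))// ler_wpM2r.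
have iind : leb.-integrable setT (EFin \o (fun x => (4 * M ^+ 2) * \1_`[- L, L] x)).
  by apply: integrableZR; exact: integrable_indic_itv.
apply: (dct0 (m := leb) (f_ := fun n x => (b (x + u n) - b x) ^+ 2) _ _ iind).
- by move=> n; have ms := meas_shift (u n) mb; meas.
- have : {ae leb, forall x : R, x != N}.
    exists [set N]; split=> //; first exact: lebesgue_measure_set1.
    by move=> x /= /negP; rewrite negbK => /eqP.
  have : {ae leb, forall x : R, x != - N}.
    exists [set - N]; split=> //; first exact: lebesgue_measure_set1.
    by move=> x /= /negP; rewrite negbK => /eqP.
  have FF : Filter (almost_everywhere leb) by exact: ae_filter_ringOfSetsType.
  apply: (@filterS2 _ _ FF) => x xN xN'.
  have cb : {for x, continuous b}.
    have [xI|xI] := boolP ((- N <= x) && (x <= N)).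
      have {xI}xI : (- N < x) && (x < N).
        by move: xI; rewrite !le_eqVlt eq_sym (negbTE xN) (negbTE xN').
      apply: cvg_trans (_ : g @ x --> b x); last first.
        rewrite /b indicE mem_set ?mulr1 //=; first exact: cg.
        by rewrite in_itv/=; case/andP: xI => /ltW-> /ltW->.
      apply: near_eq_cvg; case/andP: xI => x1 x2; near=> y.
      rewrite /b indicE mem_set ?mulr1//= in_itv/=; apply/andP; split; apply: ltW; near: y.
        exact: near_gtr.
      exact: near_ltr.
    have b0 y : ~~ ((- N <= y) && (y <= N)) -> b y = 0.
      by move=> yI; rewrite /b indicE memNset ?mulr0//= in_itv/=; apply/negP.
    apply: cvg_trans (_ : (fun=> 0) @ x --> b x); last by rewrite b0//; exact: cvg_cst.
    apply: near_eq_cvg; move: xI; rewrite negb_and -!ltNge => /orP[xI|xI]; near=> y; rewrite b0//.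
      by rewrite negb_and -!ltNge; apply/orP; left; near: y; exact: near_ltr.
    by rewrite negb_and -!ltNge; apply/orP; right; near: y; exact: near_gtr.
  have c0 : (fun n => b (x + u n) - b x) @ \oo --> (0 : R).
    rewrite -(subrr (b x)); apply: cvgB; last exact: cvg_cst.
    apply: (@cvg_comp _ _ _ (fun n => x + u n) b _ (nbhs x)) => //.
    have : (fun n => x + u n) @ \oo --> x + 0 by apply: cvgD => //; exact: cvg_cst.
    by rewrite addr0.
  rewrite -[X in _ --> X](mulr0 (0 : R)).
  under eq_fun do rewrite expr2.
  exact: cvgM.
move=> n x.
rewrite ger0_norm ?sqr_ge0//.
have b1 := bM x; have b2 := bM (x + u n).
rewrite indicE; have [xL|xL] := boolP (x \in `[- L, L]%classic).
  rewrite mulr1 -real_normK ?num_real//.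
  have i1 (y : R) : \1_`[- N, N] y <= 1 :> R by rewrite indicE; case: (_ \in _).
  have : `|b (x + u n) - b x| <= 2 * M.
    rewrite (le_trans (ler_normB _ _))// mulr_natl mulr2n lerD//.
      by rewrite (le_trans b2)// ler_piMr.
    by rewrite (le_trans b1)// ler_piMr.
  have := normr_ge0 (b (x + u n) - b x); nra.
have uKn := uK n.
have bN y : L < `|y| + (`|K| + 1) -> b y = 0.
  move=> yL; rewrite /b indicE memNset ?mulr0//= in_itv/=; apply/negP.
  rewrite -ler_norml -ltNge; apply: (@le_lt_trans _ _ `|N|); first exact: ler_norm.
  by move: yL; rewrite /L addrA; lra.
have {}xL : L < `|x|.
  by move: xL; rewrite notin_setE/= in_itv/= => /negP; rewrite -ler_norml -ltNge.
rewrite !bN ?subrr ?expr0n ?mulr0//=; first by rewrite ltr_wpDr ?addr_ge0.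
have := ler_normD (x + u n) (- u n); rewrite addrK normrN; lra.
Unshelve. all: by end_near. Qed.

End translation.

Section translation_L2.
Variable R : realType.
Local Notation leb := (@lebesgue_measure R).
Implicit Types a b : R -> R.

(** The approximation by continuous functions is in L1. Clipping the approximant to [[- M, M]]
    brings it no further from [a], and then [(a - g1)^2 <= 2 * M * |a - g n|] converts the L1 error
    into an L2 error. *)
Lemma tcont_bounded a (N M : R) : 0 <= M -> measurable_fun setT a ->
  (forall x, `|a x| <= M * \1_`[- N, N] x) -> tcont a.
Proof.
move=> M0 ma aM.
apply: tcont_closed => // e e0.
have iE : leb.-integrable `[- N, N] (EFin \o a).
  apply/integrable_mkcond; first exact: measurable_itv.
  have -> : (EFin \o a) \_ `[- N, N] = EFin \o a.
    apply/funext => x; rewrite /patch; case: ifPn => // xN.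
    have := aM x; rewrite indicE (negbTE xN) mulr0 normr_le0 => /eqP.
    by move=> /= ->.
  have ii : leb.-integrable setT (EFin \o (fun x => M * \1_`[- N, N] x)).
    by apply: integrableZR; exact: integrable_indic_itv.
  have H := (@integrable_le _ _ _ leb _ _ ma ii).
  exact (H aM).
have lE : (leb `[(- N)%R, N]%classic < +oo)%E.
  by rewrite lebesgue_measure_itv/=; case: ifPn => _; rewrite ?ltry// -EFinB ltry.
have [g [cg ig g0]] := approximation_continuous_integrable (measurable_itv _) lE iE.
have e1 : 0 < e / (2 * M + 1) by rewrite divr_gt0// ltr_pwDr// mulr_ge0.
have [n _ gn] : \forall n \near \oo,
    (\int[leb]_(z in `[(- N)%R, N]) `|(a z - g n z)%:E| <= (e / (2 * M + 1))%:E)%E.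
  by apply: cvge0_near.
have {}gn := gn n (leqnn n).
pose g1 x := Num.max (- M) (Num.min M (g n x)).
have cg1 : continuous g1.
  move=> x; apply: (@continuous_max _ _ (fun=> - M) (fun x => Num.min M (g n x))).
    exact: cvg_cst.
  by apply: (@continuous_min _ _ (fun=> M) (g n)); [exact: cvg_cst|exact: cg].
have g1M x : `|g1 x| <= M.
  rewrite ler_norml /g1 le_max lexx/= ge_max ge_min lexx/= andbT.
  by rewrite -subr_ge0 opprK addr_ge0.
have g1a x : (a x - g1 x) ^+ 2 <= 2 * M * `|a x - g n x| * 1.
  have : `|a x| <= M.
    by rewrite (le_trans (aM x))// ler_piMr// indicE; case: (_ \in _).
  rewrite mulr1 ler_norml => /andP[a1 a2]; have := g1M x; rewrite ler_norml => /andP[b1 b2].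
  have h : `|a x - g1 x| <= `|a x - g n x|.
    have h1 := ler_norm (a x - g n x); have h2 := ler_norm (- (a x - g n x)).
    rewrite normrN in h2.
    have [gM|gM] := leP (g n x) M.
      rewrite /g1 (min_r gM); have [gM'|gM'] := leP (- M) (g n x).
        by rewrite ?(max_r gM').
      by rewrite ?(max_l (ltW gM')) ler_norml; apply/andP; split; lra.
    rewrite /g1 (min_l (ltW gM)) max_r; last by lra.
    by rewrite ler_norml; apply/andP; split; lra.
  rewrite -real_normK ?num_real// expr2 ler_pM//.
  by rewrite ler_norml; apply/andP; split; lra.
have mg1 : measurable_fun setT g1 by exact: continuous_measurable_fun.
have mb : measurable_fun setT (fun x => g1 x * \1_`[- N, N] x).
  by apply: measurable_funM => //; exact: measurable_indic.
exists (fun x => g1 x * \1_`[- N, N] x); split => //; first exact: tcont_cutoff cg1 g1M.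
apply: (@le_trans _ _ (\int[leb]_(z in `[(- N)%R, N]) ((2 * M) * `|a z - g n z|)%:E)%E).
  rewrite [leRHS]integral_mkcond; apply: ge0_le_integral => //.
  - by move=> x _; rewrite lee_fin sqr_ge0.
  - by meas.
  - apply/(measurable_restrictT _ (measurable_itv _)); apply: measurable_funTS.
    have mgn : measurable_fun setT (g n) by apply: continuous_measurable_fun; exact: cg.
    by meas.
  move=> x _; rewrite /patch indicE; case: ifPn => xN; rewrite lee_fin.
    by rewrite ?xN mulr1; have := g1a x; rewrite mulr1.
  have := aM x; rewrite indicE (negbTE xN) !mulr0 normr_le0 => /eqP ->.
  by rewrite subrr expr0n.
under eq_integral do rewrite EFinM.
rewrite ge0_integralZl_EFin//; last 2 first.
- apply: measurable_funTS.
  have mgn : measurable_fun setT (g n) by apply: continuous_measurable_fun; exact: cg.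
  by meas.
- by rewrite mulr_ge0.
apply: (@le_trans _ _ ((2 * M)%:E * (e / (2 * M + 1))%:E)%E).
  by apply: lee_wpmul2l => //; rewrite lee_fin mulr_ge0.
rewrite -EFinM lee_fin mulrA ler_pdivrMr ?ltr_pwDr ?mulr_ge0//; nra.
Qed.

(** Truncate [a] to the set where both the argument and the value are at most [n]; the squared error
    is dominated by [a^2]. *)
Lemma tcont_L2 a : measurable_fun setT a ->
  (\int[leb]_x (a x ^+ 2)%:E < +oo)%E -> tcont a.
Proof.
move=> ma a2; apply: tcont_closed => // e e0.
pose A (n : nat) := [set x | `|x| <= n%:R] `&` [set x | `|a x| <= n%:R].
have mA n : measurable (A n).
  have mle (f : R -> R) : measurable_fun setT f -> measurable [set x | `|f x| <= n%:R].
    move=> mf; rewrite -[X in measurable X]setTI.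
    have -> : [set x | `|f x| <= n%:R] = (fun x => `|f x|) @^-1` `]-oo, n%:R].
      by apply/seteqP; split => x /=; rewrite in_itv.
    have mnf : measurable_fun setT (fun x => `|f x|) by meas.
    by apply: mnf => //; exact: measurable_itv.
  by apply: measurableI; apply: mle => //; exact: measurable_id.
pose b n x := a x * \1_(A n) x.
have mb n : measurable_fun setT (b n).
  by apply: measurable_funM => //; exact: measurable_indic.
have tb n : tcont (b n).
  apply: (@tcont_bounded _ n%:R n%:R) => // x; rewrite /b !indicE normrM.
  have [|_] := boolP (x \in A n); last by rewrite normr0 mulr0 mulr_ge0.
  rewrite inE => -[/= xn axn]; rewrite normr1 mulr1 mem_set ?mulr1//= in_itv/=.
  by rewrite -ler_norml.
have [n _ bn] : \forall n \near \oo, (\int[leb]_x ((a x - b n x) ^+ 2)%:E <= e%:E)%E.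
  apply: cvge0_near => //.
  apply: (dct0 (m := leb) (f_ := fun n x => (a x - b n x) ^+ 2) (g := fun x => a x ^+ 2)).
  - by move=> n; have mbn := mb n; meas.
  - apply: aeW => x; pose K := Num.bound (`|x| + `|a x|).
    have Kb : `|x| + `|a x| < K%:R by apply: archi_boundP; rewrite addr_ge0.
    apply: cvg_near_cst; exists K => // n /= Kn.
    have Kn' : (K%:R : R) <= n%:R by rewrite ler_nat.
    rewrite /b indicE mem_set ?mulr1 ?subrr ?expr0n//; split => /=.
      by rewrite (le_trans _ Kn')// (le_trans _ (ltW Kb))// lerDl.
    by rewrite (le_trans _ Kn')// (le_trans _ (ltW Kb))// lerDr.
  - apply: ge0_integrableR => //; first by meas.
    by move=> x; rewrite sqr_ge0.
  move=> n x; rewrite ger0_norm ?sqr_ge0// /b indicE.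
  by case: (_ \in _); rewrite ?mulr1 ?subrr ?mulr0 ?subr0 ?expr0n ?sqr_ge0.
by exists (b n); split => //; exact: (bn n (leqnn n)).
Qed.

End translation_L2.

(** * Cosine and sine transforms for an abstract phase *)

Section phase.
Context d (T : measurableType d) (R : realType) (m : {sigma_finite_measure set T -> \bar R}).
Variable th : T * T -> R.
Hypothesis mth : measurable_fun setT th.
Implicit Types a b : T -> R.

(** The phase [th] stays abstract so that one set of definitions serves the line, products (where
    phases add) and row vectors. *)
Definition Fc a xi := \int[m]_x (a x * cos (th (x, xi))).
Definition Fs a xi := \int[m]_x (a x * sin (th (x, xi))).
(* The squared modulus of the transform of [a + i b]. Complex functions are
   needed even for real data: in a product, the partial transform in the first
   variable is complex. *)
Definition Fsq a b xi := (Fc a xi + Fs b xi) ^+ 2 + (Fc b xi - Fs a xi) ^+ 2.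

Lemma Fsq_real a xi : Fsq a (fun=> 0) xi = Fc a xi ^+ 2 + Fs a xi ^+ 2.
Proof.
have E (g : T -> R) : \int[m]_x (0 * g x) = 0.
  by under eq_Rintegral do rewrite mul0r; rewrite Rintegral_cst ?mul0r.
have C0 : Fc (fun=> 0) xi = 0 by exact: E.
have S0 : Fs (fun=> 0) xi = 0 by exact: E.
by rewrite /Fsq C0 S0 addr0 sub0r sqrrN.
Qed.

Definition plancherel (kappa : R) := forall a b, nice m a -> nice m b ->
  (\int[m]_xi (Fsq a b xi)%:E =
   kappa%:E * \int[m]_x (a x ^+ 2 + b x ^+ 2)%:E)%E.

Lemma Fsq_ge0 a b xi : 0 <= Fsq a b xi.
Proof. by rewrite addr_ge0// sqr_ge0. Qed.

Lemma cos_norm1 (x : R) : `|cos x| <= 1.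
Proof. by rewrite ler_norml cos_geN1 cos_le1. Qed.

Lemma sin_norm1 (x : R) : `|sin x| <= 1.
Proof. by rewrite ler_norml sin_geN1 sin_le1. Qed.

Lemma meas_th2 xi : measurable_fun setT (fun x => th (x, xi)).
Proof. exact: meas_slice2. Qed.

Lemma meas_Fc a : measurable_fun setT a -> measurable_fun setT (Fc a).
Proof.
move=> ma; apply: (meas_Rint2 m (F := fun p => a p.1 * cos (th (p.1, p.2)))).
have ma1 : measurable_fun setT (fun p : T * T => a p.1) by apply: (meas_comp ma); meas.
have mt : measurable_fun setT (fun p : T * T => th (p.1, p.2)) by apply: (meas_comp mth); meas.
by meas.
Qed.

Lemma meas_Fs a : measurable_fun setT a -> measurable_fun setT (Fs a).
Proof.
move=> ma; apply: (meas_Rint2 m (F := fun p => a p.1 * sin (th (p.1, p.2)))).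
have ma1 : measurable_fun setT (fun p : T * T => a p.1) by apply: (meas_comp ma); meas.
have mt : measurable_fun setT (fun p : T * T => th (p.1, p.2)) by apply: (meas_comp mth); meas.
by meas.
Qed.

Lemma meas_Fsq a b : measurable_fun setT a -> measurable_fun setT b ->
  measurable_fun setT (Fsq a b).
Proof.
move=> ma mb; have h1 := meas_Fc ma; have h2 := meas_Fc mb; have h3 := meas_Fs ma.
have h4 := meas_Fs mb; rewrite /Fsq; meas.
Qed.

Lemma integrable_cos a xi : m.-integrable setT (EFin \o a) ->
  m.-integrable setT (EFin \o (fun x => a x * cos (th (x, xi)))).
Proof.
move=> ia; apply: integrable_mulb => //; last by move=> x; exact: cos_norm1.
by have h := meas_th2 xi; meas.
Qed.

Lemma integrable_sin a xi : m.-integrable setT (EFin \o a) ->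
  m.-integrable setT (EFin \o (fun x => a x * sin (th (x, xi)))).
Proof.
move=> ia; apply: integrable_mulb => //; last by move=> x; exact: sin_norm1.
by have h := meas_th2 xi; meas.
Qed.

Lemma FcB a b xi : m.-integrable setT (EFin \o a) -> m.-integrable setT (EFin \o b) ->
  Fc (fun x => a x - b x) xi = Fc a xi - Fc b xi.
Proof.
move=> ia ib; rewrite /Fc; under eq_Rintegral do rewrite mulrBl.
by rewrite RintegralB//; exact: integrable_cos.
Qed.

Lemma FsB a b xi : m.-integrable setT (EFin \o a) -> m.-integrable setT (EFin \o b) ->
  Fs (fun x => a x - b x) xi = Fs a xi - Fs b xi.
Proof.
move=> ia ib; rewrite /Fs; under eq_Rintegral do rewrite mulrBl.
by rewrite RintegralB//; exact: integrable_sin.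
Qed.

(** Makes the squared modulus linear in a kernel, so that a weight in [xi] can be integrated against
    it under Fubini. *)
Lemma Fc2Fs2 a xi : m.-integrable setT (EFin \o a) ->
  Fc a xi ^+ 2 + Fs a xi ^+ 2 =
  \int[prodm m m]_p (a p.1 * a p.2 * cos (th (p.1, xi) - th (p.2, xi))).
Proof.
move=> ia; have ic := integrable_cos xi ia; have is_ := integrable_sin xi ia.
rewrite /prodm !expr2 /Fc /Fs -(Rint_tensor ic ic) -(Rint_tensor is_ is_) -RintegralD//; last 2 first.
- exact: (integrable_tensor ic ic).
- exact: (integrable_tensor is_ is_).
by apply: eq_Rintegral => p _; rewrite cosB; ring.
Qed.

End phase.

(** * Abel summation of the squared transform on the line *)

Section line.
Variable R : realType.
Local Notation leb := (@lebesgue_measure R).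
Definition th1 (p : measurableTypeR R * measurableTypeR R) : R := p.1 * p.2.

Lemma meas_th1 : measurable_fun setT th1.
Proof. by rewrite /th1; meas. Qed.

Lemma continuous_pk e : 0 < e -> continuous (pk (R := R) e).
Proof.
move=> e0 x; rewrite /pk; apply: cvgM; first exact: cvg_cst.
apply: cvgV; first by rewrite gt_eqF// ltr_pwDl ?sqr_ge0// exprn_gt0.
by apply: cvgD; [exact: cvg_cst|exact: exprn_continuous].
Qed.

Lemma meas_pk e : 0 < e -> measurable_fun setT (pk (R := R) e).
Proof. by move=> e0; apply: continuous_measurable_fun; exact: continuous_pk. Qed.

Section weighted.
Variables (a : R -> R) (e : R).
Hypotheses (na : nice leb a) (e0 : 0 < e).
Let ma : measurable_fun setT a := nice_meas na.
Let ia : leb.-integrable setT (EFin \o a) := na.1.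
Let F xi := Fc leb th1 a xi ^+ 2 + Fs leb th1 a xi ^+ 2.

Let H (q : (measurableTypeR R * measurableTypeR R) * measurableTypeR R) : R :=
  (a q.1.1 * a q.1.2) * (wk e q.2) * cos ((q.1.1 - q.1.2) * q.2).

Let iH : (prodm leb leb \x leb)%E.-integrable setT (EFin \o H).
Proof.
have iaa := integrable_tensor (m1 := leb) (m2 := leb) ia ia.
have it := integrable_tensor (m1 := prodm leb leb) (m2 := leb) iaa (integrable_wk e0).
apply: (integrable_mulb it); last by move=> x; exact: cos_norm1.
by meas.
Qed.

(** The Abel weight makes the triple integrand integrable; integrating in the frequency first then
    turns the cosine into the Poisson kernel. *)
Lemma Rint_weighted : \int[leb]_xi (wk e xi * F xi) =
  \int[(prodm leb leb)]_p (a p.1 * a p.2 * pk e (p.1 - p.2)).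
Proof.
have := Rint_fubini iH; rewrite /H /= => HH.
have icos (y : R) : (prodm leb leb).-integrable setT (EFin \o (fun p : measurableTypeR R * measurableTypeR R =>
    a p.1 * a p.2 * cos ((p.1 - p.2) * y))).
  apply: integrable_mulb; first exact: integrable_tensor.
    by meas.
  by move=> x; exact: cos_norm1.
transitivity (\int[leb]_y
        \int[(prodm leb leb)]_x (a x.1 * a x.2 * wk e y * cos ((x.1 - x.2) * y))).
  apply: eq_Rintegral => y _; rewrite /F Fc2Fs2//; last exact: meas_th1.
  rewrite -RintegralZl//; last first.
    apply: eq_integrable (icos y) => // p _ /=.
    by rewrite /th1/= mulrBl.
  by apply: eq_Rintegral => p _; rewrite /th1/= mulrBl; ring.
rewrite -HH; apply: eq_Rintegral => p _.
under eq_Rintegral do rewrite -mulrA.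
rewrite RintegralZl ?Rint_wk_cos//.
apply: integrable_mulb; [exact: integrable_wk|by meas|].
by move=> x; exact: cos_norm1.
Qed.

Lemma integrable_weighted : leb.-integrable setT (EFin \o (fun xi => wk e xi * F xi)).
Proof.
have := integrable_Rint2 iH; apply: eq_integrable => // y _ /=; congr EFin.
rewrite /F Fc2Fs2//; last exact: meas_th1.
rewrite -RintegralZl//; last first.
  apply: integrable_mulb; first exact: integrable_tensor.
    by rewrite /th1/=; meas.
  by move=> x; exact: cos_norm1.
by apply: eq_Rintegral => p _; rewrite /H /th1/= mulrBl; ring.
Qed.

End weighted.
End line.

Section line_plancherel.
Variable R : realType.
Local Notation leb := (@lebesgue_measure R).
Local Notation RR := (measurableTypeR R).
Variable a : R -> R.
Hypothesis na : nice leb a.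
Let ma : measurable_fun setT a := nice_meas na.
Let ia : leb.-integrable setT (EFin \o a) := na.1.
Let A2 := \int[leb]_x (a x ^+ 2).

Let A2E : (\int[leb]_x (a x ^+ 2)%:E = A2%:E)%E.
Proof. by apply: Rint_EFin; exact: nice_sqr. Qed.

Let A2_ge0 : 0 <= A2.
Proof. by apply: Rintegral_ge0 => x _; exact: sqr_ge0. Qed.

Lemma pkN e (h : R) : pk e (- h) = pk e h.
Proof. by rewrite /pk sqrrN. Qed.

Lemma int_pk_shift e y : 0 < e -> (\int[leb]_x (pk e (x - y))%:E = pi%:E)%E.
Proof.
move=> e0; have mk := meas_pk e0.
rewrite (@int_shift R (fun x => (pk e x)%:E)) ?int_pk//; first by meas.
by move=> x; rewrite lee_fin pk_ge0// ltW.
Qed.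

Let m1 : measurable_fun setT (fun p : RR * RR => a p.1).
Proof. by apply: (meas_comp ma); meas. Qed.
Let m2 : measurable_fun setT (fun p : RR * RR => a p.2).
Proof. by apply: (meas_comp ma); meas. Qed.

Let mk12 e : 0 < e -> measurable_fun setT (fun p : RR * RR => pk e (p.1 - p.2)).
Proof. by move=> e0; apply: (meas_comp (meas_pk e0)); meas. Qed.

Let int1 e : 0 < e -> (\int[prodm leb leb]_p (a p.1 ^+ 2 * pk e (p.1 - p.2))%:E = (pi * A2)%:E)%E.
Proof.
move=> e0; have mk := meas_pk e0; have mk2 := mk12 e0.
rewrite /prodm tonelli1; last 2 first.
- by meas.
- by move=> p; rewrite lee_fin mulr_ge0 ?sqr_ge0// pk_ge0// ltW.
transitivity (\int[leb]_x (pi * a x ^+ 2)%:E)%E.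
  apply: eq_integral => x _ /=.
  rewrite ge0_intZ ?sqr_ge0//; last 2 first.
  - by apply: (meas_comp mk); meas.
  - by move=> y; rewrite pk_ge0// ltW.
  under eq_integral do rewrite -pkN opprB.
  by rewrite int_pk_shift// -EFinM mulrC.
rewrite ge0_intZ ?pi_ge0//; last 2 first.
- by meas.
- by move=> x; exact: sqr_ge0.
by rewrite A2E -EFinM.
Qed.

Let int2 e : 0 < e -> (\int[prodm leb leb]_p (a p.2 ^+ 2 * pk e (p.1 - p.2))%:E = (pi * A2)%:E)%E.
Proof.
move=> e0; have mk := meas_pk e0; have mk2 := mk12 e0.
rewrite /prodm tonelli2; last 2 first.
- by meas.
- by move=> p; rewrite lee_fin mulr_ge0 ?sqr_ge0// pk_ge0// ltW.
transitivity (\int[leb]_x (pi * a x ^+ 2)%:E)%E.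
  apply: eq_integral => x _ /=.
  rewrite ge0_intZ ?sqr_ge0//; last 2 first.
  - by apply: (meas_comp mk); meas.
  - by move=> y; rewrite pk_ge0// ltW.
  by rewrite int_pk_shift// -EFinM mulrC.
rewrite ge0_intZ ?pi_ge0//; last 2 first.
- by meas.
- by move=> x; exact: sqr_ge0.
by rewrite A2E -EFinM.
Qed.

(* Half of it is the amount by which the quadratic form of the Poisson kernel
   at [a] falls short of [pi * \int a^2]; it tends to 0 by continuity of
   translations in L2. *)
Definition defect e := \int[prodm leb leb]_p ((a p.1 - a p.2) ^+ 2 * pk e (p.1 - p.2)).

Let iprod1 e : 0 < e -> (prodm leb leb).-integrable setT (EFin \o (fun p : RR * RR =>
   a p.1 ^+ 2 * pk e (p.1 - p.2))).
Proof.
move=> e0; have mk2 := mk12 e0; apply: ge0_integrableR; first by meas.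
  by move=> p; rewrite mulr_ge0 ?sqr_ge0// pk_ge0// ltW.
by rewrite int1// ltry.
Qed.

Let iprod2 e : 0 < e -> (prodm leb leb).-integrable setT (EFin \o (fun p : RR * RR =>
   a p.2 ^+ 2 * pk e (p.1 - p.2))).
Proof.
move=> e0; have mk2 := mk12 e0; apply: ge0_integrableR; first by meas.
  by move=> p; rewrite mulr_ge0 ?sqr_ge0// pk_ge0// ltW.
by rewrite int2// ltry.
Qed.

Let idef e : 0 < e -> (prodm leb leb).-integrable setT (EFin \o (fun p : RR * RR =>
   (a p.1 - a p.2) ^+ 2 * pk e (p.1 - p.2))).
Proof.
move=> e0; have mk2 := mk12 e0.
have ii := integrableDR (integrableZR 2 (iprod1 e0)) (integrableZR 2 (iprod2 e0)).
apply: (integrable_le _ ii); first by meas.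
move=> p; have k0 : 0 <= pk e (p.1 - p.2) by rewrite pk_ge0// ltW.
rewrite ger0_norm; last by rewrite mulr_ge0// sqr_ge0.
rewrite /=; move: (pk e _) (a p.1) (a p.2) k0 => k x y k0.
rewrite [leRHS](_ : _ = (2 * x ^+ 2 + 2 * y ^+ 2) * k); last by ring.
by rewrite ler_wpM2r// -subr_ge0 (_ : _ - _ = (x + y) ^+ 2) ?sqr_ge0//; ring.
Qed.

(** Polarisation [2 x y = x^2 + y^2 - (x - y)^2]: either square integrates to [pi * A2], because the
    kernel has mass [pi] in each variable. *)
Lemma Rint_defect e : 0 < e ->
  \int[prodm leb leb]_p (a p.1 * a p.2 * pk e (p.1 - p.2)) = pi * A2 - defect e / 2.
Proof.
move=> e0.
have E1 : \int[prodm leb leb]_p (a p.1 ^+ 2 * pk e (p.1 - p.2)) = pi * A2.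
  by rewrite /Rintegral int1.
have E2 : \int[prodm leb leb]_p (a p.2 ^+ 2 * pk e (p.1 - p.2)) = pi * A2.
  by rewrite /Rintegral int2.
transitivity (2^-1 * (\int[prodm leb leb]_p (a p.1 ^+ 2 * pk e (p.1 - p.2)) +
   \int[prodm leb leb]_p (a p.2 ^+ 2 * pk e (p.1 - p.2)) - defect e)); last first.
  by rewrite E1 E2; field.
have i1 := iprod1 e0; have i2 := iprod2 e0; have i3 := idef e0.
rewrite /defect -RintegralD// -RintegralB//; last exact: integrableDR.
rewrite -RintegralZl//; last first.
  by apply: integrableDR; [exact: integrableDR|exact: integrableNR].
by apply: eq_Rintegral => p _; field.
Qed.

(** The substitution [h = e * t] moves [e] out of the kernel into the translation:
    [e * pk e (e * t)] is [(1 + t^2)^-1] for every [e]. *)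
Lemma int_defect e : 0 < e -> ((defect e)%:E =
  \int[leb]_t ((1 + t ^+ 2)^-1%:E * tdiff a (e * t)%R))%E.
Proof.
move=> e0; have mk2 := mk12 e0; have mk := meas_pk e0.
rewrite -Rint_EFin; last exact: idef.
rewrite /prodm tonelli2; last 2 first.
- by meas.
- by move=> p; rewrite lee_fin mulr_ge0 ?sqr_ge0// pk_ge0// ltW.
have madd : measurable_fun setT (fun p : RR * RR => a (p.1 + p.2)).
  by apply: (meas_comp ma); meas.
transitivity (\int[leb]_y \int[leb]_x ((a (x + y) - a y) ^+ 2 * pk e x)%:E)%E.
  apply: eq_integral => y _ /=.
  rewrite -(@int_shift R _ y); last 2 first.
  - by meas; apply: (meas_comp mk); meas.
  - by move=> x; rewrite lee_fin mulr_ge0 ?sqr_ge0// pk_ge0// ltW.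
  by apply: eq_integral => x _; rewrite addrK.
have mF : measurable_fun setT (fun p : RR * RR => ((a (p.1 + p.2) - a p.2) ^+ 2 * pk e p.1)%:E).
  by meas; apply: (meas_comp mk); meas.
have F0 (p : RR * RR) : (0 <= ((a (p.1 + p.2) - a p.2) ^+ 2 * pk e p.1)%:E)%E.
  by rewrite lee_fin mulr_ge0 ?sqr_ge0// pk_ge0// ltW.
rewrite -(@fubini_tonelli _ _ _ _ _ leb leb _ mF F0).
have tE x : (\int[leb]_y ((a (x + y) - a y) ^+ 2 * pk e x)%:E = (pk e x)%:E * tdiff a x)%E.
  under eq_integral do rewrite mulrC (addrC x).
  rewrite ge0_intZ//.
  - by have ms := meas_shift x ma; meas.
  - by move=> y; exact: sqr_ge0.
  - by rewrite pk_ge0// ltW.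
under eq_integral do rewrite tE.
have mt : measurable_fun setT (fun x : RR => (pk e x)%:E * tdiff a x)%E.
  under eq_fun do rewrite -tE.
  exact: (meas_eint1 leb mF F0).
have := @ge0_int_affine R e 0 _ e0 mt.
move=> H; have {}H := H _.
have -> : (\int[leb]_x ((pk e x)%:E * tdiff a x) =
   e%:E * (e^-1%:E * \int[leb]_x ((pk e x)%:E * tdiff a x)))%E.
  by rewrite muleA -EFinM mulfV ?gt_eqF// mul1e.
rewrite -H; last by move=> x; rewrite mule_ge0 ?tdiff_ge0// lee_fin pk_ge0// ltW.
rewrite -ge0_integralZl_EFin//; last 3 first.
- by move=> x _; rewrite mule_ge0 ?tdiff_ge0// lee_fin pk_ge0// ltW.
- apply: (meas_comp mt); by meas.
- exact: ltW.
apply: eq_integral => t _; rewrite muleA -EFinM addr0; congr (_%:E * _)%E.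
rewrite /pk; field.
by apply/andP; split; rewrite gt_eqF// ltr_pwDl ?sqr_ge0 ?ltr01 ?exprn_gt0.
Qed.
End line_plancherel.

Section line_plancherel2.
Variable R : realType.
Local Notation leb := (@lebesgue_measure R).
Local Notation RR := (measurableTypeR R).

Section real.
Variable a : R -> R.
Hypothesis na : nice leb a.
Let ma : measurable_fun setT a := nice_meas na.
Let ia : leb.-integrable setT (EFin \o a) := na.1.
Let A2 := \int[leb]_x (a x ^+ 2).

Let A2E : (\int[leb]_x (a x ^+ 2)%:E = A2%:E)%E.
Proof. by apply: Rint_EFin; exact: nice_sqr. Qed.

Let A2_ge0 : 0 <= A2.
Proof. by apply: Rintegral_ge0 => x _; exact: sqr_ge0. Qed.

Let tdiff_fin h : tdiff a h \is a fin_num.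
Proof.
rewrite ge0_fin_numE ?tdiff_ge0//; apply: le_lt_trans (tdiff_le h ma) _.
by rewrite A2E -EFinM ltry.
Qed.

Lemma integrable_cauchy : leb.-integrable setT (EFin \o (fun x : R => (1 + x ^+ 2)^-1)).
Proof.
have E : (fun x : R => (1 + x ^+ 2)^-1) = pk 1.
  by apply/funext => x; rewrite /pk expr1n mul1r.
rewrite E; apply: ge0_integrableR; first exact: meas_pk.
  by move=> x; exact: pk_ge0.
by rewrite int_pk// ltry.
Qed.

Lemma meas_tdiff : measurable_fun setT (tdiff a).
Proof.
apply: (meas_eint1 leb (F := fun p : RR * RR => ((a (p.2 + p.1) - a p.2) ^+ 2)%:E)).
  have m1 : measurable_fun setT (fun p : RR * RR => a p.2) by apply: (meas_comp ma); meas.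
  have m2 : measurable_fun setT (fun p : RR * RR => a (p.2 + p.1)) by apply: (meas_comp ma); meas.
  by meas.
by move=> p; rewrite lee_fin sqr_ge0.
Qed.

(** Translations of [a] are continuous in L2, and [tdiff_le] gives the dominating function
    [4 * A2 / (1 + t^2)]. *)
Lemma defect_cvg0 : (fun n => defect a n.+1%:R^-1) @ \oo --> (0 : R).
Proof.
suff : (fun n => (defect a n.+1%:R^-1)%:E) @ \oo --> 0%E by move=> /fine_cvgP[].
under eq_fun do rewrite int_defect//.
have -> : (fun n : nat => \int[leb]_t ((1 + t ^+ 2)^-1%:E * tdiff a (n.+1%:R^-1 * t)%R))%E =
  (fun n : nat => \int[leb]_t ((1 + t ^+ 2)^-1 * fine (tdiff a (n.+1%:R^-1 * t)))%:E)%E.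
  apply/funext => n; apply: eq_integral => t _; rewrite EFinM fineK//.
apply: (dct0 (m := leb) (f_ := fun n t => (1 + t ^+ 2)^-1 * fine (tdiff a (n.+1%:R^-1 * t)))
  (g := fun t => (4 * A2) * (1 + t ^+ 2)^-1)).
- move=> n; apply: measurable_funM; first exact: integrableR_meas integrable_cauchy.
  apply: (meas_comp (h := fine)); first exact: fine_measurable.
  by apply: (meas_comp meas_tdiff); meas.
- apply: aeW => t; rewrite -[X in _ --> X](mulr0 (1 + t ^+ 2)^-1).
  apply: cvgM; first exact: cvg_cst.
  have u0 : (fun n => n.+1%:R^-1 * t) @ \oo --> (0 : R).
    rewrite -[X in _ --> X](mul0r t); apply: cvgM; last exact: cvg_cst.
    exact: cvg_harmonic.
  by have /fine_cvgP[] := tcont_L2 ma na.2 u0.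
- by apply: integrableZR; exact: integrable_cauchy.
move=> n t; have t0 : 0 <= (1 + t ^+ 2)^-1 by rewrite invr_ge0 addr_ge0// sqr_ge0.
rewrite ger0_norm; last by rewrite mulr_ge0// fine_ge0// tdiff_ge0.
rewrite mulrC ler_wpM2r// -lee_fin fineK//.
by apply: le_trans (tdiff_le _ ma) _; rewrite A2E -EFinM.
Qed.

Let F xi := Fc leb (@th1 R) a xi ^+ 2 + Fs leb (@th1 R) a xi ^+ 2.

Let F0 xi : 0 <= F xi. Proof. by rewrite addr_ge0// sqr_ge0. Qed.

Let mF : measurable_fun setT F.
Proof.
have h1 := meas_Fc leb (@meas_th1 R) ma; have h2 := meas_Fs leb (@meas_th1 R) ma.
by rewrite /F; meas.
Qed.

(** The Abel weights increase to the indicator of the half-line, so monotone convergence gives one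
    expression for the limit; [Rint_defect] and [defect_cvg0] give the other. *)
Lemma half_plancherel : (\int[leb]_xi (\1_`[0%R, +oo[ xi * F xi)%:E = (pi * A2)%:E)%E.
Proof.
pose g n xi := (wk n.+1%:R^-1 xi * F xi)%:E.
have mw n : measurable_fun setT (wk (R := R) n.+1%:R^-1) by exact: meas_wk.
have gE n : (\int[leb]_xi g n xi = (pi * A2 - defect a n.+1%:R^-1 / 2)%:E)%E.
  have n0 : (0 : R) < n.+1%:R^-1 by rewrite invr_gt0 ltr0n.
  have E := Rint_EFin (integrable_weighted na n0).
  by rewrite [LHS]E Rint_weighted// Rint_defect.
have c1 : (fun n => \int[leb]_xi g n xi)%E @ \oo --> (pi * A2)%:E.
  under eq_fun do rewrite gE.
  apply/fine_cvgP; split; first exact: nearW.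
  rewrite -[X in _ --> X]subr0; apply: cvgB; first exact: cvg_cst.
  rewrite -(mul0r 2^-1); apply: cvgM; last exact: cvg_cst.
  exact: defect_cvg0.
have gcvg xi : g^~ xi @ \oo --> (\1_`[0%R, +oo[ xi * F xi)%:E.
  apply/fine_cvgP; split; first exact: nearW.
  have e1 : (fun n => - (n.+1%:R^-1 * xi)) @ \oo --> (0 : R).
    rewrite -[X in _ --> X]oppr0; apply: cvgN; rewrite -(mul0r xi).
    by apply: cvgM; [exact: cvg_harmonic|exact: cvg_cst].
  have e2 : (fun n => expR (- (n.+1%:R^-1 * xi))) @ \oo --> (1 : R).
    rewrite -[X in _ --> X](@expR0 R).
    exact: (@continuous_cvg _ _ _ _ _ (fun n => - (n.+1%:R^-1 * xi)) expR 0 (@continuous_expR R 0)).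
  rewrite /g /wk /=; apply: cvgM; last exact: cvg_cst.
  rewrite -[X in _ --> X]mul1r; apply: cvgM; last exact: cvg_cst.
  exact: e2.
have c2 := @cvg_monotone_convergence _ _ _ leb setT measurableT g.
have {}c2 : (fun n => \int[leb]_xi g n xi)%E @ \oo --> (\int[leb]_xi (\1_`[0%R, +oo[ xi * F xi)%:E)%E.
  rewrite (_ : (\int[leb]_xi (\1_`[0%R, +oo[ xi * F xi)%:E)%E = (\int[leb]_x limn (g ^~ x))%E); last first.
    by apply: eq_integral => x _; apply/esym/cvg_lim.
  apply: c2.
  - by move=> n; have mwn := mw n; rewrite /g; meas.
  - by move=> n x _; rewrite lee_fin mulr_ge0// wk_ge0.
  move=> x _ n k nk; rewrite lee_fin ler_wpM2r// /wk indicE.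
  have [xA|_] := boolP (x \in _); last by rewrite !mulr0.
  rewrite !mulr1 ler_expR lerN2 ler_wpM2r//.
    by move: xA; rewrite inE/= in_itv/= andbT.
  by rewrite lef_pV2 ?posrE// ler_nat ltnS.
exact: (cvg_unique _ c2 c1).
Qed.

End real.

(** For complex data the squared modulus is not even, but its cross terms change sign with [xi].
    Folding the line onto the half-line leaves [2 * (P a + P b)], whence the factor 2 in
    [2 * pi]. *)
Lemma plancherel_line : plancherel leb (@th1 R) (2 * pi).
Proof.
move=> a b na nb.
have ma := nice_meas na; have mb := nice_meas nb.
have mC x (mx : measurable_fun setT x) := meas_Fc leb (@meas_th1 R) mx.
have mS x (mx : measurable_fun setT x) := meas_Fs leb (@meas_th1 R) mx.
have mca := mC _ ma; have mcb := mC _ mb; have msa := mS _ ma; have msb := mS _ mb.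
have mq := meas_Fsq leb (@meas_th1 R) ma mb.
have FcN x xi : Fc leb (@th1 R) x (- xi) = Fc leb (@th1 R) x xi.
  by apply: eq_Rintegral => y _; rewrite /th1/= mulrN cosN.
have FsN x xi : nice leb x -> Fs leb (@th1 R) x (- xi) = - Fs leb (@th1 R) x xi.
  move=> nx; rewrite -[RHS]mulN1r /Fs -RintegralZl//; last first.
    by apply: integrable_sin; [exact: meas_th1|case: nx].
  by apply: eq_Rintegral => y _; rewrite /th1/= mulrN sinN; ring.
have mI : measurable_fun setT (\1_`[0%R, +oo[ : R -> R) by exact: measurable_indic.
pose P x xi := Fc leb (@th1 R) x xi ^+ 2 + Fs leb (@th1 R) x xi ^+ 2.
have P0 x xi : 0 <= P x xi by rewrite addr_ge0// sqr_ge0.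
have I0 (xi : R) : 0 <= \1_`[0%R, +oo[ xi :> R by [].
transitivity (\int[leb]_xi (\1_`[0%R, +oo[ xi * Fsq leb (@th1 R) a b xi +
   \1_`[0%R, +oo[ (- xi) * Fsq leb (@th1 R) a b xi)%:E)%E.
  apply: ae_eq_intR => //.
    have mI' : measurable_fun setT (fun xi : R => \1_`[0%R, +oo[ (- xi) : R).
      by apply: (meas_comp mI); meas.
    by meas.
  (* At 0 both indicators are 1, so the splitting can fail only on this null set. *)
  exists [set 0]; split=> //; first exact: lebesgue_measure_set1.
  move=> x /= xH; apply: contrapT => x0; apply: xH.
  rewrite -mulrDl !indicE.
  have [x1|x1|//] := ltgtP x 0.
    rewrite memNset ?mem_set/= ?in_itv/= ?andbT ?oppr_ge0 ?(ltW x1) ?add0r ?mul1r//.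
    by rewrite leNgt x1.
  rewrite mem_set ?memNset/= ?in_itv/= ?andbT ?oppr_ge0 ?(ltW x1) ?addr0 ?mul1r//.
  by rewrite leNgt x1.
have mI' : measurable_fun setT (fun xi : R => \1_`[0%R, +oo[ (- xi) : R).
  by apply: (meas_comp mI); meas.
rewrite ge0_intD; last 4 first.
- by meas.
- by meas.
- by move=> x; rewrite mulr_ge0// Fsq_ge0.
- by move=> x; rewrite mulr_ge0// Fsq_ge0.
have mN : measurable_fun setT (fun xi : R => Fsq leb (@th1 R) a b (- xi)).
  by apply: (meas_comp mq); meas.
have -> : (\int[leb]_x (\1_`[0%R, +oo[ (- x) * Fsq leb (@th1 R) a b x)%:E =
    \int[leb]_x (\1_`[0%R, +oo[ x * Fsq leb (@th1 R) a b (- x))%:E)%E.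
  rewrite -(@ge0_int_opp R (fun x => (\1_`[0%R, +oo[ x * Fsq leb (@th1 R) a b (- x))%:E)).
  - by apply: eq_integral => x _; rewrite opprK.
  - by meas.
  - by move=> x; rewrite lee_fin mulr_ge0// Fsq_ge0.
rewrite -ge0_intD; last 4 first.
- by meas.
- by meas.
- by move=> x; rewrite mulr_ge0// Fsq_ge0.
- by move=> x; rewrite mulr_ge0// Fsq_ge0.
transitivity (\int[leb]_x (2 * (\1_`[0%R, +oo[ x * P a x) + 2 * (\1_`[0%R, +oo[ x * P b x))%:E)%E.
  apply: eq_integral => x _; congr EFin; rewrite /Fsq !FcN !FsN// /P.
  by ring.
have mP x : nice leb x -> measurable_fun setT (P x).
  move=> nx; have m1 := mC _ (nice_meas nx); have m2 := mS _ (nice_meas nx).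
  by rewrite /P; meas.
have mPa := mP _ na; have mPb := mP _ nb.
rewrite ge0_intD; last 4 first.
- by meas.
- by meas.
- by move=> x; rewrite !mulr_ge0.
- by move=> x; rewrite !mulr_ge0.
rewrite !ge0_intZ//; try by [meas|move=> x; rewrite mulr_ge0].
rewrite !half_plancherel// ge0_intD; try by [meas|move=> x; exact: sqr_ge0].
rewrite !Rint_EFin; [|exact: nice_sqr|exact: nice_sqr].
by rewrite -!EFinD -EFinM; congr EFin; ring.
Qed.

End line_plancherel2.

(** * The Plancherel identity on products and row vectors *)

Section ae_tools.
Context d (T : measurableType d) (R : realType) (m : {measure set T -> \bar R}).

Lemma ae_eq_Rint (f g : T -> R) : measurable_fun setT f -> measurable_fun setT g ->
  {ae m, forall x, f x = g x} -> \int[m]_x f x = \int[m]_x g x.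
Proof. by move=> mf mg fg; rewrite /Rintegral (ae_eq_intR mf mg fg). Qed.

Lemma ae_lty (f : T -> \bar R) : measurable_fun setT f -> (forall x, (0 <= f x)%E) ->
  (\int[m]_x f x < +oo)%E -> {ae m, forall x, (f x < +oo)%E}.
Proof.
move=> mf f0 fi; have : m.-integrable setT f.
  apply/integrableP; split => //.
  by under eq_integral do rewrite gee0_abs//.
move=> /(integrable_ae measurableT); apply: filterS => x /(_ I).
by rewrite ge0_fin_numE.
Qed.

End ae_tools.

(** * Plancherel on a product from its factors *)

Section product_phase.
Context d1 d2 (X : measurableType d1) (Y : measurableType d2) (R : realType).
Variables (m1 : {sigma_finite_measure set X -> \bar R})
  (m2 : {sigma_finite_measure set Y -> \bar R}).
Variables (t1 : X * X -> R) (t2 : Y * Y -> R).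
Hypotheses (mt1 : measurable_fun setT t1) (mt2 : measurable_fun setT t2).

Definition t12 (p : (X * Y) * (X * Y)) : R := t1 (p.1.1, p.2.1) + t2 (p.1.2, p.2.2).

Lemma meas_t12 : measurable_fun setT t12.
Proof.
rewrite /t12; apply: measurable_funD; first by apply: (meas_comp mt1); meas.
by apply: (meas_comp mt2); meas.
Qed.

Local Notation m12 := (prodm m1 m2).
Local Notation C1 a xi y := (Fc m1 t1 (fun x => a (x, y)) xi).
Local Notation S1 a xi y := (Fs m1 t1 (fun x => a (x, y)) xi).

Let mc1 (xi : X) : measurable_fun setT (fun p : X * Y => cos (t1 (p.1, xi))).
Proof.
have : measurable_fun setT (fun p : X * Y => t1 (p.1, xi)) by apply: (meas_comp mt1); meas.
by move=> ?; meas.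
Qed.
Let ms1 (xi : X) : measurable_fun setT (fun p : X * Y => sin (t1 (p.1, xi))).
Proof.
have : measurable_fun setT (fun p : X * Y => t1 (p.1, xi)) by apply: (meas_comp mt1); meas.
by move=> ?; meas.
Qed.
Let mc2 (tau : Y) : measurable_fun setT (fun p : X * Y => cos (t2 (p.2, tau))).
Proof.
have : measurable_fun setT (fun p : X * Y => t2 (p.2, tau)) by apply: (meas_comp mt2); meas.
by move=> ?; meas.
Qed.
Let ms2 (tau : Y) : measurable_fun setT (fun p : X * Y => sin (t2 (p.2, tau))).
Proof.
have : measurable_fun setT (fun p : X * Y => t2 (p.2, tau)) by apply: (meas_comp mt2); meas.
by move=> ?; meas.
Qed.

Section one.
Variable a : X * Y -> R.
Hypothesis ia : m12.-integrable setT (EFin \o a).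
Let ma : measurable_fun setT a := integrableR_meas ia.

Let ic (xi : X) : m12.-integrable setT (EFin \o (fun p => a p * cos (t1 (p.1, xi)))).
Proof. by apply: integrable_mulb => // x; exact: cos_norm1. Qed.
Let isn (xi : X) : m12.-integrable setT (EFin \o (fun p => a p * sin (t1 (p.1, xi)))).
Proof. by apply: integrable_mulb => // x; exact: sin_norm1. Qed.

Lemma integrable_C1 xi : m2.-integrable setT (EFin \o (fun y => C1 a xi y)).
Proof. exact: (integrable_Rint2 (ic xi)). Qed.
Lemma integrable_S1 xi : m2.-integrable setT (EFin \o (fun y => S1 a xi y)).
Proof. exact: (integrable_Rint2 (isn xi)). Qed.

Let fub (g : X * Y -> R) (c : Y -> R) :
  m12.-integrable setT (EFin \o g) -> measurable_fun setT c -> (forall y, `|c y| <= 1) ->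
  m12.-integrable setT (EFin \o (fun p => g p * c p.2)) /\
  \int[m12]_p (g p * c p.2) = \int[m2]_y ((\int[m1]_x g (x, y)) * c y).
Proof.
move=> ig mc c1.
have mcp : measurable_fun setT (fun p : X * Y => c p.2) by apply: (meas_comp mc); meas.
have igc : m12.-integrable setT (EFin \o (fun p => g p * c p.2)).
  by apply: integrable_mulb => // x.
split => //; rewrite /prodm -(Rint_fubini2 igc); apply: ae_eq_Rint.
- exact: (meas_Rint2 m1 (integrableR_meas igc)).
- by apply: measurable_funM => //; exact: (meas_Rint2 m1 (integrableR_meas ig)).
by move: (ae_slice2 ig); apply: filterS => y iy; rewrite /= RintegralZr.
Qed.

Lemma Fc_prod xi tau : Fc m12 t12 a (xi, tau) =
  Fc m2 t2 (fun y => C1 a xi y) tau - Fs m2 t2 (fun y => S1 a xi y) tau.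
Proof.
have mct : measurable_fun setT (fun y => cos (t2 (y, tau))) by have h := meas_th2 mt2 tau; meas.
have mst : measurable_fun setT (fun y => sin (t2 (y, tau))) by have h := meas_th2 mt2 tau; meas.
have [i1 e1] := fub (ic xi) mct (fun y => cos_norm1 _).
have [i2 e2] := fub (isn xi) mst (fun y => sin_norm1 _).
rewrite /Fc /Fs -e1 -e2 -RintegralB//; apply: eq_Rintegral => p _.
by rewrite /t12/= cosD; ring.
Qed.

Lemma Fs_prod xi tau : Fs m12 t12 a (xi, tau) =
  Fs m2 t2 (fun y => C1 a xi y) tau + Fc m2 t2 (fun y => S1 a xi y) tau.
Proof.
have mct : measurable_fun setT (fun y => cos (t2 (y, tau))) by have h := meas_th2 mt2 tau; meas.
have mst : measurable_fun setT (fun y => sin (t2 (y, tau))) by have h := meas_th2 mt2 tau; meas.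
have [i1 e1] := fub (ic xi) mst (fun y => sin_norm1 _).
have [i2 e2] := fub (isn xi) mct (fun y => cos_norm1 _).
rewrite /Fc /Fs -e1 -e2 -RintegralD//; apply: eq_Rintegral => p _.
by rewrite /t12/= sinD; ring.
Qed.

End one.

(** [Are] and [Aim] are the real and imaginary parts of the transform of [a + i b] in the first
    variable alone. *)
Definition Are (a b : X * Y -> R) xi y : R := C1 a xi y + S1 b xi y.
Definition Aim (a b : X * Y -> R) xi y : R := C1 b xi y - S1 a xi y.

Lemma Fsq_prod a b xi tau : m12.-integrable setT (EFin \o a) ->
  m12.-integrable setT (EFin \o b) ->
  Fsq m12 t12 a b (xi, tau) = Fsq m2 t2 (Are a b xi) (Aim a b xi) tau.
Proof.
move=> ia ib; have i1 := integrable_C1 ia xi; have i2 := integrable_S1 ia xi.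
have i3 := integrable_C1 ib xi; have i4 := integrable_S1 ib xi.
have FcD f g : m2.-integrable setT (EFin \o f) -> m2.-integrable setT (EFin \o g) ->
    Fc m2 t2 (fun x => f x + g x) tau = Fc m2 t2 f tau + Fc m2 t2 g tau.
  move=> fi gi; rewrite /Fc -RintegralD//; try exact: integrable_cos.
  by apply: eq_Rintegral => x _; rewrite mulrDl.
have FsD f g : m2.-integrable setT (EFin \o f) -> m2.-integrable setT (EFin \o g) ->
    Fs m2 t2 (fun x => f x + g x) tau = Fs m2 t2 f tau + Fs m2 t2 g tau.
  move=> fi gi; rewrite /Fs -RintegralD//; try exact: integrable_sin.
  by apply: eq_Rintegral => x _; rewrite mulrDl.
rewrite /Fsq !Fc_prod// !Fs_prod//.
rewrite (FcD (fun y => C1 a xi y) (fun y => S1 b xi y))//.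
rewrite (FsD (fun y => C1 a xi y) (fun y => S1 b xi y))//.
rewrite (FcB mt2 tau i3 i2) (FsB mt2 tau i3 i2).
have r1 (x y z t : R) : x - y + (z + t) = x + t + (z - y) by ring.
have r2 (x y z t : R) : x - y - (z + t) = x - t - (z + y) by ring.
by congr (_ ^+ 2 + _ ^+ 2); [exact: r1|exact: r2].
Qed.

Lemma meas_C1 (a : X * Y -> R) : measurable_fun setT a ->
  measurable_fun setT (fun q : X * Y => C1 a q.1 q.2).
Proof.
move=> ma; apply: (meas_Rint1 m1 (F := fun q : (X * Y) * X => a (q.2, q.1.2) * cos (t1 (q.2, q.1.1)))).
have h1 : measurable_fun setT (fun q : (X * Y) * X => a (q.2, q.1.2)) by apply: (meas_comp ma); meas.
have h2 : measurable_fun setT (fun q : (X * Y) * X => t1 (q.2, q.1.1)) by apply: (meas_comp mt1); meas.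
by meas.
Qed.

Lemma meas_S1 (a : X * Y -> R) : measurable_fun setT a ->
  measurable_fun setT (fun q : X * Y => S1 a q.1 q.2).
Proof.
move=> ma; apply: (meas_Rint1 m1 (F := fun q : (X * Y) * X => a (q.2, q.1.2) * sin (t1 (q.2, q.1.1)))).
have h1 : measurable_fun setT (fun q : (X * Y) * X => a (q.2, q.1.2)) by apply: (meas_comp ma); meas.
have h2 : measurable_fun setT (fun q : (X * Y) * X => t1 (q.2, q.1.1)) by apply: (meas_comp mt1); meas.
by meas.
Qed.

Lemma ae_nice_slice a : nice m12 a -> {ae m2, forall y, nice m1 (fun x => a (x, y))}.
Proof.
move=> na; have ma := nice_meas na; have [ia _] := na; have i2 := nice_sqr na.
have := ae_slice2 ia; have := ae_slice2 i2; apply: filterS2 => y h2 h1; split => //.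
have := integrableR_lty h2; apply: le_lt_trans; apply: ge0_le_intR.
- by have ms := meas_slice2 y ma; meas.
- by have ms := meas_slice2 y ma; meas.
- by move=> x; exact: sqr_ge0.
- by move=> x; exact: ler_norm.
Qed.

Section planch.
Variables (k1 k2 : R).
Hypotheses (P1 : plancherel m1 t1 k1) (P2 : plancherel m2 t2 k2).
Hypotheses (k10 : 0 <= k1) (k20 : 0 <= k2).
Variables a b : X * Y -> R.
Hypotheses (na : nice m12 a) (nb : nice m12 b).
Let ma := nice_meas na.
Let mb := nice_meas nb.
Let Q (q : X * Y) := Fsq m1 t1 (fun x => a (x, q.2)) (fun x => b (x, q.2)) q.1.

Let mAre : measurable_fun setT (fun q : X * Y => Are a b q.1 q.2).
Proof. by apply: measurable_funD; [exact: meas_C1|exact: meas_S1]. Qed.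
Let mAim : measurable_fun setT (fun q : X * Y => Aim a b q.1 q.2).
Proof. by apply: measurable_funB; [exact: meas_C1|exact: meas_S1]. Qed.

Lemma meas_Q : measurable_fun setT Q.
Proof.
apply: (eq_measurable_fun (fun q : X * Y => Are a b q.1 q.2 ^+ 2 + Aim a b q.1 q.2 ^+ 2)) => //.
by meas.
Qed.

Lemma int_Q : (\int[m12]_q (Q q)%:E = k1%:E * \int[m12]_p (a p ^+ 2 + b p ^+ 2)%:E)%E.
Proof.
have mQ := meas_Q.
have F0 p : (0 <= (a p ^+ 2 + b p ^+ 2)%:E)%E by rewrite lee_fin addr_ge0 ?sqr_ge0.
have Q0 p : (0 <= (Q p)%:E)%E by rewrite lee_fin Fsq_ge0.
rewrite /prodm (tonelli2 m1 m2 _ Q0) ?(tonelli2 m1 m2 _ F0); try by meas.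
rewrite -ge0_integralZl_EFin//; first last.
- apply: (meas_eint2 m1 (F := fun p => (a p ^+ 2 + b p ^+ 2)%:E)); first by meas.
  by move=> p; rewrite lee_fin addr_ge0 ?sqr_ge0.
- by move=> y _; apply: int_ge0 => x; rewrite addr_ge0 ?sqr_ge0.
apply: ae_eq_integral => //.
- apply: (meas_eint2 m1 (F := fun p => (Q p)%:E)); first by meas.
  by move=> p; rewrite lee_fin Fsq_ge0.
- apply: measurable_funeM.
  apply: (meas_eint2 m1 (F := fun p => (a p ^+ 2 + b p ^+ 2)%:E)); first by meas.
  by move=> p; rewrite lee_fin addr_ge0 ?sqr_ge0.
have := ae_nice_slice na; have := ae_nice_slice nb.
by apply: filterS2 => y nby nay _; rewrite -P1.
Qed.

Let ab_lty : (\int[m12]_p (a p ^+ 2 + b p ^+ 2)%:E < +oo)%E.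
Proof.
rewrite ge0_intD; try by [meas|move=> x; exact: sqr_ge0].
by apply: lte_add_pinfty; [case: na|case: nb].
Qed.

(** The partial transform is integrable in [y] for every [xi]; its square integrability holds for
    almost every [xi], by the finiteness of [int_Q], and there [P2] applies to it. *)
Lemma partial_plancherel : {ae m1, forall xi,
  (\int[m2]_tau (Fsq m12 t12 a b (xi, tau))%:E = k2%:E * \int[m2]_y (Q (xi, y))%:E)%E}.
Proof.
have mQ := meas_Q.
have : (\int[m12]_q (Q q)%:E < +oo)%E by rewrite int_Q lte_mul_pinfty.
rewrite /prodm tonelli1; first last.
- by move=> p; rewrite lee_fin Fsq_ge0.
- by meas.
move=> /ae_lty H.
have {}H : {ae m1, forall xi, (\int[m2]_y (Q (xi, y))%:E < +oo)%E}.
  apply: H.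
    apply: (meas_eint1 m2 (F := fun p => (Q p)%:E)); first by meas.
    by move=> p; rewrite lee_fin Fsq_ge0.
  by move=> xi; apply: int_ge0 => y; exact: Fsq_ge0.
move: H; apply: filterS => xi Hxi.
have mA : measurable_fun setT (Are a b xi) by exact: (meas_slice1 xi mAre).
have mB : measurable_fun setT (Aim a b xi) by exact: (meas_slice1 xi mAim).
have [ia _] := na; have [ib _] := nb.
under eq_integral do rewrite Fsq_prod//.
rewrite P2//; split.
- by apply: integrableDR; [exact: integrable_C1|exact: integrable_S1].
- apply: le_lt_trans Hxi; apply: ge0_le_intR.
  + by meas.
  + exact: (meas_slice1 xi mQ).
  + by move=> x; exact: sqr_ge0.
  + by move=> y; rewrite /Q /Fsq lerDl sqr_ge0.
- by apply: integrableDR; [exact: integrable_C1|apply: integrableNR; exact: integrable_S1].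
apply: le_lt_trans Hxi; apply: ge0_le_intR.
+ by meas.
+ exact: (meas_slice1 xi mQ).
+ by move=> x; exact: sqr_ge0.
+ by move=> y; rewrite /Q /Fsq lerDr sqr_ge0.
Qed.

Lemma plancherel_prod : (\int[m12]_q (Fsq m12 t12 a b q)%:E =
  (k1 * k2)%:E * \int[m12]_p (a p ^+ 2 + b p ^+ 2)%:E)%E.
Proof.
have mQ := meas_Q; have mF := meas_Fsq m12 meas_t12 ma mb.
rewrite mulrC EFinM -muleA -int_Q /prodm !tonelli1; first last.
- by move=> p; rewrite lee_fin Fsq_ge0.
- by apply/measurable_EFinP; exact: mF.
- by move=> p; rewrite lee_fin Fsq_ge0.
- by meas.
have mQ1 : measurable_fun setT (fun xi => \int[m2]_y (Q (xi, y))%:E)%E.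
  apply: (meas_eint1 m2 (F := fun p => (Q p)%:E)); first by meas.
  by move=> p; rewrite lee_fin Fsq_ge0.
rewrite -ge0_integralZl_EFin//; first last.
- by move=> xi _; apply: int_ge0 => y; exact: Fsq_ge0.
apply: ae_eq_integral => //.
- apply: (meas_eint1 m2 (F := fun p => (Fsq m12 t12 a b p)%:E)).
    by apply/measurable_EFinP; exact: mF.
  by move=> p; rewrite lee_fin Fsq_ge0.
- exact: measurable_funeM.
by move: partial_plancherel; apply: filterS => xi H _; exact: H.
Qed.

End planch.
End product_phase.

Section plancherel_transfer.
Context d1 d2 (X : measurableType d1) (Y : measurableType d2) (R : realType).
Variables (phi : X -> Y) (mX : {sigma_finite_measure set X -> \bar R})
  (mY : {sigma_finite_measure set Y -> \bar R}).
Hypothesis mphi : measurable_fun setT phi.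
Hypothesis phiE : forall A, measurable A -> mY A = mX (phi @^-1` A).
Variables (tX : X * X -> R) (tY : Y * Y -> R).
Hypothesis mtY : measurable_fun setT tY.
Hypothesis tE : forall p q, tY (phi p, phi q) = tX (p, q).

Lemma Fc_transfer a xi : mY.-integrable setT (EFin \o a) ->
  Fc mY tY a (phi xi) = Fc mX tX (fun x => a (phi x)) xi.
Proof.
move=> ia; rewrite /Fc (Rint_transfer mphi phiE); last exact: integrable_cos.
by apply: eq_Rintegral => x _; rewrite tE.
Qed.

Lemma Fs_transfer a xi : mY.-integrable setT (EFin \o a) ->
  Fs mY tY a (phi xi) = Fs mX tX (fun x => a (phi x)) xi.
Proof.
move=> ia; rewrite /Fs (Rint_transfer mphi phiE); last exact: integrable_sin.
by apply: eq_Rintegral => x _; rewrite tE.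
Qed.

Lemma nice_transfer a : nice mY a -> nice mX (fun x => a (phi x)).
Proof.
move=> na; have ma := nice_meas na; split; first by case: na => ia _; exact: integrable_transfer ia.
case: na => _; rewrite (ge0_int_transfer mphi phiE)//; first by meas.
by move=> y; rewrite lee_fin sqr_ge0.
Qed.

Lemma plancherel_transfer k : plancherel mX tX k -> plancherel mY tY k.
Proof.
move=> pX a b na nb; have ma := nice_meas na; have mb := nice_meas nb.
have mq := meas_Fsq mY mtY ma mb.
rewrite !(ge0_int_transfer mphi phiE).
- rewrite -pX; [|exact: nice_transfer|exact: nice_transfer].
  apply: eq_integral => x _; case: na nb => ia _ [ib _].
  by rewrite /Fsq !Fc_transfer// !Fs_transfer.
- by meas.
- by move=> y; rewrite lee_fin addr_ge0 ?sqr_ge0.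
- by meas.
- by move=> y; rewrite lee_fin Fsq_ge0.
Qed.

End plancherel_transfer.

(** * Row vectors: iterated integrals, Plancherel, shifts and dilations *)

Section rV.
Variable R : realType.
Local Notation leb := (@lebesgue_measure R).
Local Notation mu := (lebesgue_rV R).

Definition rth d (p : 'rV[R]_d * 'rV[R]_d) : R := dotv p.1 p.2.

Lemma meas_coord d d' (T : measurableType d') (f : T -> 'rV[R]_d) i :
  measurable_fun setT f -> measurable_fun setT (fun x => f x ord0 i).
Proof. by move=> mf; apply: (meas_comp (measurable_coord i) mf). Qed.

Lemma meas_dotv d d' (T : measurableType d') (f g : T -> 'rV[R]_d) :
  measurable_fun setT f -> measurable_fun setT g ->
  measurable_fun setT (fun x => dotv (f x) (g x)).
Proof.
move=> mf mg; rewrite /dotv; apply: measurable_sum => i.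
by apply: measurable_funM; exact: meas_coord.
Qed.

Lemma meas_rVD d d' (T : measurableType d') (f g : T -> 'rV[R]_d) :
  measurable_fun setT f -> measurable_fun setT g ->
  measurable_fun setT (fun x => f x + g x).
Proof.
move=> mf mg; apply: measurable_fun_rV => i; under eq_fun do rewrite mxE.
by apply: measurable_funD; exact: meas_coord.
Qed.

Lemma meas_rVZ d d' (T : measurableType d') (c : R) (f : T -> 'rV[R]_d) :
  measurable_fun setT f -> measurable_fun setT (fun x => c *: f x).
Proof.
move=> mf; apply: measurable_fun_rV => i; under eq_fun do rewrite mxE.
by apply: measurable_funM => //; exact: meas_coord.
Qed.

Lemma meas_rVB d d' (T : measurableType d') (f g : T -> 'rV[R]_d) :
  measurable_fun setT f -> measurable_fun setT g ->
  measurable_fun setT (fun x => f x - g x).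
Proof.
move=> mf mg; apply: meas_rVD => //.
have -> : (fun x => - g x) = (fun x => (-1) *: g x) by apply/funext => x; rewrite scaleN1r.
exact: meas_rVZ.
Qed.

Lemma meas_row_mx n k d' (T : measurableType d') (f : T -> 'rV[R]_n) (g : T -> 'rV[R]_k) :
  measurable_fun setT f -> measurable_fun setT g ->
  measurable_fun setT (fun x => row_mx (f x) (g x)).
Proof.
move=> mf mg; apply: measurable_fun_rV => i; case: (splitP i) => j ij.
  have -> : i = lshift k j by exact: val_inj.
  by under eq_fun do rewrite row_mxEl; exact: meas_coord.
have -> : i = rshift n j by exact: val_inj.
by under eq_fun do rewrite row_mxEr; exact: meas_coord.
Qed.

Lemma meas_lsubmx n k d' (T : measurableType d') (f : T -> 'rV[R]_(n + k)) :
  measurable_fun setT f -> measurable_fun setT (fun x => lsubmx (f x)).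
Proof.
move=> mf; apply: measurable_fun_rV => i; under eq_fun do rewrite mxE.
exact: meas_coord.
Qed.

Lemma meas_rsubmx n k d' (T : measurableType d') (f : T -> 'rV[R]_(n + k)) :
  measurable_fun setT f -> measurable_fun setT (fun x => rsubmx (f x)).
Proof.
move=> mf; apply: measurable_fun_rV => i; under eq_fun do rewrite mxE.
exact: meas_coord.
Qed.

Lemma meas_rth d : measurable_fun setT (@rth d).
Proof. by rewrite /rth; apply: meas_dotv; meas. Qed.

Lemma dotv_cons d (p q : measurableTypeR R * 'rV[R]_d) :
  dotv (cons_rV p) (cons_rV q) = p.1 * q.1 + dotv p.2 q.2.
Proof.
rewrite /dotv big_ord_recl !cons_rV0; congr (_ + _).
by apply: eq_bigr => i _; rewrite !cons_rVS.
Qed.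

Lemma dotv_row n k (x y : 'rV[R]_n) (t r : 'rV[R]_k) :
  dotv (row_mx x t) (row_mx y r) = dotv x y + dotv t r.
Proof.
rewrite /dotv big_split_ord/=; congr (_ + _); apply: eq_bigr => i _.
  by rewrite !row_mxEl.
by rewrite !row_mxEr.
Qed.

Lemma mu_consE d A : mu d.+1 A = prodm leb (mu d) (@cons_rV R d @^-1` A).
Proof. by []. Qed.

Lemma int_cons d (f : 'rV[R]_d.+1 -> \bar R) : measurable_fun setT f ->
  (forall x, (0 <= f x)%E) ->
  (\int[mu d.+1]_x f x = \int[leb]_x0 \int[mu d]_x f (cons_rV (x0, x)))%E.
Proof.
move=> mf f0; rewrite (ge0_int_transfer (mX := prodm leb (mu d)) (@measurable_cons_rV R d))//.
rewrite /prodm tonelli1//.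
by apply: (meas_comp mf); exact: measurable_cons_rV.
Qed.

Lemma int_rV0 (f : 'rV[R]_0 -> \bar R) : measurable_fun setT f ->
  (\int[mu 0]_x f x = f 0%R)%E.
Proof. by move=> mf; rewrite /= integral_dirac//= diracT mul1e. Qed.

(** Each coordinate split off by [cons_rV] multiplies the constant by [2 * pi]; on ['rV_0] the
    measure is a unit mass and the phase is 0. *)
Lemma plancherel_rV d : plancherel (mu d) (@rth d) ((2 * pi) ^+ d).
Proof.
elim: d => [|d IH].
  move=> a b na nb; have ma := nice_meas na; have mb := nice_meas nb.
  have mq := meas_Fsq (mu 0) (@meas_rth 0) ma mb.
  have t0 (x y : 'rV[R]_0) : rth (x, y) = 0 :> R by rewrite /rth /dotv big_ord0.
  have cE g xi : nice (mu 0) g -> Fc (mu 0) (@rth 0) g xi = g 0.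
    move=> ng; have mg := nice_meas ng; rewrite /Fc /Rintegral int_rV0 ?t0 ?cos0 ?mulr1//.
    by have h := meas_th2 (@meas_rth 0) xi; meas.
  have sE g xi : nice (mu 0) g -> Fs (mu 0) (@rth 0) g xi = 0.
    move=> ng; have mg := nice_meas ng; rewrite /Fs /Rintegral int_rV0 ?t0 ?sin0 ?mulr0//.
    by have h := meas_th2 (@meas_rth 0) xi; meas.
  rewrite !int_rV0; [|by meas|by meas].
  by rewrite /Fsq !cE// !sE// addr0 subr0 expr0 mul1e.
apply: (@plancherel_transfer _ _ _ _ _ (@cons_rV R d) (prodm leb (mu d)) (mu d.+1)
   (@measurable_cons_rV R d) (fun A _ => mu_consE A) (t12 (@th1 R) (@rth d)) (@rth d.+1) (@meas_rth d.+1)).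
  by move=> p q; rewrite /rth /= dotv_cons.
move=> a b na nb; rewrite exprS; apply: (plancherel_prod (@meas_th1 R) (@meas_rth d)) => //.
- exact: plancherel_line.
- by rewrite mulr_ge0// pi_ge0.
- by rewrite exprn_ge0// mulr_ge0// pi_ge0.
Qed.

Lemma meas_cons2 d d' (T : measurableType d') (f : T -> measurableTypeR R) (g : T -> 'rV[R]_d) :
  measurable_fun setT f -> measurable_fun setT g ->
  measurable_fun setT (fun x => cons_rV (f x, g x)).
Proof. by move=> mf mg; apply: (meas_comp (@measurable_cons_rV R d)); meas. Qed.

(** The dimensions [n.+1 + k] and [(n + k).+1] are convertible, so both sides have one type and only
    the injections of ordinals remain to be matched. *)
Lemma row_mx_cons n k (x0 : R) (x : 'rV[R]_n) (t : 'rV[R]_k) :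
  row_mx (cons_rV (x0, x)) t = cons_rV (x0, row_mx x t) :> 'rV[R]_(n.+1 + k).
Proof.
apply/rowP => i; case: (unliftP ord0 i) => [j|] ->.
  rewrite cons_rVS; case: (splitP j) => l jl.
    have -> : j = lshift k l by exact: val_inj.
    have -> : lift ord0 (lshift k l) = lshift k (lift ord0 l) :> 'I_(n.+1 + k) by exact: val_inj.
    by rewrite !row_mxEl cons_rVS.
  have -> : j = rshift n l by exact: val_inj.
  have -> : lift ord0 (rshift n l) = rshift n.+1 l :> 'I_(n.+1 + k) by exact: val_inj.
  by rewrite !row_mxEr.
rewrite cons_rV0; have -> : ord0 = lshift k ord0 :> 'I_(n.+1 + k) by exact: val_inj.
by rewrite row_mxEl cons_rV0.
Qed.

(** Induction on [n], because [lebesgue_rV] is built by adding coordinates on the left. *)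
Lemma int_row n k (f : 'rV[R]_(n + k) -> \bar R) : measurable_fun setT f ->
  (forall x, (0 <= f x)%E) ->
  (\int[mu (n + k)]_z f z = \int[mu n]_x \int[mu k]_t f (row_mx x t))%E.
Proof.
elim: n f => [|n IH] f mf f0.
  have mp : measurable_fun setT (fun p : 'rV[R]_0 * 'rV[R]_k => f (row_mx p.1 p.2)).
    by apply: (meas_comp mf); apply: meas_row_mx; meas.
  rewrite int_rV0; last exact: (meas_eint1 (mu k) mp).
  apply: eq_integral => t _; congr f.
  apply/rowP => i; rewrite (_ : i = rshift 0 i); last exact: val_inj.
  rewrite row_mxEr; congr (t _ _); exact: val_inj.
have mp : measurable_fun setT (fun p : 'rV[R]_n.+1 * 'rV[R]_k => f (row_mx p.1 p.2)).
  by apply: (meas_comp mf); apply: meas_row_mx; meas.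
rewrite [RHS]int_cons; last 2 first.
- exact: (meas_eint1 (mu k) mp).
- by move=> x; exact: integral_ge0.
transitivity (\int[leb]_x0 \int[mu (n + k)]_x f (cons_rV (x0, x)))%E; first exact: int_cons.
apply: eq_integral => x0 _; rewrite IH//.
  have E x t : f (cons_rV (x0, row_mx x t)) = f (row_mx (cons_rV (x0, x)) t).
    exact: (congr1 f (esym (row_mx_cons x0 x t))).
  by under eq_integral do under eq_integral do rewrite E.
by apply: (meas_comp mf); apply: meas_cons2; meas.
Qed.

Lemma mu_rowE n k A : measurable A ->
  mu (n + k) A = prodm (mu n) (mu k) ((fun p => row_mx p.1 p.2) @^-1` A).
Proof.
move=> mA; have mphi : measurable_fun setT (fun p : 'rV[R]_n * 'rV[R]_k => row_mx p.1 p.2).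
  by apply: meas_row_mx; meas.
have mB : measurable ((fun p : 'rV[R]_n * 'rV[R]_k => row_mx p.1 p.2) @^-1` A).
  by rewrite -[X in measurable X]setTI; exact: mphi.
rewrite -(setIT A) -integral_indic// int_row; last 2 first.
- by apply/measurable_EFinP; exact: measurable_indic.
- by move=> x; rewrite lee_fin.
rewrite setIT -[in RHS](setIT (_ @^-1` _)) -integral_indic// /prodm tonelli1//.
- by apply/measurable_EFinP; exact: measurable_indic.
Qed.

Lemma int_rV_shift d (f : 'rV[R]_d -> \bar R) h : measurable_fun setT f ->
  (forall x, (0 <= f x)%E) -> (\int[mu d]_x f (x + h)%R = \int[mu d]_x f x)%E.
Proof.
elim: d f h => [|d IH] f h mf f0.
  have m1 : measurable_fun setT (fun x : 'rV[R]_0 => f (x + h)) by apply: (meas_comp mf); apply: meas_rVD; meas.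
  by rewrite !int_rV0//; congr f; apply/rowP => -[].
have m1 : measurable_fun setT (fun x : 'rV[R]_d.+1 => f (x + h)) by apply: (meas_comp mf); apply: meas_rVD; meas.
rewrite (int_cons m1 (fun x => f0 (x + h))) (int_cons mf f0).
pose h' := uncons_rV h.
have E x0 x : cons_rV (x0, x) + h = cons_rV (x0 + h'.1, x + h'.2).
  apply/rowP => i; rewrite mxE; case: (unliftP ord0 i) => [j|] ->.
    by rewrite !cons_rVS /= !mxE.
  by rewrite !cons_rV0.
have m2 : measurable_fun setT (fun p : measurableTypeR R * 'rV[R]_d => f (cons_rV p)).
  by apply: (meas_comp mf); exact: measurable_cons_rV.
rewrite -(@int_shift R (fun x0 => \int[mu d]_x f (cons_rV (x0, x)))%E h'.1); last 2 first.
- exact: (meas_eint1 (mu d) m2).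
- by move=> x; exact: integral_ge0.
apply: eq_integral => x0 _; under eq_integral do rewrite E.
by rewrite (IH (fun x => f (cons_rV (x0 + h'.1, x))))//; apply: (meas_comp mf); apply: meas_cons2; meas.
Qed.

Lemma int_rV_scale d (f : 'rV[R]_d -> \bar R) c : 0 < c -> measurable_fun setT f ->
  (forall x, (0 <= f x)%E) ->
  (\int[mu d]_x f (c *: x)%R = (c ^- d)%:E * \int[mu d]_x f x)%E.
Proof.
move=> c0; elim: d f => [|d IH] f mf f0.
  have m1 : measurable_fun setT (fun x : 'rV[R]_0 => f (c *: x)) by apply: (meas_comp mf); apply: meas_rVZ; meas.
  by rewrite !int_rV0// expr0 invr1 mul1e; congr f; apply/rowP => -[].
have m1 : measurable_fun setT (fun x : 'rV[R]_d.+1 => f (c *: x)) by apply: (meas_comp mf); apply: meas_rVZ; meas.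
rewrite !int_cons//.
have E x0 x : c *: cons_rV (x0, x) = cons_rV (c * x0 + 0, c *: x).
  apply/rowP => i; rewrite mxE; case: (unliftP ord0 i) => [j|] ->.
    by rewrite !cons_rVS /= !mxE.
  by rewrite !cons_rV0 addr0.
have m2 : measurable_fun setT (fun p : measurableTypeR R * 'rV[R]_d => f (cons_rV p)).
  by apply: (meas_comp mf); exact: measurable_cons_rV.
have m3 := meas_eint1 (mu d) m2 (fun p => f0 _).
have I0 x0 : (0 <= \int[mu d]_x f (cons_rV (x0, x)))%E by exact: integral_ge0.
have m4 : measurable_fun setT (fun x0 : R => \int[mu d]_x f (cons_rV ((c * x0 + 0)%R, x)))%E.
  by apply: (meas_comp m3); meas.
rewrite exprS invfM mulrC EFinM -muleA.
rewrite -(@ge0_int_affine R c 0 (fun x0 => \int[mu d]_x f (cons_rV (x0, x)))%E)//.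
rewrite -ge0_integralZl_EFin//; first last.
- by rewrite invr_ge0 exprn_ge0// ltW.
apply: eq_integral => x0 _; under eq_integral do rewrite E.
by rewrite (IH (fun x => f (cons_rV (c * x0 + 0, x))))//; apply: (meas_comp mf); apply: meas_cons2; meas.
Qed.

End rV.

(** * The Gagliardo seminorm in Fourier variables *)

Section enorm.
Variable R : realType.

Lemma dotvv_ge0 d (x : 'rV[R]_d) : 0 <= dotv x x.
Proof. by apply: sumr_ge0 => i _; rewrite -expr2 sqr_ge0. Qed.

Lemma enorm_ge0 d (x : 'rV[R]_d) : 0 <= enorm x.
Proof. exact: sqrtr_ge0. Qed.

Lemma enorm_sqr d (x : 'rV[R]_d) : enorm x ^+ 2 = dotv x x.
Proof. by rewrite sqr_sqrtr// dotvv_ge0. Qed.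

Lemma dotvZl d c (x y : 'rV[R]_d) : dotv (c *: x) y = c * dotv x y.
Proof. by rewrite /dotv mulr_sumr; apply: eq_bigr => i _; rewrite mxE mulrA. Qed.

Lemma dotvZr d c (x y : 'rV[R]_d) : dotv x (c *: y) = c * dotv x y.
Proof. by rewrite /dotv mulr_sumr; apply: eq_bigr => i _; rewrite mxE; ring. Qed.

Lemma dotvDl d (x y z : 'rV[R]_d) : dotv (x + y) z = dotv x z + dotv y z.
Proof. by rewrite /dotv -big_split/=; apply: eq_bigr => i _; rewrite mxE; ring. Qed.

Lemma dotvC d (x y : 'rV[R]_d) : dotv x y = dotv y x.
Proof. by rewrite /dotv; apply: eq_bigr => i _; rewrite mulrC. Qed.

Lemma enormZ d c (x : 'rV[R]_d) : enorm (c *: x) = `|c| * enorm x.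
Proof. by rewrite /enorm dotvZl dotvZr mulrA -expr2 sqrtrM ?sqr_ge0// sqrtr_sqr. Qed.

Lemma coord_le_enorm d (x : 'rV[R]_d) i : `|x ord0 i| <= enorm x.
Proof.
rewrite -sqrtr_sqr ler_wsqrtr// /dotv (bigD1 i)//= expr2 lerDl.
by apply: sumr_ge0 => j _; rewrite -expr2 sqr_ge0.
Qed.

Lemma enorm0_eq0 d (x : 'rV[R]_d) : enorm x = 0 -> x = 0.
Proof.
move=> x0; apply/rowP => i; rewrite mxE; apply/eqP.
by rewrite -normr_eq0 eq_le normr_ge0 andbT -x0 coord_le_enorm.
Qed.

Lemma dotv_unit d (x e : 'rV[R]_d) : enorm e = 1 -> `|dotv x e| <= enorm x.
Proof.
move=> e1; rewrite -sqrtr_sqr ler_wsqrtr//.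
have ee : dotv e e = 1 by rewrite -enorm_sqr e1 expr1n.
(* The squared length of the part of [x] orthogonal to [e] is [dotv x x - dotv x e ^+ 2]. *)
have := dotvv_ge0 (x + (- dotv x e) *: e).
rewrite dotvDl !(dotvC _ (x + _)) !dotvDl !dotvZl !dotvZr !(dotvC e x) ee; nra.
Qed.

Lemma meas_enorm d d' (T : measurableType d') (f : T -> 'rV[R]_d) :
  measurable_fun setT f -> measurable_fun setT (fun x => enorm (f x)).
Proof.
move=> mf; apply: (meas_comp (h := Num.sqrt : R -> R)).
  by apply: continuous_measurable_fun; exact: sqrt_continuous.
exact: meas_dotv.
Qed.

Lemma sin_le_norm (x : R) : `|sin x| <= `|x|.
Proof.
wlog x0 : x / 0 <= x.
  move=> H; have [|x0] := leP 0 x; first exact: H.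
  by rewrite -normrN -sinN -[leRHS]normrN; apply: H; rewrite oppr_ge0 ltW.
have [->|xn0] := eqVneq x 0; first by rewrite sin0.
have x1 : 0 < x by rewrite lt_neqAle eq_sym xn0.
have [c _] : exists2 c, c \in `]0, x[%R & sin x - sin 0 = cos c * (x - 0).
  apply: MVT => //.
  by apply: continuous_subspaceT => y; exact: continuous_sin.
rewrite sin0 !subr0 => ->; rewrite normrM ler_piMl// cos_norm1//.
Qed.

Lemma two_sub_cos (x : R) : 2 - 2 * cos x = 4 * sin (x / 2) ^+ 2.
Proof.
have {1}-> : x = x / 2 + x / 2 by field.
by rewrite cosD; have := cos2Dsin2 (x / 2); nra.
Qed.

Lemma two_sub_cos_ge0 (x : R) : 0 <= 2 - 2 * cos x.
Proof. by rewrite two_sub_cos mulr_ge0// sqr_ge0. Qed.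

Lemma two_sub_cos_le (x : R) : 2 - 2 * cos x <= x ^+ 2.
Proof.
rewrite two_sub_cos -(real_normK (num_real (sin _))).
have := sin_le_norm (x / 2); have := normr_ge0 (sin (x / 2)).
have -> : x ^+ 2 = 4 * `|x / 2| ^+ 2 by rewrite real_normK ?num_real//; field.
by move=> h1 h2; rewrite ler_wpM2l// lerXn2r// nnegrE.
Qed.

Lemma two_sub_cos_le4 (x : R) : 2 - 2 * cos x <= 4.
Proof. by have := cos_geN1 x; lra. Qed.

End enorm.

(** * Power integrals over dyadic shells *)

Section shells.
Variable R : realType.
Local Notation mu := (lebesgue_rV R).

Lemma indic_ge0R (T : Type) (A : set T) (x : T) : 0 <= \1_A x :> R.
Proof. by rewrite indicE. Qed.

Lemma indic_le1R (T : Type) (A : set T) (x : T) : \1_A x <= 1 :> R.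
Proof. by rewrite indicE; case: (_ \in _). Qed.

Lemma meas_indic_enorm d (J : set R) : measurable J ->
  measurable_fun setT (fun h : 'rV[R]_d => \1_J (enorm h) : R).
Proof.
move=> mJ; apply: (meas_comp (measurable_indic mJ)).
by apply: meas_enorm; meas.
Qed.

Lemma meas_enorm_pow d q : measurable_fun setT (fun h : 'rV[R]_d => enorm h `^ q).
Proof. by meas; apply: meas_enorm; meas. Qed.

(* Replaces polar coordinates: scaling by [c] bounds the integral over [J N.+1]
   by [S] plus a fixed factor less than 1 times the integral over [J N]. *)
Lemma shells_lty d (q c S : R) (J : nat -> set R) :
  0 < c -> c ^+ d * c `^ q < 1 ->
  (forall N, measurable (J N)) -> J 0%N = set0 ->
  (forall N M, (N <= M)%N -> J N `<=` J M) ->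
  (forall N r, J N.+1 r -> J 1%N r \/ J N (c^-1 * r)) ->
  (\int[mu d]_h (\1_(J 1%N) (enorm h) * enorm h `^ q)%:E <= S%:E)%E ->
  (\int[mu d]_h (\1_(\bigcup_N J N) (enorm h) * enorm h `^ q)%:E < +oo)%E.
Proof.
move=> c0 rho1 mJ J0 ndJ recJ SE.
pose rho := c ^+ d * c `^ q; pose I N := (\int[mu d]_h (\1_(J N) (enorm h) * enorm h `^ q)%:E)%E.
have rho0 : 0 <= rho by rewrite mulr_ge0 ?exprn_ge0 ?powR_ge0// ltW.
have mI N : measurable_fun setT (fun h : 'rV[R]_d => \1_(J N) (enorm h) * enorm h `^ q).
  by apply: measurable_funM; [exact: meas_indic_enorm|exact: meas_enorm_pow].
have fge0 N h : 0 <= \1_(J N) (enorm (h : 'rV[R]_d)) * enorm h `^ q.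
  by rewrite mulr_ge0 ?indic_ge0R ?powR_ge0.
have rec N : (I N.+1 <= S%:E + rho%:E * I N)%E.
  pose f (h : 'rV[R]_d) := (\1_(J N) (enorm h) * enorm h `^ q).
  have mfs : measurable_fun setT (fun h : 'rV[R]_d => f (c^-1 *: h)).
    by apply: (meas_comp (mI N)); apply: meas_rVZ; meas.
  have sc := @int_rV_scale R d (fun h => (f h)%:E) c^-1.
  have -> : (rho%:E * I N = (c `^ q)%:E * \int[mu d]_h (f (c^-1 *: h))%:E)%E.
    rewrite sc ?invr_gt0//.
    - by rewrite exprVn invrK muleA -EFinM [_ * c ^+ d]mulrC.
    - by apply/measurable_EFinP; exact: (mI N).
    - by move=> x; rewrite lee_fin; exact: fge0.
  rewrite -(@ge0_intZ _ _ _ (mu d) (c `^ q) (fun h => f (c^-1 *: h)) mfs (fun h => fge0 _ _) (powR_ge0 _ _)).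
  apply: le_trans (leeD2r _ SE).
  rewrite -ge0_intD; first last.
  - by move=> x; rewrite mulr_ge0 ?powR_ge0 ?fge0.
  - by move=> x; exact: (fge0 1%N).
  - by meas.
  - exact: (mI 1%N).
  have m1 := mI 1%N.
  apply: ge0_le_intR; [exact: (mI N.+1)| |exact: fge0|].
    by apply: measurable_funD (mI 1%N) _; exact: (measurable_funM (measurable_cst _) mfs).
  move=> h; rewrite /f enormZ.
  have ci : 0 <= c^-1 by rewrite invr_ge0 ltW.
  have -> : c `^ q * (\1_(J N) (`|c^-1| * enorm h) * (`|c^-1| * enorm h) `^ q) =
     \1_(J N) (c^-1 * enorm h) * enorm h `^ q.
    rewrite (ger0_norm ci) mulrCA -powRM ?mulr_ge0 ?enorm_ge0 ?(ltW c0)//.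
    by rewrite mulrA mulfV ?gt_eqF// mul1r.
  rewrite -mulrDl ler_wpM2r ?powR_ge0// !indicE.
  have [|_] := boolP (enorm h \in J N.+1); last by rewrite addr_ge0.
  rewrite inE => /recJ[H|H]; rewrite (mem_set H) ?lerDl ?lerDr//.
(* The fixed point of [x |-> S + rho * x], hence a bound preserved by the recursion, which starts
   from [I 0 = 0]. *)
pose M := S / (1 - rho).
have r1 : 0 < 1 - rho by rewrite subr_gt0.
have S0 : 0 <= S.
  by rewrite -lee_fin; apply: le_trans SE; apply: int_ge0 => h; exact: (fge0 1%N).
have M0 : 0 <= M by rewrite divr_ge0// ltW.
have IM N : (I N <= M%:E)%E.
  elim: N => [|N IH].
    rewrite /I (_ : (fun h => _) = fun=> 0%E) ?integral0 ?lee_fin//.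
    by apply/funext => h; rewrite J0 indicE in_set0 mul0r.
  apply: le_trans (rec N) _.
  apply: (@le_trans _ _ (S%:E + rho%:E * M%:E)%E).
    by apply: leeD2l; apply: lee_wpmul2l.
  rewrite -EFinM -EFinD lee_fin /M.
  by rewrite le_eqVlt; apply/orP; left; apply/eqP; field; rewrite gt_eqF.
have cv : I @ \oo --> (\int[mu d]_h limn (fun N => (\1_(J N) (enorm h) * enorm h `^ q)%:E))%E.
  apply: (@cvg_monotone_convergence _ _ _ (mu d) setT measurableT
    (fun N h => (\1_(J N) (enorm h) * enorm h `^ q)%:E)).
  - by move=> N; have m := mI N; meas.
  - by move=> N h _; rewrite lee_fin.
  move=> h _ N k Nk; rewrite lee_fin ler_wpM2r ?powR_ge0// !indicE.
  have [|_] := boolP (enorm h \in J N); last by [].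
  by rewrite inE => /(ndJ _ _ Nk) H; rewrite mem_set.
apply: (@le_lt_trans _ _ M%:E); last exact: ltry.
rewrite (_ : (\int[_]_h _ = \int[mu d]_h limn (fun N => (\1_(J N) (enorm h) * enorm h `^ q)%:E))%E); last first.
  apply: eq_integral => h _; apply/esym/cvg_lim => //.
  apply/fine_cvgP; split; first exact: nearW.
  apply: cvgM; last exact: cvg_cst.
  have [[N _ JN]|nJ] := pselect ((\bigcup_N J N) (enorm h)).
    apply: cvg_near_cst; exists N => // k /= Nk.
    rewrite !indicE mem_set; last by apply: ndJ Nk _ JN.
    by rewrite mem_set//; exists N.
  apply: cvg_near_cst; apply: nearW => k; rewrite !indicE memNset.
    by rewrite memNset.
  by move=> Jk; apply: nJ; exists k.
rewrite -(cvg_lim _ cv)//; apply: lime_le; first exact: (cvgP _ cv).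
by apply: nearW => N; exact: IM.
Qed.

Lemma mu_cube_lty d (L : R) : (mu d [set v : 'rV[R]_d | forall i, `[(- L)%R, L]%classic (v ord0 i)] < +oo)%E.
Proof.
rewrite (@lebesgue_rV_box R d (fun=> `[(- L)%R, L]%classic))//.
have fin : (lebesgue_measure (`[(- L)%R, L]%classic : set R) < +oo)%E.
  by rewrite lebesgue_measure_itv/=; case: ifPn => _; rewrite ?ltry// -EFinB ltry.
have : (\prod_(i < d) lebesgue_measure (`[(- L)%R, L]%classic : set R))%E \is a fin_num.
  by apply: prode_fin_num => i _; rewrite ge0_fin_numE.
by rewrite fin_numElt => /andP[].
Qed.

End shells.

Section kernel.
Variable R : realType.
Local Notation mu := (lebesgue_rV R).
Variables (d : nat) (s : R).
Hypothesis hs : 0 < s < 1.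
Local Notation p := (d%:R + 2 * s).

Let s0 : 0 < s. Proof. by case/andP: hs. Qed.
Let s1 : s < 1. Proof. by case/andP: hs. Qed.
Let p0 : 0 < p. Proof. by rewrite ltr_wpDl// mulr_gt0. Qed.

Lemma two_powR_gt1 (q : R) : 0 < q -> 1 < 2 `^ q.
Proof.
move=> q0; have := @gt0_ltr_powR R q q0 1 2; rewrite powR1 !nnegrE; apply => //; exact: ltr1n.
Qed.

Lemma int_cube_lty (J : set R) (q L K : R) : measurable J ->
  (forall r, J r -> `|r| <= L /\ r `^ q <= K) ->
  (\int[mu d]_h (\1_J (enorm h) * enorm h `^ q)%:E < +oo)%E.
Proof.
move=> mJ JL.
pose A := [set v : 'rV[R]_d | forall i, `[(- L)%R, L]%classic (v ord0 i)].
have mA : measurable A.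
  have -> : A = \bigcap_(i in [set: 'I_d]) ((fun v : 'rV[R]_d => v ord0 i) @^-1` `[(- L)%R, L]%classic).
    by apply/seteqP; split => [v Av i _|v Av i]; [exact: Av|exact: Av].
  apply: fin_bigcap_measurable => // i _.
  by rewrite -[X in measurable X]setTI; apply: measurable_coord => //; exact: measurable_itv.
apply: (@le_lt_trans _ _ (\int[mu d]_h (`|K| * \1_A h)%:E)%E).
  apply: ge0_le_intR.
  - by apply: measurable_funM; [exact: meas_indic_enorm|exact: meas_enorm_pow].
  - by apply: measurable_funM => //; exact: (measurable_indic mA).
  - by move=> h; rewrite mulr_ge0 ?indic_ge0R ?powR_ge0.
  move=> h; rewrite !indicE; have [|_] := boolP (enorm h \in J); last by rewrite mul0r mulr_ge0.
  rewrite inE => /JL[hL hK]; rewrite mul1r mem_set ?mulr1.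
    by rewrite (le_trans hK)// ler_norm.
  move=> i /=; rewrite in_itv/= -ler_norml (le_trans (coord_le_enorm _ _))//.
  by rewrite (le_trans (ler_norm _)).
rewrite ge0_intZ//.
by rewrite integral_indic// setIT lte_mul_pinfty// mu_cube_lty.
Qed.

(** Doubling the radius multiplies a shell integral by [2 ^ (- 2 s)], which is less than 1 because
    [s > 0]. *)
Lemma far_lty :
  (\int[mu d]_h (\1_(\bigcup_N `[1%R, (2 ^+ N)%R[%classic) (enorm h) * enorm h `^ (- p))%:E < +oo)%E.
Proof.
have mJ N : measurable (`[1%R, (2 ^+ N : R)[%classic) by exact: measurable_itv.
have fin : (\int[mu d]_h (\1_(`[1%R, (2 ^+ 1 : R)[%classic) (enorm h) * enorm h `^ (- p))%:E < +oo)%E.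
  apply: (@int_cube_lty _ _ 2 1) => // r /=; rewrite in_itv/= expr1 => /andP[r1 r2].
  split; first by rewrite ger0_norm ?(ltW r2)// (le_trans ler01).
  rewrite powRN invf_le1 ?powR_gt0 ?(lt_le_trans ltr01)//.
  by have := ler_powR r1 (ltW p0); rewrite powRr0.
have [S SE] : exists S : R, (\int[mu d]_h (\1_(`[1%R, (2 ^+ 1 : R)[%classic) (enorm h) * enorm h `^ (- p))%:E <= S%:E)%E.
  exists (fine (\int[mu d]_h (\1_(`[1%R, (2 ^+ 1 : R)[%classic) (enorm h) * enorm h `^ (- p))%:E)).
  by rewrite fineK// ge0_fin_numE// int_ge0// => h; rewrite mulr_ge0 ?indic_ge0R ?powR_ge0.
apply: (@shells_lty R d (- p) 2 S (fun N => `[1%R, (2 ^+ N)%R[%classic)) => //.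
- rewrite -powR_mulrn// -powRD; last by rewrite pnatr_eq0 implybT.
  rewrite (_ : d%:R - p = - (2 * s)); last by ring.
  by rewrite powRN invf_lt1 ?powR_gt0// two_powR_gt1// mulr_gt0.
- by apply/seteqP; split => r //=; rewrite in_itv/= expr0 => /andP[a b]; move: (le_lt_trans a b); rewrite ltxx.
- move=> N M NM r /=; rewrite !in_itv/= => /andP[-> rN] /=.
  by rewrite (lt_le_trans rN)// ler_eXn2l// ltr1n.
move=> N r /=; rewrite !in_itv/= expr1 => /andP[r1 rN].
have [r2|r2] := ltP r 2; first by left; rewrite r1.
right; rewrite ler_pdivlMl// mulr1 r2 /= ltr_pdivrMl// -exprS//.
Qed.

(** Halving the radius multiplies a shell integral by [2 ^ (- 2 (1 - s))], which is less than 1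
    because [s < 1]. *)
Lemma near_lty :
  (\int[mu d]_h (\1_(\bigcup_N `[((2^-1) ^+ N)%R, 1%R[%classic) (enorm h) * enorm h `^ (2 - p))%:E < +oo)%E.
Proof.
have mJ N : measurable (`[((2^-1 : R) ^+ N), 1%R[%classic) by exact: measurable_itv.
have fin : (\int[mu d]_h (\1_(`[((2^-1 : R) ^+ 1), 1%R[%classic) (enorm h) * enorm h `^ (2 - p))%:E < +oo)%E.
  (* For [r] between 1/2 and 1 the power with exponent [2 - p] is at most 1 if the exponent is
     nonnegative, and at most 2 to the [p - 2] otherwise; the sum covers both cases. *)
  apply: (@int_cube_lty _ _ 1 (1 + 2 `^ (p - 2))) => // r /=; rewrite in_itv/= expr1 => /andP[r1 r2].
  have r0 : 0 < r by rewrite (lt_le_trans _ r1)// invr_gt0.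
  split; first by rewrite ger0_norm ?ltW.
  have [q0|q0] := leP 0 (2 - p).
    rewrite (@le_trans _ _ 1)// ?lerDl ?powR_ge0//.
    have := @ge0_ler_powR R _ q0 r 1; rewrite powR1 => -> //; rewrite ?nnegrE// ltW//.
  have -> : r `^ (2 - p) = r^-1 `^ (p - 2) by rewrite -(powR_inv1 (ltW r0)) -powRrM mulN1r opprB.
  have q1 : 0 <= p - 2 by rewrite -opprB oppr_ge0 ltW.
  apply: ler_wpDl => //; apply: (ge0_ler_powR q1); rewrite ?nnegrE//.
    by rewrite invr_ge0 ltW.
  by rewrite -[leRHS]invrK lef_pV2 ?posrE ?invr_gt0.
have [S SE] : exists S : R, (\int[mu d]_h (\1_(`[((2^-1 : R) ^+ 1), 1%R[%classic) (enorm h) * enorm h `^ (2 - p))%:E <= S%:E)%E.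
  exists (fine (\int[mu d]_h (\1_(`[((2^-1 : R) ^+ 1), 1%R[%classic) (enorm h) * enorm h `^ (2 - p))%:E)).
  by rewrite fineK// ge0_fin_numE// int_ge0// => h; rewrite mulr_ge0 ?indic_ge0R ?powR_ge0.
apply: (@shells_lty R d (2 - p) 2^-1 S (fun N => `[((2^-1) ^+ N)%R, 1%R[%classic)) => //.
- rewrite -powR_mulrn// -powRD; last by rewrite invr_eq0 pnatr_eq0 implybT.
  rewrite (_ : d%:R + (2 - p) = 2 * (1 - s)); last by ring.
  rewrite -powR_inv1// -powRrM mulN1r powRN invf_lt1 ?powR_gt0//.
  by rewrite two_powR_gt1// mulr_gt0// subr_gt0.
- by apply/seteqP; split => r //=; rewrite in_itv/= expr0 => /andP[a b]; move: (le_lt_trans a b); rewrite ltxx.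
- move=> N M NM r /=; rewrite !in_itv/= => /andP[rN ->] /=; rewrite andbT.
  by rewrite (le_trans _ rN)// ler_wiXn2l// invf_le1// ler1n.
move=> N r /=; rewrite !in_itv/= expr1 invrK => /andP[rN r1].
have [r2|r2] := leP 2^-1 r; first by left; rewrite r1.
right; rewrite -ltr_pdivlMl// mulr1 r2 andbT -ler_pdivrMl// -exprS//.
Qed.

(* Dominates [symb_fun xi] for all unit vectors [xi]. *)
Definition levy (h : 'rV[R]_d) : R := Num.min 4 (enorm h ^+ 2) / enorm h `^ p.

Lemma levy_ge0 h : 0 <= levy h.
Proof. by rewrite divr_ge0 ?powR_ge0// le_min sqr_ge0 andbT. Qed.

Lemma meas_inv_pow q : measurable_fun setT (fun h : 'rV[R]_d => (enorm h `^ q)^-1).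
Proof. by under eq_fun do rewrite -powRN; exact: meas_enorm_pow. Qed.

Lemma meas_levy : measurable_fun setT levy.
Proof.
apply: measurable_funM; last exact: meas_inv_pow.
apply: measurable_minr => //.
have h : measurable_fun setT (fun h : 'rV[R]_d => enorm h) by apply: meas_enorm; meas.
by meas.
Qed.

Lemma levy_lty : (\int[mu d]_h (levy h)%:E < +oo)%E.
Proof.
set F := \bigcup_N `[1%R, (2 ^+ N)%R[%classic : set R.
set N0 := \bigcup_N `[((2^-1) ^+ N)%R, 1%R[%classic : set R.
have mF : measurable F by apply: bigcup_measurable => N _; exact: measurable_itv.
have mN : measurable N0 by apply: bigcup_measurable => N _; exact: measurable_itv.
have m1 : measurable_fun setT (fun h : 'rV[R]_d => \1_F (enorm h) * enorm h `^ (- p)).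
  by apply: measurable_funM; [exact: meas_indic_enorm|exact: meas_enorm_pow].
have m2 : measurable_fun setT (fun h : 'rV[R]_d => \1_N0 (enorm h) * enorm h `^ (2 - p)).
  by apply: measurable_funM; [exact: meas_indic_enorm|exact: meas_enorm_pow].
have pos (A : set R) h q : 0 <= \1_A (enorm (h : 'rV[R]_d)) * enorm h `^ q.
  by rewrite mulr_ge0 ?indic_ge0R ?powR_ge0.
apply: (@le_lt_trans _ _ (\int[mu d]_h (4 * (\1_F (enorm h) * enorm h `^ (- p)) +
    \1_N0 (enorm h) * enorm h `^ (2 - p))%:E)%E).
  apply: ge0_le_intR; [exact: meas_levy|by meas|exact: levy_ge0|].
  move=> h; rewrite /levy; have := enorm_ge0 h; move: (enorm h) => r r0.
  have [->|rn0] := eqVneq r 0.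
    (* At the origin the quotient takes the value 0, as 0 to the power [p] is 0 and [0^-1 = 0]. *)
    rewrite powR0 ?gt_eqF// invr0 mulr0 addr_ge0// ?mulr_ge0 ?indic_ge0R ?powR_ge0//.
  have r1 : 0 < r by rewrite lt_neqAle eq_sym rn0.
  have [rl|rg] := ltP r 1.
    apply: ler_wpDl; first by rewrite !mulr_ge0 ?indic_ge0R ?powR_ge0.
    rewrite indicE mem_set ?mul1r; last first.
      have : (fun n : nat => (2^-1 : R) ^+ n) @ \oo --> (0 : R).
        by apply: cvg_expr; rewrite ger0_norm// invf_lt1// ltr1n.
      move=> /cvgr_lt /(_ _ r1)[N _ HN]; exists N => //=; rewrite in_itv/= rl andbT ltW//.
      exact: (HN N (leqnn N)).
    have -> : r `^ (2 - p) = r ^+ 2 / r `^ p.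
      by rewrite -(powR_mulrn 2 r0) -powRN -powRD// rn0 implybT.
    by rewrite ler_wpM2r ?invr_ge0 ?powR_ge0// ge_min lexx orbT.
  apply: ler_wpDr; first by rewrite mulr_ge0 ?indic_ge0R ?powR_ge0.
  rewrite indicE mem_set ?mul1r; last first.
    exists (Num.bound r) => //=; rewrite in_itv/= rg /=.
    by rewrite (lt_le_trans (archi_boundP r0))// -natrX ler_nat ltnW// ltn_expl.
  by rewrite powRN ler_wpM2r ?invr_ge0 ?powR_ge0// ge_min lexx.
rewrite ge0_intD//; try by [meas|move=> x; rewrite mulr_ge0].
rewrite ge0_intZ//.
by apply: lte_add_pinfty; [rewrite lte_mul_pinfty// ?int_ge0// far_lty|exact: near_lty].
Qed.

End kernel.

(** * The Fourier symbol of the Gagliardo integral *)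

Section symbol.
Variable R : realType.
Local Notation mu := (lebesgue_rV R).
Variables (d : nat) (s : R).
Hypothesis hs : 0 < s < 1.
Local Notation p := (d%:R + 2 * s).

Let s0 : 0 < s. Proof. by case/andP: hs. Qed.
Let s1 : s < 1. Proof. by case/andP: hs. Qed.
Let p0 : 0 < p. Proof. by rewrite ltr_wpDl// mulr_gt0. Qed.

(** [2 - 2 * cos] is the squared modulus of [exp (i h.xi) - 1], the factor by which taking
    increments with step [h] multiplies the squared transform ([psq_diff]). *)
Definition symb_fun (xi h : 'rV[R]_d) : R := (2 - 2 * cos (dotv h xi)) / enorm h `^ p.

(* [symb] is homogeneous of degree [2 s] under positive dilations, so that it
   suffices to bound it above and below on unit vectors. *)
Definition symb (xi : 'rV[R]_d) : \bar R := (\int[mu d]_h (symb_fun xi h)%:E)%E.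

Lemma symb_fun_ge0 xi h : 0 <= symb_fun xi h.
Proof. by rewrite divr_ge0 ?two_sub_cos_ge0 ?powR_ge0. Qed.

Lemma meas_symb_fun xi : measurable_fun setT (symb_fun xi).
Proof.
apply: measurable_funM; last exact: meas_inv_pow.
have h : measurable_fun setT (fun h : 'rV[R]_d => dotv h xi) by apply: meas_dotv; meas.
by meas.
Qed.

Lemma symb_scale (r : R) (e : 'rV[R]_d) : 0 < r ->
  (symb (r *: e) = (r `^ (2 * s))%:E * symb e)%E.
Proof.
move=> r0; have ms := meas_symb_fun e.
have E h : symb_fun (r *: e) h = r `^ p * symb_fun e (r *: h).
  rewrite /symb_fun dotvZr dotvZl enormZ (gtr0_norm r0) powRM ?(ltW r0) ?enorm_ge0//.
  by rewrite invfM [RHS]mulrCA mulVKf// powR_eq0 gt_eqF.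
rewrite /symb; under eq_integral do rewrite E.
have mr : measurable_fun setT (fun h : 'rV[R]_d => symb_fun e (r *: h)).
  by apply: (meas_comp ms); apply: meas_rVZ; meas.
rewrite (ge0_intZ (mu d) mr (fun h => symb_fun_ge0 e (r *: h)) (powR_ge0 r p)).
rewrite (@int_rV_scale R d (fun h => (symb_fun e h)%:E))//.
- rewrite muleA -EFinM; congr (_%:E * _)%E.
  rewrite powRD ?gt_eqF ?implybT// powR_mulrn ?(ltW r0)//.
  by rewrite mulrAC mulfV ?mul1r// expf_neq0// gt_eqF.
- by apply/measurable_EFinP; exact: ms.
- by move=> h; rewrite lee_fin symb_fun_ge0.
Qed.

Definition symb_ub : R := fine (\int[mu d]_h (levy s h)%:E)%E.

Lemma symb_ubE : (\int[mu d]_h (levy s h)%:E)%E = symb_ub%:E.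
Proof.
by rewrite /symb_ub fineK// ge0_fin_numE ?levy_lty// int_ge0// => h; exact: levy_ge0.
Qed.

Lemma symb_ub_ge0 : 0 <= symb_ub.
Proof. by rewrite -lee_fin -symb_ubE int_ge0// => h; exact: levy_ge0. Qed.

Lemma enorm_dir (xi : 'rV[R]_d) : enorm xi != 0 ->
  xi = enorm xi *: ((enorm xi)^-1 *: xi) /\ enorm ((enorm xi)^-1 *: xi) = 1.
Proof.
move=> xn0; rewrite scalerA mulfV// scale1r; split => //.
by rewrite enormZ normfV ger0_norm ?enorm_ge0// mulVf.
Qed.

Lemma symb_le xi : (symb xi <= (symb_ub * enorm xi `^ (2 * s))%:E)%E.
Proof.
have [x0|xn0] := eqVneq (enorm xi) 0.
  rewrite (enorm0_eq0 x0) /symb (_ : (fun h => _) = fun=> 0%E); last first.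
    apply/funext => h; rewrite /symb_fun -(scale0r 0) dotvZr mul0r cos0 mulr1 subrr mul0r//.
  by rewrite integral0 lee_fin mulr_ge0 ?powR_ge0 ?symb_ub_ge0.
have [xE e1] := enorm_dir xn0.
have xp : 0 < enorm xi by rewrite lt_neqAle eq_sym xn0 enorm_ge0.
rewrite [in X in (X <= _)%E]xE symb_scale// [X in (_ <= X%:E)%E]mulrC EFinM.
apply: lee_wpmul2l; first by rewrite lee_fin powR_ge0.
rewrite -symb_ubE; apply: ge0_le_intR.
- exact: meas_symb_fun.
- exact: meas_levy.
- exact: symb_fun_ge0.
move=> h; rewrite /symb_fun /levy ler_wpM2r ?invr_ge0 ?powR_ge0//.
rewrite le_min two_sub_cos_le4/= (le_trans (two_sub_cos_le _))//.
by rewrite -real_normK ?num_real// lerXn2r ?nnegrE ?enorm_ge0// dotv_unit.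
Qed.

(** The least value of [2 - 2 * cos] on [[1/4, 3/4]] times the volume of the cube of side
    [1 / (2 d)] centred at [e / 2], for a unit vector [e]: on it [dotv h e] lies in that interval
    and [enorm h <= 1], so that dividing by a power of [enorm h] only helps. *)
Definition symb_lb : R := (2 - 2 * cos 4^-1) * ((2 * d%:R)^-1) ^+ d.

Lemma symb_lb_gt0 : (0 < d)%N -> 0 < symb_lb.
Proof.
move=> d0; rewrite mulr_gt0 ?exprn_gt0 ?invr_gt0 ?mulr_gt0 ?ltr0n//.
rewrite subr_gt0 gtr_pMr// -[ltRHS]cos0 ltr_cos ?invr_gt0// in_itv/=.
  by rewrite lexx pi_ge0.
rewrite invr_ge0 ler0n/= (le_trans _ (pi_ge2 R))//.
by rewrite (@le_trans _ _ 1)// ?invf_le1// ler1n.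
Qed.

Lemma symb_ge xi : (0 < d)%N -> ((symb_lb * enorm xi `^ (2 * s))%:E <= symb xi)%E.
Proof.
move=> d0; have [x0|xn0] := eqVneq (enorm xi) 0.
  rewrite x0 powR0 ?mulr0; last by rewrite mulf_neq0// gt_eqF.
  by apply: int_ge0 => h; exact: symb_fun_ge0.
have [xE e1] := enorm_dir xn0.
have xp : 0 < enorm xi by rewrite lt_neqAle eq_sym xn0 enorm_ge0.
rewrite [in X in (_ <= X)%E]xE symb_scale// [X in (X%:E <= _)%E]mulrC EFinM.
apply: lee_wpmul2l; first by rewrite lee_fin powR_ge0.
move: ((enorm xi)^-1 *: xi) e1 => e e1 {xE}.
(* The coordinates of [e] are at most 1 in modulus, so moving each of the [d] coordinates of [h] by
   at most [del] changes [dotv h e] by at most 1/4. *)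
pose del : R := (4 * d%:R)^-1.
pose A i : set R := `[(e ord0 i / 2 - del)%R, (e ord0 i / 2 + del)%R]%classic.
pose B := [set v : 'rV[R]_d | forall i, A i (v ord0 i)].
have dR : 0 < d%:R :> R by rewrite ltr0n.
have del0 : 0 < del by rewrite invr_gt0 mulr_gt0.
have mB : measurable B.
  have -> : B = \bigcap_(i in [set: 'I_d]) ((fun v : 'rV[R]_d => v ord0 i) @^-1` A i).
    by apply/seteqP; split => [v Av i _|v Av i]; [exact: Av|exact: Av].
  apply: fin_bigcap_measurable => // i _.
  by rewrite -[X in measurable X]setTI; apply: measurable_coord => //; exact: measurable_itv.
pose k0 : R := 2 - 2 * cos 4^-1.
apply: (@le_trans _ _ (\int[mu d]_h (k0 * \1_B h)%:E)%E).
  have k00 : 0 <= k0 by exact: two_sub_cos_ge0.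
  have BE : (\int[mu d]_h (\1_B h)%:E = \prod_(i < d) lebesgue_measure (A i))%E.
    rewrite integral_indic// setIT.
    by apply: lebesgue_rV_box => i; exact: measurable_itv.
  rewrite ge0_intZ// BE.
  rewrite (eq_bigr (fun=> ((2 * d%:R)^-1)%:E)); last first.
    move=> i _; rewrite lebesgue_measure_itv/= lte_fin ltrD2l gtrN//.
    rewrite -EFinB; congr EFin; rewrite /del; field; rewrite gt_eqF//.
  by rewrite prodEFin -EFinM lee_fin /symb_lb prodr_const card_ord.
have coord1 i : `|e ord0 i| <= 1 by rewrite -e1 coord_le_enorm.
apply: ge0_le_intR; [|exact: meas_symb_fun| |].
- by apply: measurable_funM => //; exact: (measurable_indic mB).
- by move=> h; rewrite mulr_ge0 ?two_sub_cos_ge0 ?indic_ge0R.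
move=> h; rewrite indicE; have [|_] := boolP (h \in B); last by rewrite mulr0 symb_fun_ge0.
rewrite inE mulr1 => Bh.
pose D : 'rV[R]_d := h - 2^-1 *: e.
have hE : h = D + 2^-1 *: e by rewrite /D subrK.
have Dd i : `|D ord0 i| <= del.
  by move: (Bh i); rewrite /A /= in_itv/= !mxE ler_norml => /andP[h1 h2]; apply/andP; split; lra.
have sdel : \sum_(i < d) del = 4^-1.
  by rewrite sumr_const card_ord -[LHS]mulr_natl /del; field; rewrite gt_eqF.
have De : `|dotv D e| <= 4^-1.
  rewrite (le_trans (ler_norm_sum _ _ _))//.
  rewrite (@le_trans _ _ (\sum_(i < d) del))//.
    apply: ler_sum => i _; rewrite normrM (le_trans (ler_wpM2l _ (coord1 i)))// mulr1//.
  by rewrite sdel.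
have DD : dotv D D <= 4^-1.
  rewrite (@le_trans _ _ (\sum_(i < d) del))//.
    apply: ler_sum => i _; rewrite -expr2 -real_normK ?num_real// expr2.
    rewrite (le_trans (ler_pM _ _ (Dd i) (Dd i)))// ler_piMr ?ltW//.
    rewrite /del invf_lt1 ?mulr_gt0//; have : 1 <= d%:R :> R by rewrite ler1n.
    by lra.
  by rewrite sdel.
have ee : dotv e e = 1 by rewrite -enorm_sqr e1 expr1n.
have he : dotv h e = dotv D e + 2^-1 by rewrite hE dotvDl dotvZl ee mulr1.
have hh : dotv h h <= 1.
  rewrite [in X in dotv X _]hE dotvDl dotvZl (dotvC e) he (dotvC D) hE dotvDl dotvZl (dotvC e).
  by move: De DD; rewrite ler_norml => /andP[]; lra.
have h1 : enorm h <= 1 by rewrite -(sqrtr1 R) ler_wsqrtr.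
have he1 : 4^-1 <= dotv h e <= 3 / 4.
  by move: De; rewrite ler_norml he => /andP[a b]; apply/andP; split; lra.
have hp : 0 < enorm h `^ p.
  rewrite powR_gt0// lt_neqAle enorm_ge0 andbT eq_sym; apply/eqP => h0.
  by move: he1; rewrite (enorm0_eq0 h0) -(scale0r 0) dotvZl mul0r; lra.
have hp1 : enorm h `^ p <= 1.
  by have := @ge0_ler_powR R p (ltW p0) (enorm h) 1; rewrite powR1 !nnegrE; apply => //; exact: enorm_ge0.
rewrite /symb_fun ler_pdivlMr// (le_trans (_ : _ <= k0))//.
  by rewrite ler_piMr// two_sub_cos_ge0.
rewrite lerD2l lerN2 ler_pM2l// leNgt ltr_cos -?leNgt ?in_itv/=; case/andP: he1 => a1 a2 //.
- by rewrite (le_trans _ a1)/= ?(le_trans a2)// ?(le_trans _ (pi_ge2 R))//; lra.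
- by rewrite invr_ge0 ler0n/= (le_trans a1)// (le_trans a2)// (le_trans _ (pi_ge2 R))//; lra.
Qed.

End symbol.

Section gagliardo.
Variable R : realType.
Local Notation mu := (lebesgue_rV R).
Variables (d : nat).
Implicit Types u v : 'rV[R]_d -> R.

Local Notation fc u := (Fc (mu d) (@rth R d) u).
Local Notation fs u := (Fs (mu d) (@rth R d) u).

Definition psq u xi : R := fc u xi ^+ 2 + fs u xi ^+ 2.

Lemma psq_ge0 u xi : 0 <= psq u xi.
Proof. by rewrite addr_ge0// sqr_ge0. Qed.

Lemma meas_psq u : measurable_fun setT u -> measurable_fun setT (psq u).
Proof.
move=> m; have h1 := meas_Fc (mu d) (@meas_rth R d) m.
by have h2 := meas_Fs (mu d) (@meas_rth R d) m; rewrite /psq; meas.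
Qed.

Lemma nice0 : nice (mu d) (fun=> 0).
Proof.
split; first exact: integrable0.
by under eq_integral do rewrite expr0n/=; rewrite integral0.
Qed.

Lemma Fsq0 u xi : Fsq (mu d) (@rth R d) u (fun=> 0) xi = psq u xi.
Proof. exact: Fsq_real. Qed.

Lemma plancherel_psq u : nice (mu d) u ->
  (\int[mu d]_xi (psq u xi)%:E = ((2 * pi) ^+ d)%:E * \int[mu d]_x (u x ^+ 2)%:E)%E.
Proof.
move=> nu; have := @plancherel_rV R d u _ nu nice0.
under eq_integral do rewrite Fsq0.
by move=> ->; congr (_ * _)%E; apply: eq_integral => x _; rewrite expr0n/= addr0.
Qed.

Lemma mu_shiftE (h : 'rV[R]_d) A : measurable A ->
  mu d A = mu d ((fun x => x + h) @^-1` A).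
Proof.
move=> mA; have mphi : measurable_fun setT (fun x : 'rV[R]_d => x + h).
  by apply: meas_rVD; meas.
have mB : measurable ((fun x => x + h) @^-1` A).
  by rewrite -[X in measurable X]setTI; exact: mphi.
rewrite -(setIT A) -integral_indic// -(@int_rV_shift R d _ h); last 2 first.
- by apply/measurable_EFinP; exact: measurable_indic.
- by move=> x; rewrite lee_fin.
by rewrite setIT -[in RHS](setIT (_ @^-1` _)) -integral_indic.
Qed.

Lemma nice_shift u h : nice (mu d) u -> nice (mu d) (fun x => u (x + h)).
Proof.
move=> nu; apply: (@nice_transfer _ _ _ _ _ (fun x : 'rV[R]_d => x + h) (mu d) (mu d)) => //.
  by apply: meas_rVD; meas.
exact: mu_shiftE.
Qed.

Lemma fc_shift u h xi : nice (mu d) u ->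
  fc (fun x => u (x + h)) xi = cos (dotv h xi) * fc u xi + sin (dotv h xi) * fs u xi.
Proof.
move=> nu; have ic := integrable_cos (@meas_rth R d) xi nu.1.
have is_ := integrable_sin (@meas_rth R d) xi nu.1.
rewrite /Fc /Fs -!RintegralZl// -RintegralD//; [|exact: integrableZR|exact: integrableZR].
rewrite [RHS](Rint_transfer (mX := mu d) (phi := fun x : 'rV[R]_d => x + h)).
- apply: eq_Rintegral => x _; rewrite /rth/=.
  transitivity (u (x + h) * (cos (dotv x xi) * (cos (dotv h xi) ^+ 2 + sin (dotv h xi) ^+ 2))).
    by rewrite cos2Dsin2 mulr1.
  by rewrite dotvDl cosD sinD; ring.
- by apply: meas_rVD; meas.
- exact: mu_shiftE.
- by apply: integrableDR; exact: integrableZR.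
Qed.

Lemma fs_shift u h xi : nice (mu d) u ->
  fs (fun x => u (x + h)) xi = cos (dotv h xi) * fs u xi - sin (dotv h xi) * fc u xi.
Proof.
move=> nu; have ic := integrable_cos (@meas_rth R d) xi nu.1.
have is_ := integrable_sin (@meas_rth R d) xi nu.1.
rewrite /Fc /Fs -!RintegralZl// -RintegralB//; [|exact: integrableZR|exact: integrableZR].
rewrite [RHS](Rint_transfer (mX := mu d) (phi := fun x : 'rV[R]_d => x + h)).
- apply: eq_Rintegral => x _; rewrite /rth/=.
  transitivity (u (x + h) * (sin (dotv x xi) * (cos (dotv h xi) ^+ 2 + sin (dotv h xi) ^+ 2))).
    by rewrite cos2Dsin2 mulr1.
  by rewrite dotvDl cosD sinD; ring.
- by apply: meas_rVD; meas.
- exact: mu_shiftE.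
- by apply: integrableDR; [exact: integrableZR|apply: integrableNR; exact: integrableZR].
Qed.

Lemma psq_diff u h xi : nice (mu d) u ->
  psq (fun x => u (x + h) - u x) xi = (2 - 2 * cos (dotv h xi)) * psq u xi.
Proof.
move=> nu; have nuh := nice_shift h nu.
rewrite /psq FcB ?FsB ?fc_shift ?fs_shift//; try by [case: nu|case: nuh|exact: meas_rth].
have := cos2Dsin2 (dotv h xi); move: (cos _) (sin _) (fc u xi) (fs u xi) => c t C S ct.
have -> : t ^+ 2 = 1 - c ^+ 2 -> (c * C + t * S - C) ^+ 2 + (c * S - t * C - S) ^+ 2 =
  (2 - 2 * c) * (C ^+ 2 + S ^+ 2).
  by move=> tE; transitivity ((c ^+ 2 + t ^+ 2 + 1 - 2 * c) * (C ^+ 2 + S ^+ 2)); [ring|rewrite tE; ring].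
- by [].
by rewrite -ct addrC addKr.
Qed.

Section s.
Variable s : R.
Hypothesis hs : 0 < s < 1.
Local Notation p := (d%:R + 2 * s).

Definition gag u : \bar R := (\int[mu d \x mu d]_q
  ((u q.1 - u q.2) ^+ 2 / enorm (q.1 - q.2) `^ p)%:E)%E.

(** The Fourier energy without the factor [K_d]; comparisons across dimensions therefore carry
    powers of [2 * pi]. *)
Definition fen u : \bar R := (\int[mu d]_xi (enorm xi `^ (2 * s) * psq u xi)%:E)%E.

Lemma fen_ge0 u : (0 <= fen u)%E.
Proof. by apply: int_ge0 => x; rewrite mulr_ge0 ?powR_ge0 ?psq_ge0. Qed.

Lemma meas_fen_fun u : measurable_fun setT u ->
  measurable_fun setT (fun xi => enorm xi `^ (2 * s) * psq u xi).
Proof. by move=> m; apply: measurable_funM; [exact: meas_enorm_pow|exact: meas_psq]. Qed.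

(** With [x = h + y] the Gagliardo integral becomes a weighted integral over [h] of squared L2 norms
    of increments. Plancherel applies for each fixed [h], and Tonelli then lets [h] be integrated
    first, which produces [symb]. *)
Lemma gag_fourier u : nice (mu d) u ->
  (((2 * pi) ^+ d)%:E * gag u = \int[mu d]_xi ((psq u xi)%:E * symb s xi))%E.
Proof.
move=> nu; have mu_ := nice_meas nu.
have [k [k0 kE]] : exists k : R, 0 <= k /\ k = (2 * pi) ^+ d.
  by exists ((2 * pi) ^+ d); rewrite exprn_ge0// mulr_ge0// pi_ge0.
rewrite -kE.
have mw : measurable_fun setT (fun h : 'rV[R]_d => (enorm h `^ p)^-1) by exact: meas_inv_pow.
have w0 h : 0 <= (enorm (h : 'rV[R]_d) `^ p)^-1 by rewrite invr_ge0 powR_ge0.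
have mu1 : measurable_fun setT (fun q : 'rV[R]_d * 'rV[R]_d => u q.1) by apply: (meas_comp mu_); meas.
have mu2 : measurable_fun setT (fun q : 'rV[R]_d * 'rV[R]_d => u q.2) by apply: (meas_comp mu_); meas.
have mu12 : measurable_fun setT (fun q : 'rV[R]_d * 'rV[R]_d => u (q.1 + q.2)).
  by apply: (meas_comp mu_); apply: meas_rVD; meas.
have mw12 : measurable_fun setT (fun q : 'rV[R]_d * 'rV[R]_d => (enorm (q.1 - q.2) `^ p)^-1).
  by apply: (meas_comp mw); apply: meas_rVB; meas.
have mw1 : measurable_fun setT (fun q : 'rV[R]_d * 'rV[R]_d => (enorm q.1 `^ p)^-1).
  by apply: (meas_comp mw); meas.
have mA : measurable_fun setT (fun q : 'rV[R]_d * 'rV[R]_d =>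
    ((u q.1 - u q.2) ^+ 2 / enorm (q.1 - q.2) `^ p)%:E).
  apply/measurable_EFinP; apply: measurable_funM; last exact: mw12.
  by apply: measurable_funX; exact: (measurable_funB mu1 mu2).
have A0 (q : 'rV[R]_d * 'rV[R]_d) : (0 <= ((u q.1 - u q.2) ^+ 2 / enorm (q.1 - q.2) `^ p)%:E)%E.
  by rewrite lee_fin mulr_ge0 ?sqr_ge0.
rewrite /gag (tonelli2 (mu d) (mu d) mA A0).
have inner y : (\int[mu d]_x ((u x - u y) ^+ 2 / enorm (x - y) `^ p)%:E =
    \int[mu d]_h ((u (h + y) - u y) ^+ 2 * (enorm h `^ p)^-1)%:E)%E.
  pose g (x : 'rV[R]_d) := ((u x - u y) ^+ 2 / enorm (x - y) `^ p)%:E.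
  have mg : measurable_fun setT g.
    apply/measurable_EFinP; apply: measurable_funM.
      by apply: measurable_funX; apply: measurable_funB => //; exact: measurable_cst.
    by apply: (meas_comp mw); apply: meas_rVB; meas.
  have g0 x : (0 <= g x)%E by rewrite lee_fin mulr_ge0 ?sqr_ge0.
  rewrite -[LHS](int_rV_shift y mg g0).
  by apply: eq_integral => h _; rewrite /g addrK.
under eq_integral do rewrite inner.
have mF : measurable_fun setT (fun q : 'rV[R]_d * 'rV[R]_d => ((u (q.1 + q.2) - u q.2) ^+ 2 * (enorm q.1 `^ p)^-1)%:E).
  apply/measurable_EFinP; apply: measurable_funM; last exact: mw1.
  by apply: measurable_funX; exact: (measurable_funB mu12 mu2).
have F0 (q : 'rV[R]_d * 'rV[R]_d) : (0 <= ((u (q.1 + q.2) - u q.2) ^+ 2 * (enorm q.1 `^ p)^-1)%:E)%E.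
  by rewrite lee_fin mulr_ge0 ?sqr_ge0.
rewrite -(@fubini_tonelli _ _ _ _ _ (mu d) (mu d) _ mF F0).
rewrite -ge0_integralZl_EFin; [|by []| |exact: (meas_eint1 (mu d) mF)|by []]; last first.
  by move=> h _; apply: int_ge0 => y; rewrite mulr_ge0 ?sqr_ge0.
pose G (q : 'rV[R]_d * 'rV[R]_d) := psq u q.2 * symb_fun s q.2 q.1.
have mG : measurable_fun setT G.
  apply: measurable_funM; first by apply: (meas_comp (meas_psq mu_)); meas.
  apply: measurable_funM => //.
  have md : measurable_fun setT (fun q : 'rV[R]_d * 'rV[R]_d => dotv q.1 q.2) by apply: meas_dotv; meas.
  by meas.
have G0 q : 0 <= G q by rewrite mulr_ge0 ?psq_ge0 ?symb_fun_ge0.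
transitivity (\int[mu d]_h \int[mu d]_xi (G (h, xi))%:E)%E.
  apply: eq_integral => h _.
  have nd : nice (mu d) (fun x => u (x + h) - u x) by apply: niceB => //; exact: nice_shift.
  under eq_integral do rewrite /= (addrC h) mulrC.
  rewrite ge0_intZ//; last 2 first.
  - by have m := nice_meas nd; meas.
  - by move=> x; exact: sqr_ge0.
  rewrite muleCA kE -plancherel_psq// -ge0_intZ//; last 2 first.
  - exact: meas_psq (nice_meas nd).
  - by move=> x; exact: psq_ge0.
  by apply: eq_integral => xi _; rewrite psq_diff// /G/= /symb_fun; congr EFin; ring.
rewrite (@fubini_tonelli _ _ _ _ _ (mu d) (mu d) (EFin \o G)); last 2 first.
- by meas.
- by move=> q; rewrite lee_fin.
apply: eq_integral => xi _; rewrite /G/= ge0_intZ//.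
- exact: meas_symb_fun.
- by move=> h; exact: symb_fun_ge0.
- exact: psq_ge0.
Qed.

Lemma meas_symb : measurable_fun setT (fun xi : 'rV[R]_d => symb s xi).
Proof.
apply: (meas_eint1 (mu d) (F := fun q : 'rV[R]_d * 'rV[R]_d => (symb_fun s q.1 q.2)%:E)).
  apply/measurable_EFinP; apply: measurable_funM.
    have md : measurable_fun setT (fun q : 'rV[R]_d * 'rV[R]_d => dotv q.2 q.1) by apply: meas_dotv; meas.
    by meas.
  by apply: (meas_comp (meas_inv_pow p)); meas.
by move=> q; rewrite lee_fin symb_fun_ge0.
Qed.

Lemma gag_le u : nice (mu d) u ->
  (((2 * pi) ^+ d)%:E * gag u <= (symb_ub d s)%:E * fen u)%E.
Proof.
move=> nu; have m := nice_meas nu; rewrite gag_fourier// -ge0_intZ ?symb_ub_ge0//; last 2 first.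
- exact: meas_fen_fun.
- by move=> x; rewrite mulr_ge0 ?powR_ge0 ?psq_ge0.
apply: ge0_le_integral => //.
- by move=> x _; rewrite mule_ge0 ?lee_fin ?psq_ge0// int_ge0// => h; exact: symb_fun_ge0.
- by apply: emeasurable_funM; [apply/measurable_EFinP; exact: meas_psq|exact: meas_symb].
- by have h := meas_fen_fun m; meas.
move=> xi _; rewrite (le_trans (lee_wpmul2l _ (symb_le hs xi)))// ?lee_fin ?psq_ge0//.
by rewrite le_eqVlt; apply/orP; left; apply/eqP; ring.
Qed.

Lemma gag_ge u : (0 < d)%N -> nice (mu d) u ->
  ((symb_lb R d)%:E * fen u <= ((2 * pi) ^+ d)%:E * gag u)%E.
Proof.
move=> d0 nu; have m := nice_meas nu.
have lb0 : 0 <= symb_lb R d by apply: ltW; exact: symb_lb_gt0.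
rewrite gag_fourier// -ge0_intZ//; last 2 first.
- exact: meas_fen_fun.
- by move=> x; rewrite mulr_ge0 ?powR_ge0 ?psq_ge0.
apply: ge0_le_integral => //.
- by move=> x _; rewrite lee_fin !mulr_ge0 ?powR_ge0 ?psq_ge0.
- by have h := meas_fen_fun m; meas.
- by apply: emeasurable_funM; [apply/measurable_EFinP; exact: meas_psq|exact: meas_symb].
move=> xi _; apply: le_trans (lee_wpmul2l _ (symb_ge hs xi d0)); last by rewrite lee_fin psq_ge0.
by rewrite lee_fin le_eqVlt; apply/orP; left; apply/eqP; ring.
Qed.

End s.
End gagliardo.

(** * Weak solutions in terms of real transforms *)

Section gamma.
Variable R : realType.
Local Notation leb := (@lebesgue_measure R).
Local Notation mu := (lebesgue_rV R).

Lemma int_rV1 (f : R -> \bar R) : measurable_fun setT f -> (forall x, (0 <= f x)%E) ->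
  (\int[mu 1]_x f (x ord0 ord0) = \int[leb]_t f t)%E.
Proof.
move=> mf f0; rewrite (@int_cons R 0 (fun x => f (x ord0 ord0)))//; last first.
  by apply: (meas_comp mf); apply: meas_coord; meas.
apply: eq_integral => t _.
rewrite int_rV0 ?cons_rV0//.
by apply: (meas_comp mf); apply: meas_coord; apply: meas_cons2; meas.
Qed.

Lemma enorm1E (x : 'rV[R]_1) : enorm x = `|x ord0 ord0|.
Proof. by rewrite /enorm /dotv big_ord1 -expr2 sqrtr_sqr. Qed.

Lemma near0_lty (x : R) : 0 < x < 2 ->
  (\int[leb]_t (\1_`]0%R, 1%R[ t * t `^ (x - 1))%:E < +oo)%E.
Proof.
(* For this [s], in dimension 1, the exponent [2 - (1 + 2 s)] of [near_lty] is [x - 1]. *)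
move=> /andP[x0 x2]; pose s := 1 - x / 2.
have hs : 0 < s < 1 by rewrite /s; apply/andP; split; lra.
have := near_lty 1 hs; set J := \bigcup_N _ => H.
have mJ : measurable J by apply: bigcup_measurable => N _; exact: measurable_itv.
have mf : measurable_fun setT (fun t : R => \1_J `|t| * `|t| `^ (2 - (1%:R + 2 * s))).
  apply: measurable_funM.
    by apply: (meas_comp (measurable_indic mJ)); meas.
  by meas.
move: H; under eq_integral do rewrite enorm1E.
rewrite (@int_rV1 (fun t : R => (\1_J `|t| * `|t| `^ (2 - (1%:R + 2 * s)))%:E)); last 2 first.
- by apply/measurable_EFinP; exact: mf.
- by move=> t; rewrite lee_fin mulr_ge0 ?indic_ge0R ?powR_ge0.
apply: le_lt_trans; apply: ge0_le_intR => //.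
- by apply: measurable_funM; [apply: measurable_indic; exact: measurable_itv|meas].
- by move=> t; rewrite mulr_ge0 ?indic_ge0R ?powR_ge0.
move=> t; rewrite [X in X * _ <= _]indicE; have [|_] := boolP (t \in _); last first.
  by rewrite mul0r mulr_ge0 ?indic_ge0R ?powR_ge0.
rewrite inE/= in_itv/= mul1r => /andP[t0 t1].
rewrite (gtr0_norm t0) indicE mem_set ?mul1r.
  rewrite (_ : 2 - (1%:R + 2 * s) = x - 1)//; rewrite /s; lra.
have : (fun n : nat => (2^-1 : R) ^+ n) @ \oo --> (0 : R).
  by apply: cvg_expr; rewrite ger0_norm// invf_lt1// ltr1n.
move=> /cvgr_lt /(_ _ t0)[N _ HN]; exists N => //=; rewrite in_itv/= t1 andbT ltW//.
exact: (HN N (leqnn N)).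
Qed.

(** The rate [2^-1] leaves half of the decay of [expR (- t)] for integrability. *)
Lemma pow_le_exp (q : R) : exists2 C : R, 0 <= C & forall t, 1 <= t -> t `^ q <= C * expR (2^-1 * t).
Proof.
pose n := Num.bound `|q|.
exists (2 ^+ n.+1 * (n.+1)`!%:R); first by rewrite mulr_ge0// exprn_ge0.
move=> t t1; have t0 : 0 <= t by rewrite (le_trans ler01).
apply: (@le_trans _ _ (t ^+ n.+1)).
  rewrite -powR_mulrn// ler_powR// (le_trans (ler_norm q))// (le_trans (ltW (archi_boundP _)))//.
  by rewrite ler_nat.
have := @expR_ge1Dxn R (2^-1 * t) n; rewrite mulr_ge0// => /(_ isT) H.
have {}H : (2^-1 * t) ^+ n.+1 / n.+1`!%:R <= expR (2^-1 * t).
  by apply: le_trans H; rewrite lerDr.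
rewrite ler_pdivrMr ?ltr0n ?fact_gt0// exprMn exprVn ler_pdivrMl ?exprn_gt0// in H.
by rewrite -mulrA [_%:R * _]mulrC.
Qed.

(** [Gamma] is the [fine] of this integral, so positivity of the integral must come with finiteness:
    an infinite integral would give the value 0. *)
Lemma gamma_bounds (x : R) : 0 < x ->
  (\int[leb]_(t in `]0%R, +oo[) (t `^ (x - 1) * expR (- t))%:E < +oo)%E /\
  (0 < \int[leb]_(t in `]0%R, +oo[) (t `^ (x - 1) * expR (- t))%:E)%E.
Proof.
move=> x0.
have mf : measurable_fun setT (fun t : R => t `^ (x - 1) * expR (- t)) by meas.
have [C C0 HC] := pow_le_exp (x - 1).
have mI : measurable_fun setT (\1_`]0%R, +oo[ : R -> R) by apply: measurable_indic; exact: measurable_itv.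
have mI1 : measurable_fun setT (\1_`]0%R, 1%R[ : R -> R) by apply: measurable_indic; exact: measurable_itv.
have E : (\int[leb]_(t in `]0%R, +oo[) (t `^ (x - 1) * expR (- t))%:E =
    \int[leb]_t (\1_`]0%R, +oo[ t * (t `^ (x - 1) * expR (- t)))%:E)%E.
  rewrite [LHS]integral_mkcond; apply: eq_integral => t _; rewrite /patch indicE.
  by case: ifPn => ta; rewrite ?mul1r ?mul0r.
have pos t : 0 <= t `^ (x - 1) * expR (- t) by rewrite mulr_ge0 ?powR_ge0 ?expR_ge0.
rewrite E; split.
  (* [near0_lty] asks for a parameter below 2; on []0, 1[] replacing [x] by [min x 1] can only
     increase the power. *)
  pose y : R := Num.min x 1.
  have hy : 0 < y < 2 by rewrite lt_min x0 ltr01/= gt_min ltr1n orbT.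
  have h2 : (0 : R) < 2^-1 by rewrite invr_gt0.
  have ny := near0_lty hy; have nw := integrable_wk h2.
  apply: (@le_lt_trans _ _ (\int[leb]_t (\1_`]0%R, 1%R[ t * t `^ (y - 1) + C * wk 2^-1 t)%:E)%E).
    apply: ge0_le_intR.
    - by apply: measurable_funM => //.
    - by have mw := meas_wk (2^-1 : R); meas.
    - by move=> t; rewrite mulr_ge0 ?indic_ge0R.
    move=> t; rewrite [X in X * _ <= _]indicE; have [|_] := boolP (t \in _); last first.
      by rewrite mul0r addr_ge0// mulr_ge0 ?indic_ge0R ?powR_ge0 ?wk_ge0.
    rewrite inE/= in_itv/= andbT mul1r => t0.
    have [t1|t1] := ltP t 1.
      apply: ler_wpDr; first by rewrite mulr_ge0 ?wk_ge0.
      rewrite indicE mem_set ?mul1r; last by rewrite /= in_itv/= t0 t1.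
      apply: (@le_trans _ _ (t `^ (x - 1))).
        by rewrite ler_piMr ?powR_ge0// -expR0 ler_expR oppr_le0 ltW.
      rewrite /y; have [x1|x1] := leP x 1; first by [].
      rewrite subrr powRr0; have q0 : 0 <= x - 1 by rewrite subr_ge0 ltW.
      by have := @ge0_ler_powR R _ q0 t 1; rewrite powR1 !nnegrE; apply => //; apply: ltW.
    apply: ler_wpDl; first by rewrite mulr_ge0 ?indic_ge0R ?powR_ge0.
    rewrite /wk indicE mem_set ?mulr1; last by rewrite /= in_itv/= andbT ltW.
    apply: (@le_trans _ _ (C * expR (2^-1 * t) * expR (- t))).
      by rewrite ler_wpM2r ?expR_ge0// HC.
    rewrite -mulrA -expRD le_eqVlt; apply/orP; left; apply/eqP; congr (_ * expR _); lra.
  rewrite ge0_intD//; first last.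
  - by move=> t; rewrite mulr_ge0 ?wk_ge0.
  - by move=> t; rewrite mulr_ge0 ?indic_ge0R ?powR_ge0.
  - by have mw := meas_wk (2^-1 : R); meas.
  - by meas.
  apply: lte_add_pinfty => //; rewrite ge0_intZ//; [|exact: meas_wk|by move=> t; exact: wk_ge0].
  by rewrite (Rint_EFin nw) -EFinM ltry.
(* On [[1, 2]] the power is at least [t^-1 >= 1 / 2], as [x - 1 > - 1], and the exponential is at
   least [expR (- 2)]. *)
apply: (@lt_le_trans _ _ (\int[leb]_t ((expR (- 2) / 2) * \1_`[1%R, 2%R] t)%:E)%E).
  rewrite ge0_intZ ?divr_ge0 ?expR_ge0//.
  have -> : (\int[leb]_t (\1_`[1%R, 2%R] t)%:E = 1%:E)%E.
    rewrite integral_indic//.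
    rewrite setIT; transitivity (lebesgue_measure (`[1%R, 2%R]%classic : set R)); first by [].
    by rewrite lebesgue_measure_itv/= lte_fin ltr1n/= -EFinB; congr EFin; lra.
  by rewrite -EFinM lte_fin mulr1 divr_gt0 ?expR_gt0.
apply: ge0_le_intR.
- by apply: measurable_funM => //; apply: measurable_indic; exact: measurable_itv.
- exact: measurable_funM.
- by move=> t; rewrite mulr_ge0 ?divr_ge0 ?expR_ge0 ?indic_ge0R.
move=> t; rewrite indicE; have [|_] := boolP (t \in _); last by rewrite mulr0 mulr_ge0 ?indic_ge0R.
rewrite inE/= in_itv/= mulr1 => /andP[t1 t2].
have t0 : 0 < t by rewrite (lt_le_trans ltr01).
rewrite indicE mem_set ?mul1r; last by rewrite /= in_itv/= t0.
rewrite mulrC ler_pM ?invr_ge0 ?expR_ge0//; last by rewrite ler_expR lerN2.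
apply: (@le_trans _ _ (t `^ (- 1))).
  by rewrite (powR_inv1 (ltW t0)) lef_pV2 ?posrE.
by apply: ler_powR => //; lra.
Qed.

Lemma Gamma_gt0 (x : R) : 0 < x -> 0 < Gamma x.
Proof.
move=> x0; have [h1 h2] := gamma_bounds x0; rewrite /Gamma /Rintegral fine_gt0//.
by rewrite h2 h1.
Qed.

Lemma C_frac_gt0 d (s : R) : 0 < s < 1 -> 0 < C_frac d s.
Proof.
move=> /andP[s0 s1]; rewrite /C_frac !mulr_gt0 ?invr_gt0 ?powR_gt0 ?pi_gt0//.
  by rewrite Gamma_gt0// subr_gt0.
by rewrite Gamma_gt0// divr_gt0// ltr_wpDl// mulr_gt0.
Qed.

End gamma.

Section htilde.
Variable R : realType.
Local Notation mu := (lebesgue_rV R).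
Variable d : nat.
Implicit Types (u v f : 'rV[R]_d -> R) (U : set 'rV[R]_d).

Lemma Lfun2P (u : 'rV[R]_d -> R) : (u \in Lfun (mu d) 2%:E) <->
  (measurable_fun setT u /\ (\int[mu d]_x (u x ^+ 2)%:E < +oo)%E).
Proof.
split.
  move=> H; have := H => /andP[]; rewrite inE/= => mf _; split => //.
  have := Lfun2_integrable_sqr H => /integrableR_lty.
  by apply: le_lt_trans; apply: ge0_le_intR => //; [meas|meas|move=> x; exact: sqr_ge0|move=> x; exact: ler_norm].
move=> [mf fi]; apply/andP; split; first by rewrite inE.
rewrite inE/= /finite_norm unlock; apply: poweR_lty.
apply: le_lt_trans fi; apply: le_trans (le_refl _).
rewrite le_eqVlt; apply/orP; left; apply/eqP; apply: eq_integral => x _.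
by rewrite /= powR_mulrn ?normr_ge0// real_normK ?num_real.
Qed.

Lemma L2_setTP u : L2 setT u <->
  (measurable_fun setT u /\ (\int[mu d]_x (u x ^+ 2)%:E < +oo)%E).
Proof. by rewrite /L2 patch_setT; exact: Lfun2P. Qed.

Lemma coord_le_norm (x : 'rV[R]_d) i : `|x ord0 i| <= `|x|.
Proof.
rewrite [leRHS](_ : _ = mx_norm x)// mx_normrE.
exact: (le_bigmax _ (fun ij => `|x ij.1 ij.2|) (ord0, i)).
Qed.

Lemma bounded_setP U : bounded_set U -> exists2 L : R, 0 < L & forall x, U x -> forall i, `|x ord0 i| <= L.
Proof.
move=> [M [_ HM]]; exists (`|M| + 1); first by rewrite ltr_wpDl.
move=> x Ux i; rewrite (le_trans (coord_le_norm x i))//.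
by apply: (HM (`|M| + 1)) => //; rewrite (le_lt_trans (ler_norm M))// ltrDl.
Qed.

Definition cube (L : R) := [set v : 'rV[R]_d | forall i, `[(- L)%R, L]%classic (v ord0 i)].

Lemma measurable_cube L : measurable (cube L).
Proof.
have -> : cube L = \bigcap_(i in [set: 'I_d]) ((fun v : 'rV[R]_d => v ord0 i) @^-1` `[(- L)%R, L]%classic).
  by apply/seteqP; split => [v Av i _|v Av i]; [exact: Av|exact: Av].
apply: fin_bigcap_measurable => // i _.
by rewrite -[X in measurable X]setTI; apply: measurable_coord => //; exact: measurable_itv.
Qed.

(** Every point of the closure has a point of [U] at distance less than 1, whence the margin. *)
Lemma closure_cube U L : (forall x, U x -> forall i, `|x ord0 i| <= L) ->
  closure U `<=` cube (L + 1).
Proof.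
move=> UL z cz i /=; rewrite in_itv/= -ler_norml.
have [y [Uy zy]] := cz (ball z 1) (nbhsx_ballx _ _ ltr01).
have zi : `|z ord0 i - y ord0 i| < 1.
  have := coord_le_norm (z - y) i; rewrite !mxE => /le_lt_trans; apply.
  by move: zy; rewrite -ball_normE.
have yi := UL y Uy i.
have -> : z ord0 i = (z ord0 i - y ord0 i) + y ord0 i by rewrite subrK.
by rewrite (le_trans (ler_normD _ _))// addrC lerD// ltW.
Qed.

(** [|u| <= 1 + u^2] on the cube, which has finite measure. This is how the elements of [Htilde s U]
    with [U] bounded get into L1, where the integral formula for the transform is meaningful. *)
Lemma nice_of_L2 u L : measurable_fun setT u -> (\int[mu d]_x (u x ^+ 2)%:E < +oo)%E ->
  {ae mu d, forall z, ~ cube L z -> u z = 0} -> nice (mu d) u.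
Proof.
move=> mu_ u2 u0; split => //; apply: integrableR => //.
have mc := measurable_indic (measurable_cube L).
apply: (@le_lt_trans _ _ (\int[mu d]_x (\1_(cube L) x + u x ^+ 2)%:E)%E).
  apply: ae_le_intR => //.
  - by meas.
  - by meas.
  - by move=> x; rewrite addr_ge0 ?sqr_ge0.
  move: u0; apply: filterS => x ux; rewrite indicE.
  have [|] := boolP (x \in cube L).
    move=> _ /=; rewrite -[in leRHS]real_normK ?num_real//.
    by have := normr_ge0 (u x); have := sqr_ge0 (`|u x| - 1); nra.
  by rewrite notin_setE => /ux ->; rewrite normr0 expr0n/= addr0.
rewrite ge0_intD//; try by [meas|move=> x; exact: sqr_ge0].
apply: lte_add_pinfty => //.
by rewrite integral_indic ?setIT; [exact: mu_cube_lty|exact: measurableT|exact: measurable_cube].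
Qed.

Section s.
Variable s : R.
Hypothesis hs : 0 < s < 1.

Lemma Htilde_nice U u : bounded_set U -> Htilde s U u -> nice (mu d) u.
Proof.
move=> /bounded_setP[L L0 UL] [[/L2_setTP[m u2] _] u0].
apply: (@nice_of_L2 u (L + 1)) => //; move: u0; apply: filterS => z zU zc.
by apply: zU => cz; apply: zc; exact: (closure_cube UL).
Qed.

Lemma energyE u : energy s u = ((C_frac d s / 2)%:E * gag s u)%E.
Proof. by []. Qed.

Let c0 : 0 < C_frac d s / 2. Proof. by rewrite divr_gt0// C_frac_gt0. Qed.

Let kE : exists2 k : R, 0 < k & k = (2 * pi) ^+ d.
Proof. by exists ((2 * pi) ^+ d) => //; rewrite exprn_gt0// mulr_gt0// pi_gt0. Qed.

Lemma gag_ge0 u : (0 <= gag s u)%E.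
Proof. by apply: int_ge0 => q; rewrite divr_ge0 ?sqr_ge0 ?powR_ge0. Qed.

Lemma energy_ge0 u : (0 <= energy s u)%E.
Proof. by rewrite energyE mule_ge0 ?gag_ge0 ?lee_fin ?ltW. Qed.

Lemma lt_mul_pinfty_inv (c : R) (x : \bar R) : 0 < c -> (0 <= x)%E -> (c%:E * x < +oo)%E -> (x < +oo)%E.
Proof. by move=> c00; case: x => [r|//|//] _; rewrite ?ltry// gt0_muley ?lte_fin. Qed.

Lemma energy_fen u : nice (mu d) u -> (fen s u < +oo)%E -> (energy s u < +oo)%E.
Proof.
move=> nu fu; have [k k0 kk] := kE; have := gag_le hs nu; rewrite -kk => H.
rewrite energyE lte_mul_pinfty ?lee_fin ?(ltW c0)//.
apply: (lt_mul_pinfty_inv k0 (gag_ge0 u)); apply: le_lt_trans H _.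
by rewrite lte_mul_pinfty ?lee_fin ?symb_ub_ge0.
Qed.

Lemma fen_energy u : (0 < d)%N -> nice (mu d) u -> (energy s u < +oo)%E -> (fen s u < +oo)%E.
Proof.
move=> d0 nu eu; have [k k0 kk] := kE; have := gag_ge hs d0 nu; rewrite -kk => H.
apply: (lt_mul_pinfty_inv (symb_lb_gt0 R d0) (fen_ge0 s u)); apply: le_lt_trans H _.
rewrite lte_mul_pinfty ?lee_fin ?(ltW k0)//.
exact: (lt_mul_pinfty_inv c0 (gag_ge0 u)).
Qed.

(** The constant is uniform in [u]; the final estimate passes through it from the Fourier energy to
    the norm. *)
Lemma energy_le_fen : exists2 K : R, 0 <= K & forall u, nice (mu d) u -> (energy s u <= K%:E * fen s u)%E.
Proof.
have [k k0 kk] := kE; exists (C_frac d s / 2 * (k^-1 * symb_ub d s)).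
  by apply: mulr_ge0; [exact: ltW|rewrite mulr_ge0 ?invr_ge0 ?symb_ub_ge0 ?(ltW k0)].
move=> u nu; have := gag_le hs nu; rewrite -kk => H.
rewrite energyE (EFinM (C_frac d s / 2)) -muleA; apply: lee_wpmul2l; first by rewrite lee_fin ltW.
rewrite (EFinM k^-1) -muleA (_ : gag s u = k^-1%:E * (k%:E * gag s u))%E; last first.
  by rewrite muleA -EFinM mulVf ?mul1e// gt_eqF.
by apply: lee_wpmul2l => //; rewrite lee_fin invr_ge0 ltW.
Qed.

Local Notation fc u := (Fc (mu d) (@rth R d) u).
Local Notation fs u := (Fs (mu d) (@rth R d) u).

Definition bilf u v xi : R := enorm xi `^ (2 * s) * (fc u xi * fc v xi + fs u xi * fs v xi).
(* Polarisation of [fen]; up to the factor [fourier_cst], the left-hand side of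
   the weak formulation for real functions. *)
Definition bil u v : R := \int[mu d]_xi bilf u v xi.

Lemma integrable_fen u : nice (mu d) u -> (fen s u < +oo)%E ->
  (mu d).-integrable setT (EFin \o (fun xi => enorm xi `^ (2 * s) * psq u xi)).
Proof.
move=> nu fu; apply: ge0_integrableR => //; first exact: meas_fen_fun (nice_meas nu).
by move=> xi; rewrite mulr_ge0 ?powR_ge0 ?psq_ge0.
Qed.

Lemma integrable_bilf u v : nice (mu d) u -> nice (mu d) v ->
  (fen s u < +oo)%E -> (fen s v < +oo)%E -> (mu d).-integrable setT (EFin \o bilf u v).
Proof.
move=> nu nv fu fv.
have iu := integrable_fen nu fu; have iv := integrable_fen nv fv.
have h1 := meas_Fc (mu d) (@meas_rth R d) (nice_meas nu).
have h2 := meas_Fs (mu d) (@meas_rth R d) (nice_meas nu).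
have h3 := meas_Fc (mu d) (@meas_rth R d) (nice_meas nv).
have h4 := meas_Fs (mu d) (@meas_rth R d) (nice_meas nv).
apply: (integrable_le _ (integrableDR iu iv)).
  apply: measurable_funM; first exact: meas_enorm_pow.
  by apply: measurable_funD; exact: measurable_funM.
move=> xi; rewrite /bilf normrM (ger0_norm (powR_ge0 _ _)) -mulrDr.
rewrite ler_wpM2l ?powR_ge0// /psq; move: (fc u xi) (fs u xi) (fc v xi) (fs v xi) => a b c e.
have := sqr_ge0 (a + c); have := sqr_ge0 (a - c); have := sqr_ge0 (b + e); have := sqr_ge0 (b - e).
have := sqr_ge0 a; have := sqr_ge0 b; have := sqr_ge0 c; have := sqr_ge0 e.
by rewrite ler_norml; move=> *; apply/andP; split; lra.
Qed.

Lemma fen_fin u : nice (mu d) u -> (fen s u < +oo)%E -> fen s u = (bil u u)%:E.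
Proof.
move=> nu fu; rewrite /fen (Rint_EFin (integrable_fen nu fu)); rewrite /bil.
by under [in RHS]eq_Rintegral do rewrite /bilf -!expr2.
Qed.

Lemma fen_sub u v : nice (mu d) u -> nice (mu d) v ->
  (fen s u < +oo)%E -> (fen s v < +oo)%E ->
  fen s (fun x => u x - v x) = (bil u u - 2 * bil v u + bil v v)%:E.
Proof.
move=> nu nv fu fv.
have iu := integrable_bilf nu nu fu fu; have iv := integrable_bilf nv nv fv fv.
have ivu := integrable_bilf nv nu fv fu.
have i1 := integrableZR (-2) ivu.
have E xi : enorm xi `^ (2 * s) * psq (fun x => u x - v x) xi =
    bilf u u xi + (-2 * bilf v u xi) + bilf v v xi.
  rewrite /psq FcB ?FsB//; try by [case: nu|case: nv|exact: meas_rth].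
  by rewrite /bilf; ring.
rewrite /fen; under eq_integral do rewrite E.
have i2 := integrableDR iu i1; have i3 := integrableDR i2 iv.
rewrite (Rint_EFin i3); congr EFin.
rewrite (RintegralD measurableT i2 iv) (RintegralD measurableT iu i1).
rewrite (RintegralZl (-2) measurableT ivu) -![\int[_]_x _]/(bil _ _).
by move: (bil u u) (bil v u) (bil v v) => a b c; rewrite mulNr.
Qed.

Lemma bil_le u v : nice (mu d) u -> nice (mu d) v ->
  (fen s u < +oo)%E -> (fen s v < +oo)%E -> 2 * bil u v <= bil u u + bil v v.
Proof.
move=> nu nv fu fv; have := fen_ge0 s (fun x => v x - u x).
rewrite (fen_sub nv nu fv fu) lee_fin.
by move: (bil u u) (bil u v) (bil v v) => a b c; lra.
Qed.

(** This is [K_d], in the form in which it comes out of a product of two transforms. *)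
Definition fourier_cst : R := ((2 * pi) `^ (- (d%:R / 2))) ^+ 2.

Lemma fourier_cstE (k : R) : k = (2 * pi) ^+ d -> fourier_cst = k^-1.
Proof.
move=> ->; have p0 : 0 < 2 * pi :> R by rewrite mulr_gt0// pi_gt0.
rewrite /fourier_cst expr2 -powRD; last by rewrite (gt_eqF p0) implybT.
have -> : - (d%:R / 2) + - (d%:R / 2) = - d%:R :> R by field.
by rewrite powRN powR_mulrn// ltW.
Qed.

Lemma fourierE u xi : nice (mu d) u ->
  fourier u xi = (((2 * pi) `^ (- (d%:R / 2))) * fc u xi +i*
                  (- ((2 * pi) `^ (- (d%:R / 2)) * fs u xi)))%C.
Proof.
move=> nu; have is_ := integrable_sin (@meas_rth R d) xi nu.1.
rewrite /fourier /Cintegral.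
have -> : \int[mu d]_x complex.Re ((cos (dotv x xi) -i* sin (dotv x xi))%C * (u x)%:C%C) = fc u xi.
  by apply: eq_Rintegral => x _ /=; rewrite mulr0 subr0 mulrC.
have -> : \int[mu d]_x complex.Im ((cos (dotv x xi) -i* sin (dotv x xi))%C * (u x)%:C%C) = - fs u xi.
  rewrite -mulN1r /Fs -RintegralZl//; apply: eq_Rintegral => x _ /=.
  by rewrite mulr0 add0r /rth/=; ring.
move: ((2 * pi) `^ _) => c; apply/eqP; rewrite eq_complex/=; apply/andP; split; apply/eqP; ring.
Qed.

(** The real part of the complex identity: for real functions, the real part of [fourier u] times
    the conjugate of [fourier phi] is [fourier_cst] times the sum of the products of the cosine
    transforms and of the sine transforms. *)
Lemma weak_bil U f u phi : weak_solution s U f u -> Htilde s U phi ->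
  nice (mu d) u -> nice (mu d) phi -> (fen s u < +oo)%E -> (fen s phi < +oo)%E ->
  fourier_cst * bil u phi = \int[mu d]_(z in U) (f z * phi z).
Proof.
move=> [hu hw] hphi nu nphi fu fphi.
have Re : \int[mu d]_xi complex.Re ((enorm xi `^ (2 * s))%:C%C * fourier u xi * conjc (fourier phi xi)) =
    \int[mu d]_(z in U) (f z * phi z) by exact: (congr1 (@complex.Re R) (hw phi hphi)).
rewrite -Re /bil /fourier_cst.
have E xi : complex.Re ((enorm xi `^ (2 * s))%:C%C * fourier u xi * conjc (fourier phi xi)) =
    ((2 * pi) `^ (- (d%:R / 2))) ^+ 2 * bilf u phi xi.
  rewrite !fourierE//; move: ((2 * pi) `^ _) => c /=; rewrite /bilf; ring.
under [RHS]eq_Rintegral do rewrite E.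
by rewrite RintegralZl//; exact: integrable_bilf.
Qed.

End s.
End htilde.

(** * Averages over slices *)

Section jensen.
Context d (T : measurableType d) (R : realType) (m : {measure set T -> \bar R}).
Variable B : set T.
Hypotheses (mB : measurable B) (B0 : (0 < m B)%E) (Boo : (m B < +oo)%E).
Let b := fine (m B).

Lemma fine_meas_gt0 : 0 < b. Proof. by rewrite /b fine_gt0// B0 Boo. Qed.

Lemma integrable_indicR : m.-integrable setT (EFin \o (\1_B : T -> R)).
Proof.
apply: ge0_integrableR; first exact: measurable_indic.
  by move=> x; exact: indic_ge0R.
by rewrite integral_indic ?setIT.
Qed.

Lemma Rint_indic : \int[m]_x (\1_B x : R) = b.
Proof. by rewrite /Rintegral integral_indic ?setIT. Qed.

Definition mean (g : T -> R) := b^-1 * \int[m]_t (g t * \1_B t).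

(** Integrate the tangent-line bound [g^2 >= 2 M g - M^2] over [B] with [M = mean g]; outside [B]
    compare [g^2] with 0. *)
Lemma jensen_sq (g : T -> R) : m.-integrable setT (EFin \o g) ->
  ((b * mean g ^+ 2)%:E <= \int[m]_t (g t ^+ 2)%:E)%E.
Proof.
move=> ig; have mg := integrableR_meas ig; have b0 := fine_meas_gt0.
have [goo|] := ltP (\int[m]_t (g t ^+ 2)%:E)%E +oo%E; last first.
  by move=> /(le_trans _); apply; rewrite leey.
have ig2 : m.-integrable setT (EFin \o (fun t => g t ^+ 2)).
  by apply: ge0_integrableR => //; [meas|move=> t; exact: sqr_ge0].
have i1 : m.-integrable setT (EFin \o (fun t => g t * \1_B t)).
  apply: (integrable_mulb ig); first by apply: measurable_indic.
  by move=> t; rewrite ger0_norm ?indic_ge0R ?indic_le1R.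
set M := mean g.
have i2 := integrableZR (2 * M) i1; have i3 := integrableZR (- M ^+ 2) integrable_indicR.
have i23 := integrableDR i2 i3.
have E : \int[m]_t (2 * M * (g t * \1_B t) + - M ^+ 2 * \1_B t) = b * M ^+ 2.
  rewrite (RintegralD measurableT i2 i3) (RintegralZl (2 * M) measurableT i1).
  rewrite (RintegralZl (- M ^+ 2) measurableT integrable_indicR) Rint_indic.
  have -> : \int[m]_t (g t * \1_B t) = b * M by rewrite /M /mean mulVKf// gt_eqF.
  by ring.
rewrite -E -(Rint_EFin i23); apply: le_integral => // t _ /=.
rewrite lee_fin indicE; case: (t \in B) => /=; last by rewrite !mulr0 addr0 sqr_ge0.
by rewrite !mulr1; have := sqr_ge0 (g t - M); lra.
Qed.

End jensen.

Section mean_fubini.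
Context d1 d2 (X : measurableType d1) (Y : measurableType d2) (R : realType).
Variables (m1 : {sigma_finite_measure set X -> \bar R})
  (m2 : {sigma_finite_measure set Y -> \bar R}).
Variables (B : set Y) (g : X * Y -> R) (c : X -> R).
Hypothesis mc : measurable_fun setT c.
Hypothesis ig : (prodm m1 m2).-integrable setT (EFin \o (fun p => g p * \1_B p.2)).
Hypothesis igc : (prodm m1 m2).-integrable setT (EFin \o (fun p => g p * \1_B p.2 * c p.1)).

(** Together with [mean_Rint], whose right-hand side is the same, this lets averaging in the second
    variable commute with a transform in the first. *)
Lemma mean_fubini : \int[m1]_x (mean m2 B (fun y => g (x, y)) * c x) =
  (fine (m2 B))^-1 * \int[prodm m1 m2]_p (g p * \1_B p.2 * c p.1).
Proof.
rewrite /prodm -(Rint_fubini1 igc) -RintegralZl//; last exact: (integrable_Rint1 igc).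
apply: ae_eq_Rint.
- apply: measurable_funM => //; apply: measurable_funM => //.
  exact: (meas_Rint1 m2 (integrableR_meas ig)).
- apply: measurable_funM => //.
  exact: (meas_Rint1 m2 (integrableR_meas igc)).
by move: (ae_slice1 ig); apply: filterS => x ix; rewrite /= RintegralZr// /mean mulrA.
Qed.

Lemma mean_Rint : mean m2 B (fun y => \int[m1]_x (g (x, y) * c x)) =
  (fine (m2 B))^-1 * \int[prodm m1 m2]_p (g p * \1_B p.2 * c p.1).
Proof.
rewrite /mean /prodm -(Rint_fubini2 igc); congr (_ * _).
apply: eq_Rintegral => y _ /=; rewrite indicE; case: (y \in B) => /=.
  by rewrite mulr1; apply: eq_Rintegral => x _; rewrite mulr1.
rewrite mulr0; under eq_Rintegral do rewrite mulr0 mul0r.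
by rewrite Rintegral_cst// mul0r.
Qed.

End mean_fubini.

(** * The average over slices and its Fourier energy *)

Section slicing.
Variable R : realType.
Local Notation mu := (lebesgue_rV R).
Variables (n k : nat).
Local Notation m12 := (prodm (mu n) (mu k)).

Definition pair_fun (u : 'rV[R]_(n + k) -> R) (p : 'rV[R]_n * 'rV[R]_k) := u (row_mx p.1 p.2).

Lemma meas_row : measurable_fun setT (fun p : 'rV[R]_n * 'rV[R]_k => row_mx p.1 p.2).
Proof. by apply: meas_row_mx; meas. Qed.

Lemma averageE B (u : 'rV[R]_(n + k) -> R) x :
  average B u x = mean (mu k) B (fun t => pair_fun u (x, t)).
Proof.
rewrite /average /mean; congr (_ * _); rewrite Rintegral_mkcond.
by apply: eq_Rintegral => t _; rewrite patch_indic.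
Qed.

Section u.
Variable u : 'rV[R]_(n + k) -> R.
Hypothesis nu : nice (mu (n + k)) u.
Local Notation a := (pair_fun u).

Lemma nice_pair : nice m12 a.
Proof. exact: (nice_transfer meas_row (@mu_rowE R n k) nu). Qed.

Lemma int_pair_sqr : (\int[m12]_p (a p ^+ 2)%:E = \int[mu (n + k)]_z (u z ^+ 2)%:E)%E.
Proof.
have m := nice_meas nu.
rewrite (ge0_int_transfer meas_row (@mu_rowE R n k))//; first by meas.
by move=> y; rewrite lee_fin sqr_ge0.
Qed.

Lemma psq_row xi tau : psq u (row_mx xi tau) =
  Fsq m12 (t12 (@rth R n) (@rth R k)) a (fun=> 0) (xi, tau).
Proof.
have tE (x y : 'rV[R]_n * 'rV[R]_k) : rth (row_mx x.1 x.2, row_mx y.1 y.2) =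
    t12 (@rth R n) (@rth R k) (x, y) by rewrite /t12 /rth dotv_row.
have ct := @Fc_transfer _ _ _ _ _ _ _ _ meas_row (@mu_rowE R n k) _ _ (@meas_rth R (n + k)) tE u (xi, tau) nu.1.
have st := @Fs_transfer _ _ _ _ _ _ _ _ meas_row (@mu_rowE R n k) _ _ (@meas_rth R (n + k)) tE u (xi, tau) nu.1.
by rewrite /psq ct st Fsq_real.
Qed.

Section slice.
Variable B : set 'rV[R]_k.
Hypotheses (mB : measurable B) (B0 : (0 < mu k B)%E) (Boo : (mu k B < +oo)%E).
Let b := fine (mu k B).
Let w := average B u.
Let na := nice_pair.
Let ma : measurable_fun setT a := nice_meas na.

Let wE : w = fun x => b^-1 * \int[mu k]_t (a (x, t) * \1_B t).
Proof. by apply/funext => x; rewrite /w averageE. Qed.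

Let mind : measurable_fun setT (fun p : 'rV[R]_n * 'rV[R]_k => \1_B p.2 : R).
Proof. by apply: (meas_comp (measurable_indic mB)); meas. Qed.

Let iaB : m12.-integrable setT (EFin \o (fun p => a p * \1_B p.2)).
Proof.
apply: (integrable_mulb na.1 mind) => p.
by rewrite ger0_norm ?indic_ge0R ?indic_le1R.
Qed.

Lemma integrable_average : (mu n).-integrable setT (EFin \o w).
Proof. by rewrite wE; apply: integrableZR; exact: (integrable_Rint1 iaB). Qed.

Lemma average_sqr :
  (b%:E * \int[mu n]_x (w x ^+ 2)%:E <= \int[mu (n + k)]_z (u z ^+ 2)%:E)%E.
Proof.
have mw := integrableR_meas integrable_average.
have b0 := fine_meas_gt0 B0 Boo.
rewrite -int_pair_sqr /prodm tonelli1; first last.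
- by move=> p; rewrite lee_fin sqr_ge0.
- by meas.
rewrite -ge0_intZ ?(ltW b0)//; [|by meas|by move=> x; exact: sqr_ge0].
have ms : measurable_fun setT (fun x => \int[mu k]_y (a (x, y) ^+ 2)%:E)%E.
  apply: (meas_eint1 (mu k) (F := fun p => (a p ^+ 2)%:E)); first by meas.
  by move=> p; rewrite lee_fin sqr_ge0.
apply: ae_ge0_le_integral => //.
- by move=> x _; rewrite lee_fin mulr_ge0 ?sqr_ge0 ?(ltW b0).
- by meas.
- by move=> x _; apply: int_ge0 => t; exact: sqr_ge0.
move: (ae_slice1 na.1); apply: filterS => x ix _.
by rewrite /w averageE; exact: (jensen_sq mB B0 Boo ix).
Qed.

Lemma nice_average : nice (mu n) w.
Proof.
split; first exact: integrable_average.
apply: (lt_mul_pinfty_inv (fine_meas_gt0 B0 Boo)).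
  by apply: int_ge0 => x; exact: sqr_ge0.
by apply: le_lt_trans average_sqr _; case: nu.
Qed.

Let Q xi t := psq (fun x => a (x, t)) xi.

Let fcw xi : Fc (mu n) (@rth R n) w xi = mean (mu k) B (fun t => Fc (mu n) (@rth R n) (fun x => a (x, t)) xi).
Proof.
have h := meas_th2 (@meas_rth R n) xi.
have mc : measurable_fun setT (fun x => cos (@rth R n (x, xi))) by meas.
have mcp : measurable_fun setT (fun p : 'rV[R]_n * 'rV[R]_k => cos (@rth R n (p.1, xi))).
  by apply: (meas_comp mc); meas.
have i := integrable_mulb iaB mcp (fun p => cos_norm1 _).
rewrite (mean_Rint i) -(mean_fubini mc iaB i) /Fc.
by under eq_Rintegral do rewrite /w averageE.
Qed.

Let fsw xi : Fs (mu n) (@rth R n) w xi = mean (mu k) B (fun t => Fs (mu n) (@rth R n) (fun x => a (x, t)) xi).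
Proof.
have h := meas_th2 (@meas_rth R n) xi.
have mc : measurable_fun setT (fun x => sin (@rth R n (x, xi))) by meas.
have mcp : measurable_fun setT (fun p : 'rV[R]_n * 'rV[R]_k => sin (@rth R n (p.1, xi))).
  by apply: (meas_comp mc); meas.
have i := integrable_mulb iaB mcp (fun p => sin_norm1 _).
rewrite (mean_Rint i) -(mean_fubini mc iaB i) /Fs.
by under eq_Rintegral do rewrite /w averageE.
Qed.

Lemma Rint_average (f : 'rV[R]_n -> R) : measurable_fun setT f ->
  m12.-integrable setT (EFin \o (fun p => a p * \1_B p.2 * f p.1)) ->
  \int[mu n]_x (w x * f x) = b^-1 * \int[m12]_p (a p * \1_B p.2 * f p.1).
Proof.
move=> mf i; rewrite -(mean_fubini mf iaB i).
by under eq_Rintegral do rewrite /w averageE.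
Qed.

(** The transform of the average is the average of the partial transforms, so Jensen applies at a
    fixed frequency, to the cosine and the sine transform separately. *)
Lemma psq_average xi : ((b * psq w xi)%:E <= \int[mu k]_t (Q xi t)%:E)%E.
Proof.
have m1 := meas_slice1 xi (meas_C1 (mu n) (@meas_rth R n) ma).
have m2 := meas_slice1 xi (meas_S1 (mu n) (@meas_rth R n) ma).
have i1 := integrable_C1 (@meas_rth R n) na.1 xi.
have i2 := integrable_S1 (@meas_rth R n) na.1 xi.
rewrite /psq fcw fsw mulrDr EFinD.
under [leRHS]eq_integral do rewrite /Q /psq.
rewrite ge0_intD//; try by [meas|move=> t; exact: sqr_ge0].
by apply: leeD; exact: (jensen_sq mB B0 Boo).
Qed.

Lemma fen_average s (k2 : R) : 0 < s -> k2 = (2 * pi) ^+ k ->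
  ((b * k2)%:E * fen s w <= fen s u)%E.
Proof.
move=> s0 k2E; have m := nice_meas nu.
have k20 : 0 <= k2 by rewrite k2E exprn_ge0// mulr_ge0// pi_ge0.
have b0 := fine_meas_gt0 B0 Boo.
have n0 : nice m12 (fun=> 0).
  by split; [exact: integrable0|under eq_integral do rewrite expr0n/=; rewrite integral0].
have p1 : plancherel (mu n) (@rth R n) ((2 * pi) ^+ n) by exact: plancherel_rV.
have p2 : plancherel (mu k) (@rth R k) k2 by rewrite k2E; exact: plancherel_rV.
have [k1 k1E] : exists k1 : R, k1 = (2 * pi) ^+ n by exists ((2 * pi) ^+ n).
have k10 : 0 <= k1 by rewrite k1E exprn_ge0// mulr_ge0// pi_ge0.
rewrite -k1E in p1.
have pp := partial_plancherel (@meas_rth R n) (@meas_rth R k) p1 p2 k10 na n0.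
have mw := nice_meas nice_average.
have mF : measurable_fun setT (fun p : 'rV[R]_n * 'rV[R]_k => (enorm (row_mx p.1 p.2) `^ (2 * s) * psq u (row_mx p.1 p.2))%:E).
  apply/measurable_EFinP; apply: (meas_comp (meas_fen_fun s m)); exact: meas_row.
have F0 (p : 'rV[R]_n * 'rV[R]_k) : (0 <= (enorm (row_mx p.1 p.2) `^ (2 * s) * psq u (row_mx p.1 p.2))%:E)%E.
  by rewrite lee_fin mulr_ge0 ?powR_ge0 ?psq_ge0.
rewrite /fen int_row; first last.
- by move=> z; rewrite lee_fin mulr_ge0 ?powR_ge0 ?psq_ge0.
- by apply/measurable_EFinP; exact: meas_fen_fun.
rewrite -ge0_intZ; first last.
- by rewrite mulr_ge0// ltW.
- by move=> xi; rewrite mulr_ge0 ?powR_ge0 ?psq_ge0.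
- exact: meas_fen_fun.
apply: ae_ge0_le_integral.
- exact: measurableT.
- by move=> xi _; rewrite lee_fin !mulr_ge0 ?powR_ge0 ?psq_ge0 ?(ltW b0).
- have h := meas_fen_fun s mw; apply/measurable_EFinP; apply: measurable_funM => //.
- by move=> xi _; apply: int_ge0 => tau; rewrite mulr_ge0 ?powR_ge0 ?psq_ge0.
- exact: (meas_eint1 (mu k) mF F0).
move: pp; apply: filterS => xi pxi _.
have mp : measurable_fun setT (fun tau => psq u (row_mx xi tau)).
  exact: (meas_slice1 xi (F := fun p => psq u (row_mx p.1 p.2)) (meas_comp (meas_psq m) meas_row)).
(* Lowering the weight to a power of [enorm xi] leaves [psq u] as the only factor depending on
   [tau], so that partial Plancherel can evaluate the inner integral. *)
apply: (@le_trans _ _ (\int[mu k]_tau (enorm xi `^ (2 * s) * psq u (row_mx xi tau))%:E)%E); last first.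
  apply: ge0_le_intR.
  - by apply: measurable_funM.
  - by move/measurable_EFinP : mF; exact: (meas_slice1 xi).
  - by move=> tau; rewrite mulr_ge0 ?powR_ge0 ?psq_ge0.
  move=> tau; rewrite ler_wpM2r ?psq_ge0// ge0_ler_powR ?nnegrE ?enorm_ge0 ?mulr_ge0 ?(ltW s0)//.
  by rewrite /enorm dotv_row ler_wsqrtr// lerDl dotvv_ge0.
rewrite ge0_intZ ?powR_ge0//; last by move=> tau; exact: psq_ge0.
rewrite (_ : b * k2 * _ = enorm xi `^ (2 * s) * (k2 * (b * psq w xi))); last by ring.
rewrite EFinM; apply: lee_wpmul2l; first by rewrite lee_fin powR_ge0.
under [leRHS]eq_integral do rewrite psq_row.
rewrite pxi (EFinM k2); apply: lee_wpmul2l; first by rewrite lee_fin.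
apply: le_trans (psq_average xi) _.
by under [leRHS]eq_integral do rewrite Fsq0.
Qed.

End slice.
End u.
End slicing.

(** * Tensor products, scaling and cutoff functions *)

Section powR_subadd.
Variable R : realType.

(** For [c] equal to [a] or [b] the ratio [c / (a + b)] lies in [[0, 1]] and is thus at most its own
    power with exponent [s <= 1]; add the two inequalities. *)
Lemma powR_subadditive (a b s : R) : 0 <= a -> 0 <= b -> 0 < s <= 1 ->
  (a + b) `^ s <= a `^ s + b `^ s.
Proof.
move=> a0 b0 /andP[s0 s1]; have [ab0|abn0] := eqVneq (a + b) 0.
  by rewrite ab0 powR0 ?gt_eqF// addr_ge0 ?powR_ge0.
have ab : 0 < a + b by rewrite lt_neqAle eq_sym abn0 addr_ge0.
have H c : 0 <= c <= a + b -> (a + b) `^ s * (c / (a + b)) <= c `^ s.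
  move=> /andP[c0 cab]; have [->|cn0] := eqVneq c 0; first by rewrite mul0r mulr0 powR_ge0.
  have cp : 0 < c by rewrite lt_neqAle eq_sym cn0.
  rewrite -[in leRHS](@divfK _ (a + b) _ c)// [in leRHS]mulrC powRM ?divr_ge0 ?(ltW ab)//.
  rewrite ler_wpM2l ?powR_ge0// -[leLHS]powRr1 ?divr_ge0 ?(ltW ab)//.
  by apply: ger_powR => //; rewrite divr_gt0//= ler_pdivrMr// mul1r.
have Ha := H a; have Hb := H b; rewrite a0 lerDl b0 in Ha; rewrite b0 lerDr a0 in Hb.
apply: le_trans (lerD (Ha isT) (Hb isT)).
by rewrite -mulrDr -mulrDl divff// mulr1.
Qed.

Lemma enorm_row_le n k (x : 'rV[R]_n) (t : 'rV[R]_k) (s : R) : 0 < s < 1 ->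
  enorm (row_mx x t) `^ (2 * s) <= enorm x `^ (2 * s) + enorm t `^ (2 * s).
Proof.
move=> /andP[s0 s1]; have E m (y : 'rV[R]_m) : enorm y `^ (2 * s) = dotv y y `^ s.
  by rewrite powRrM -enorm_sqr (powR_mulrn 2%N) ?enorm_ge0.
by rewrite !E dotv_row powR_subadditive ?dotvv_ge0 ?s0 ?ltW.
Qed.

End powR_subadd.

Section tensor.
Variable R : realType.
Local Notation mu := (lebesgue_rV R).
Variables (n k : nat).
Local Notation m12 := (prodm (mu n) (mu k)).
Variables (p : 'rV[R]_n -> R) (q : 'rV[R]_k -> R).
Hypotheses (np : nice (mu n) p) (nq : nice (mu k) q).

Definition tensor (z : 'rV[R]_(n + k)) := p (lsubmx z) * q (rsubmx z).

Let mp := nice_meas np.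
Let mq := nice_meas nq.

Lemma tensor_row x t : tensor (row_mx x t) = p x * q t.
Proof. by rewrite /tensor row_mxKl row_mxKr. Qed.

Lemma meas_tensor_rV : measurable_fun setT tensor.
Proof.
apply: measurable_funM; first by apply: (meas_comp mp); apply: meas_lsubmx; meas.
by apply: (meas_comp mq); apply: meas_rsubmx; meas.
Qed.

Lemma int_tensor_rV (f : 'rV[R]_n -> R) (g : 'rV[R]_k -> R) :
  measurable_fun setT f -> measurable_fun setT g ->
  (forall x, 0 <= f x) -> (forall x, 0 <= g x) ->
  (\int[mu (n + k)]_z (f (lsubmx z) * g (rsubmx z))%:E =
   \int[mu n]_x (f x)%:E * \int[mu k]_t (g t)%:E)%E.
Proof.
move=> mf mg f0 g0; rewrite (ge0_int_transfer (@meas_row R n k) (@mu_rowE R n k)).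
- rewrite -(ge0_int_tensor (mu n) (mu k) mf mg f0 g0); apply: eq_integral => z _.
  by rewrite row_mxKl row_mxKr.
- apply/measurable_EFinP; apply: measurable_funM; first by apply: (meas_comp mf); apply: meas_lsubmx; meas.
  by apply: (meas_comp mg); apply: meas_rsubmx; meas.
- by move=> z; rewrite lee_fin mulr_ge0.
Qed.

Lemma int_tensor_sqr : (\int[mu (n + k)]_z (tensor z ^+ 2)%:E =
   \int[mu n]_x (p x ^+ 2)%:E * \int[mu k]_t (q t ^+ 2)%:E)%E.
Proof.
under eq_integral do rewrite /tensor exprMn.
rewrite (@int_tensor_rV (fun x => p x ^+ 2) (fun x => q x ^+ 2))//.
- by meas.
- by meas.
- by move=> x; exact: sqr_ge0.
- by move=> x; exact: sqr_ge0.
Qed.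

Lemma nice_tensor : nice (mu (n + k)) tensor.
Proof.
have mt := meas_tensor_rV; split.
  apply: integrableR => //; under eq_integral do rewrite /tensor normrM.
  rewrite (@int_tensor_rV (fun x => `|p x|) (fun x => `|q x|))//; try by meas.
  by apply: lte_mul_pinfty; [exact: int_ge0|rewrite ge0_fin_numE ?int_ge0//; exact: (integrableR_lty np.1)|exact: (integrableR_lty nq.1)].
rewrite int_tensor_sqr; apply: lte_mul_pinfty; last by case: nq.
  by apply: int_ge0 => x; exact: sqr_ge0.
by rewrite ge0_fin_numE; [case: np|apply: int_ge0 => x; exact: sqr_ge0].
Qed.

Lemma psq_tensor xi tau : psq tensor (row_mx xi tau) = psq p xi * psq q tau.
Proof.
have na := nice_pair nice_tensor; have ia := na.1.
rewrite (psq_row nice_tensor).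
rewrite Fsq_real (Fc_prod (@meas_rth R n) (@meas_rth R k) ia) (Fs_prod (@meas_rth R n) (@meas_rth R k) ia).
have ic1 := integrable_cos (@meas_rth R n) xi np.1.
have is1 := integrable_sin (@meas_rth R n) xi np.1.
have ic2 := integrable_cos (@meas_rth R k) tau nq.1.
have is2 := integrable_sin (@meas_rth R k) tau nq.1.
have C : (fun y => Fc (mu n) (@rth R n) (fun x => pair_fun tensor (x, y)) xi) = (fun y => Fc (mu n) (@rth R n) p xi * q y).
  apply/funext => y; rewrite /Fc -RintegralZr//; apply: eq_Rintegral => x _.
  by rewrite /pair_fun tensor_row/=; ring.
have S : (fun y => Fs (mu n) (@rth R n) (fun x => pair_fun tensor (x, y)) xi) = (fun y => Fs (mu n) (@rth R n) p xi * q y).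
  apply/funext => y; rewrite /Fs -RintegralZr//; apply: eq_Rintegral => x _.
  by rewrite /pair_fun tensor_row/=; ring.
have C2 c : Fc (mu k) (@rth R k) (fun y => c * q y) tau = c * Fc (mu k) (@rth R k) q tau.
  by rewrite /Fc -RintegralZl//; apply: eq_Rintegral => y _; ring.
have S2 c : Fs (mu k) (@rth R k) (fun y => c * q y) tau = c * Fs (mu k) (@rth R k) q tau.
  by rewrite /Fs -RintegralZl//; apply: eq_Rintegral => y _; ring.
rewrite C S !C2 !S2 /psq.
by move: (Fc _ _ p _) (Fs _ _ p _) (Fc _ _ q _) (Fs _ _ q _) => a b c e; ring.
Qed.

(** In each of the two terms the weight falls on one factor, and Plancherel evaluates the unweighted
    one. *)
Lemma fen_tensor s (kn kk : R) : 0 < s < 1 -> kn = (2 * pi) ^+ n -> kk = (2 * pi) ^+ k ->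
  (fen s tensor <= fen s p * (kk%:E * \int[mu k]_t (q t ^+ 2)%:E) +
                   (kn%:E * \int[mu n]_x (p x ^+ 2)%:E) * fen s q)%E.
Proof.
move=> hs knE kkE; have mt := nice_meas nice_tensor.
have m1 := meas_psq mp; have m2 := meas_psq mq.
have f1 := meas_fen_fun s mp; have f2 := meas_fen_fun s mq.
have g1 x : 0 <= enorm x `^ (2 * s) * psq p x by rewrite mulr_ge0 ?powR_ge0 ?psq_ge0.
have g2 x : 0 <= enorm x `^ (2 * s) * psq q x by rewrite mulr_ge0 ?powR_ge0 ?psq_ge0.
rewrite kkE knE -(plancherel_psq np) -(plancherel_psq nq).
rewrite /fen -(int_tensor_rV f1 m2 g1 (psq_ge0 q)) -(int_tensor_rV m1 f2 (psq_ge0 p) g2).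
have M (f : 'rV[R]_n -> R) (g : 'rV[R]_k -> R) : measurable_fun setT f -> measurable_fun setT g ->
    measurable_fun setT (fun z : 'rV[R]_(n + k) => f (lsubmx z) * g (rsubmx z)).
  move=> mf mg; apply: measurable_funM; first by apply: (meas_comp mf); apply: meas_lsubmx; meas.
  by apply: (meas_comp mg); apply: meas_rsubmx; meas.
rewrite -ge0_intD; first last.
- by move=> z; rewrite mulr_ge0 ?psq_ge0.
- by move=> z; rewrite mulr_ge0 ?psq_ge0.
- exact: (M _ _ m1 f2).
- exact: (M _ _ f1 m2).
apply: ge0_le_intR.
- exact: meas_fen_fun.
- by apply: measurable_funD; [exact: (M _ _ f1 m2)|exact: (M _ _ m1 f2)].
- by move=> z; rewrite mulr_ge0 ?powR_ge0 ?psq_ge0.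
move=> z; rewrite -[in leLHS](hsubmxK z) psq_tensor.
move: (lsubmx z) (rsubmx z) => x t.
apply: le_trans (ler_wpM2r _ (enorm_row_le x t hs)) _; first by rewrite mulr_ge0 ?psq_ge0.
by rewrite le_eqVlt; apply/orP; left; apply/eqP; ring.
Qed.

End tensor.

Section scaling.
Variable R : realType.
Local Notation mu := (lebesgue_rV R).
Variable d : nat.

(** [int_rV_scale] concerns nonnegative functions, so the positive and negative parts are scaled
    separately. *)
Lemma Rint_rV_scale (f : 'rV[R]_d -> R) c : 0 < c ->
  (mu d).-integrable setT (EFin \o f) ->
  \int[mu d]_x f (c *: x) = c ^- d * \int[mu d]_x f x.
Proof.
move=> c0 fi; have mf := integrableR_meas fi.
have mfe : measurable_fun setT (EFin \o f) by case/integrableP : fi.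
have mp := measurable_funepos mfe; have mn := measurable_funeneg mfe.
have H (g : 'rV[R]_d -> \bar R) : measurable_fun setT g -> (forall x, (0 <= g x)%E) ->
    fine (\int[mu d]_x g (c *: x)%R)%E = c ^- d * fine (\int[mu d]_x g x)%E.
  move=> mg g0; rewrite (int_rV_scale c0 mg g0).
  have : (0 <= \int[mu d]_x g x)%E by apply: integral_ge0 => x _; exact: g0.
  case: (\int[mu d]_x g x)%E => [r|_|] //=.
  by rewrite gt0_muley ?lte_fin ?invr_gt0 ?exprn_gt0//= mulr0.
have Ip := integrable_pos_fin_num measurableT fi.
have In := integrable_neg_fin_num measurableT fi.
have F (g : 'rV[R]_d -> \bar R) : measurable_fun setT g -> (forall x, (0 <= g x)%E) ->
    (\int[mu d]_x g x)%E \is a fin_num -> (\int[mu d]_x g (c *: x)%R)%E \is a fin_num.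
  by move=> mg g0 gf; rewrite (int_rV_scale c0 mg g0) fin_numM.
have E : (\int[mu d]_x f x) = fine (\int[mu d]_x (EFin \o f)^\+ x)%E - fine (\int[mu d]_x (EFin \o f)^\- x)%E.
  by rewrite /Rintegral integralE fineB.
have Fp : (\int[mu d]_x (EFin \o f)^\+ (c *: x)%R)%E \is a fin_num.
  by apply: (F ((EFin \o f)^\+)%E) => // x; exact: funepos_ge0.
have Fn : (\int[mu d]_x (EFin \o f)^\- (c *: x)%R)%E \is a fin_num.
  by apply: (F ((EFin \o f)^\-)%E) => // x; exact: funeneg_ge0.
have Ec : \int[mu d]_x f (c *: x) =
    fine (\int[mu d]_x (EFin \o f)^\+ (c *: x)%R)%E - fine (\int[mu d]_x (EFin \o f)^\- (c *: x)%R)%E.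
  have W := integralE (mu d) setT (fun x : 'rV[R]_d => (f (c *: x))%:E).
  rewrite /Rintegral W -(fineB Fp Fn); congr fine.
  by congr (_ - _)%E; apply: eq_integral => x _; rewrite ?funeposE ?funenegE.
rewrite E Ec mulrBr; congr (_ - _).
- by apply: (H ((EFin \o f)^\+)%E) => // x; exact: funepos_ge0.
- by apply: (H ((EFin \o f)^\-)%E) => // x; exact: funeneg_ge0.
Qed.

Lemma nice_scale (q : 'rV[R]_d -> R) c : 0 < c -> nice (mu d) q ->
  nice (mu d) (fun x => q (c *: x)).
Proof.
move=> c0 nq; have mq := nice_meas nq.
have m : measurable_fun setT (fun x : 'rV[R]_d => q (c *: x)).
  by apply: (meas_comp mq); apply: meas_rVZ; meas.
have L (g : 'rV[R]_d -> R) : measurable_fun setT g -> (forall x, 0 <= g x) ->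
    (\int[mu d]_x (g x)%:E < +oo)%E -> (\int[mu d]_x (g (c *: x))%:E < +oo)%E.
  move=> mg g0 gi; rewrite (@int_rV_scale R d (fun x => (g x)%:E) c c0); [|by meas|by []].
  by rewrite lte_mul_pinfty// lee_fin invr_ge0 exprn_ge0// ltW.
split; last by apply: (L (fun x => q x ^+ 2)); [meas|move=> x; exact: sqr_ge0|case: nq].
by apply: integrableR => //; apply: (L (fun x => `|q x|)); [meas|by []|exact: (integrableR_lty nq.1)].
Qed.

Lemma psq_scale (q : 'rV[R]_d -> R) c xi : 0 < c -> nice (mu d) q ->
  psq (fun x => q (c *: x)) xi = (c ^- d) ^+ 2 * psq q (c^-1 *: xi).
Proof.
move=> c0 nq; have cn0 : c != 0 by rewrite gt_eqF.
have ic := integrable_cos (@meas_rth R d) (c^-1 *: xi) nq.1.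
have is_ := integrable_sin (@meas_rth R d) (c^-1 *: xi) nq.1.
have E (x : 'rV[R]_d) : rth (x, xi) = rth (c *: x, c^-1 *: xi).
  by rewrite /rth/= dotvZl dotvZr mulVKf.
have C : Fc (mu d) (@rth R d) (fun x => q (c *: x)) xi = c ^- d * Fc (mu d) (@rth R d) q (c^-1 *: xi).
  by rewrite /Fc -(Rint_rV_scale c0 ic); apply: eq_Rintegral => x _; rewrite E.
have S : Fs (mu d) (@rth R d) (fun x => q (c *: x)) xi = c ^- d * Fs (mu d) (@rth R d) q (c^-1 *: xi).
  by rewrite /Fs -(Rint_rV_scale c0 is_); apply: eq_Rintegral => x _; rewrite E.
rewrite /psq C S; ring.
Qed.

(** The squared transform contributes [c ^ (- 2 d)], the change of variables [c ^ d] and the weight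
    [c ^ (2 s)]. For [c = l^-1] and [d = k] the factor is [l ^ (k - 2 s)]. *)
Lemma fen_scale (q : 'rV[R]_d -> R) c s : 0 < c -> nice (mu d) q ->
  fen s (fun x => q (c *: x)) = ((c `^ (2 * s) / c ^+ d)%:E * fen s q)%E.
Proof.
move=> c0 nq; have mq := nice_meas nq; have cn0 : c != 0 by rewrite gt_eqF.
have f := meas_fen_fun s mq; have cd : c ^+ d != 0 by rewrite expf_neq0.
have g0 xi : 0 <= enorm (xi : 'rV[R]_d) `^ (2 * s) * psq q xi by rewrite mulr_ge0 ?powR_ge0 ?psq_ge0.
have ci : 0 < c^-1 by rewrite invr_gt0.
have := @int_rV_scale R d (fun xi => (enorm xi `^ (2 * s) * psq q xi)%:E) _ ci.
move=> /(_ _ (fun x => g0 x)) H.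
have {}H : (\int[mu d]_x (enorm (c^-1 *: x) `^ (2 * s) * psq q (c^-1 *: x))%:E =
  (c ^+ d)%:E * fen s q)%E by rewrite H; [rewrite exprVn invrK|apply/measurable_EFinP].
rewrite (_ : c `^ (2 * s) / c ^+ d = (c `^ (2 * s) * (c ^- d) ^+ 2) * c ^+ d); last first.
  by rewrite expr2 -!mulrA mulVf ?mulr1.
rewrite EFinM -muleA -H -ge0_intZ.
- apply: eq_integral => xi _; rewrite psq_scale//; congr EFin.
  rewrite enormZ (gtr0_norm ci) powRM ?enorm_ge0 ?(ltW ci)//.
  have -> : (c^-1) `^ (2 * s) = (c `^ (2 * s))^-1 by rewrite -powRN -powR_inv1 ?ltW// -powRrM mulN1r.
  have : c `^ (2 * s) != 0 by rewrite gt_eqF ?powR_gt0.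
  by move: (c `^ _) (c ^- d) (enorm _ `^ _) (psq _ _) => a b e g a0; field.
- apply: (meas_comp f); apply: meas_rVZ; meas.
- by move=> x; exact: g0.
- by rewrite mulr_ge0 ?powR_ge0 ?sqr_ge0.
Qed.

End scaling.

(** * Topology against the coordinate sigma-algebra *)

Section open_rV.
Variable R : realType.
Local Notation mu := (lebesgue_rV R).
Variable d : nat.

Lemma norm_lt_coord (x : 'rV[R]_d) e : 0 < e -> (forall i, `|x ord0 i| < e) -> `|x| < e.
Proof.
move=> e0 xe; rewrite [ltLHS](_ : _ = mx_norm x)// mx_normrE.
by apply: bigmax_lt => //= -[i j] _ /=; rewrite ord1.
Qed.

Lemma norm_le_enorm (x : 'rV[R]_d) : `|x| <= enorm x.
Proof.
rewrite [leLHS](_ : _ = mx_norm x)// mx_normrE.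
apply: bigmax_le; first exact: enorm_ge0.
by move=> [i j] _ /=; rewrite ord1; exact: coord_le_enorm.
Qed.

Definition rat_box (q : 'rV[rat]_d) (m : nat) : set 'rV[R]_d :=
  [set v | forall i, `|v ord0 i - ratr (q ord0 i)| < m.+1%:R^-1].

Lemma measurable_rat_box q m : measurable (rat_box q m).
Proof.
have -> : rat_box q m = \bigcap_(i in [set: 'I_d]) ((fun v : 'rV[R]_d => v ord0 i) @^-1`
    `](ratr (q ord0 i) - m.+1%:R^-1)%R, (ratr (q ord0 i) + m.+1%:R^-1)%R[%classic).
  apply/seteqP; split => [v Av i _|v Av i].
    by have := Av i; rewrite /= in_itv/= ltr_distl.
  by have := Av i I; rewrite /= in_itv/= ltr_distl.
apply: fin_bigcap_measurable => // i _.
by rewrite -[X in measurable X]setTI; apply: measurable_coord => //; exact: measurable_itv.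
Qed.

(** The sigma-algebra is generated by the coordinates while open sets come from the sup norm; boxes
    with rational centres form a countable base, enumerated here through [unpickle]. *)
Lemma rV_open_measurable (A : set 'rV[R]_d) : open A -> measurable A.
Proof.
move=> oA; pose F (j : nat) := if unpickle j is Some (q, m) then
  (if `[< rat_box q m `<=` A >] then rat_box q m else set0) else set0.
have -> : A = \bigcup_j F j.
  apply/seteqP; split => [x Ax|x [j _]]; last first.
    rewrite /F; case: (unpickle j) => [[q m]|//].
    by case: asboolP => // qA /qA.
  have /nbhs_ballP[e/= e0 eA] : nbhs x A by exact: open_nbhs_nbhs.
  (* Two points of one box may be almost twice its radius apart. *)
  have [m me] : exists m : nat, m.+1%:R^-1 < e / 2.
    have e2 : 0 < e / 2 by rewrite divr_gt0.
    exists (Num.bound (e / 2)^-1); rewrite invf_plt ?posrE ?ltr0n//.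
    rewrite (lt_trans (archi_boundP _)) ?invr_ge0 ?(ltW e2)//.
    by rewrite ltr_nat.
  have mp : 0 < m.+1%:R^-1 :> R by rewrite invr_gt0 ltr0n.
  have /choice[q Hq] i : exists q : rat, `|x ord0 i - ratr q| < m.+1%:R^-1.
    have /rat_in_itvoo[q] : x ord0 i < x ord0 i + m.+1%:R^-1 by rewrite ltrDl.
    rewrite in_itv/= => /andP[q1 q2]; exists q; rewrite ltr_distl.
    by rewrite ltrBlDr q2/= (lt_trans q1)// ltrDl.
  pose Q : 'rV[rat]_d := \row_i q i.
  exists (pickle (Q, m)) => //; rewrite /F pickleK; case: asboolP => [_|].
    by move=> i; rewrite mxE; exact: Hq.
  case; move=> y /= Hy; apply: eA; rewrite -ball_normE /ball_/=.
  apply: norm_lt_coord => // i; rewrite !mxE.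
  have := Hy i; rewrite mxE => y1; have x1 := Hq i.
  rewrite (_ : x ord0 i - y ord0 i = (x ord0 i - ratr (q i)) + (ratr (q i) - y ord0 i)); last by ring.
  by rewrite (le_lt_trans (ler_normD _ _))// (distrC (ratr _)) -[ltRHS](@divfK _ 2)// mulr2n mulrDr mulr1 ltrD// (lt_trans _ me).
apply: bigcupT_measurable => j; rewrite /F; case: (unpickle j) => [[q m]|//].
by case: asboolP => // _; exact: measurable_rat_box.
Qed.

(** Preimages of open intervals are open, and [rV_open_measurable] makes them measurable. *)
Lemma lipschitz_measurable (f : 'rV[R]_d -> R) :
  (forall x y, `|f x - f y| <= `|x - y|) -> measurable_fun setT f.
Proof.
move=> fl; apply: (measurability _ (RGenOpens.measurableE R)).
move=> _ [_ [a [b ->] <-]]; rewrite setTI; apply: rV_open_measurable.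
rewrite openE => x /= fx; apply/nbhs_ballP.
have /nbhs_ballP[e e0 eA] : nbhs (f x) `]a, b[%classic by apply: open_nbhs_nbhs; split => //; exact: interval_open.
exists e => // y xy; apply: eA; rewrite -ball_normE /ball_/= (le_lt_trans (fl x y))//.
by move: xy; rewrite -ball_normE.
Qed.

Lemma mu_cubeE (L : R) : 0 <= L -> mu d (@cube R d L) = ((2 * L) ^+ d)%:E.
Proof.
move=> L0; rewrite (@lebesgue_rV_box R d (fun=> `[(- L)%R, L]%classic))//.
have E : lebesgue_measure (`[(- L)%R, L]%classic : set R) = (2 * L)%:E.
  rewrite lebesgue_measure_itv/= lte_fin; case: ltP => h.
    by rewrite -EFinB; congr EFin; ring.
  by congr EFin; lra.
rewrite (eq_bigr (fun=> (2 * L)%:E)); last by move=> i _; exact: E.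
by rewrite prodEFin prodr_const card_ord.
Qed.

Lemma mu_open_gt0 (A : set 'rV[R]_d) : open A -> A 0 -> (0 < mu d A)%E.
Proof.
move=> oA A0; have /nbhs_ballP[e/= e0 eA] : nbhs (0 : 'rV[R]_d) A by exact: open_nbhs_nbhs.
have e4 : 0 < e / 2 by rewrite divr_gt0.
apply: (@lt_le_trans _ _ (mu d (@cube R d (e / 2)))).
  by rewrite mu_cubeE ?ltW// lte_fin exprn_gt0// mulr_gt0.
apply: le_measure; rewrite ?inE; [exact: measurable_cube|exact: rV_open_measurable|].
move=> x xc; apply: eA; rewrite -ball_normE /ball_/= sub0r normrN.
apply: norm_lt_coord => // i; have := xc i; rewrite /= in_itv/= -ler_norml => /le_lt_trans; apply.
by rewrite ltr_pdivrMr// ltr_pMr// ltr1n.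
Qed.

Lemma mu_bounded_lty (A : set 'rV[R]_d) : measurable A -> bounded_set A -> (mu d A < +oo)%E.
Proof.
move=> mA /bounded_setP[L L0 AL]; apply: (@le_lt_trans _ _ (mu d (@cube R d L))); last exact: mu_cube_lty.
apply: le_measure; rewrite ?inE//; first exact: measurable_cube.
by move=> x Ax i /=; rewrite in_itv/= -ler_norml; exact: AL.
Qed.

End open_rV.

Section gag_lipschitz.
Variable R : realType.
Local Notation mu := (lebesgue_rV R).
Variables (d : nat) (s : R).
Hypothesis hs : 0 < s < 1.

Lemma levyN (h : 'rV[R]_d) : levy s (- h) = levy s h.
Proof. by rewrite /levy -scaleN1r enormZ normrN1 mul1r. Qed.

(** The squared increment is at most [K * min (4, |x - y|^2)] and vanishes unless [x] or [y] is in
    [C]. So the integrand is dominated by [K * levy (x - y)] times the sum of the two indicators;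
    [levy] is integrable and [C] has finite measure. *)
Lemma gag_lipschitz_lty (f : 'rV[R]_d -> R) (C : set 'rV[R]_d) L :
  measurable_fun setT f -> measurable C -> (mu d C < +oo)%E ->
  (forall x, ~ C x -> f x = 0) -> (forall x, 0 <= f x <= 1) ->
  (forall x y, `|f x - f y| <= L * enorm (x - y)) -> (gag s f < +oo)%E.
Proof.
move=> mf mC Coo fC f01 fL; pose K := L ^+ 2 + 1.
have K0 : 0 <= K by rewrite addr_ge0 ?sqr_ge0.
have mI : measurable_fun setT (\1_C : _ -> R) by exact: measurable_indic.
have mlv : measurable_fun setT (fun q : 'rV[R]_d * 'rV[R]_d => levy s (q.1 - q.2)).
  by apply: (meas_comp (@meas_levy R d s)); apply: meas_rVB; meas.
have mI1 : measurable_fun setT (fun q : 'rV[R]_d * 'rV[R]_d => \1_C q.1 : R) by apply: (meas_comp mI); meas.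
have mI2 : measurable_fun setT (fun q : 'rV[R]_d * 'rV[R]_d => \1_C q.2 : R) by apply: (meas_comp mI); meas.
pose G1 (q : 'rV[R]_d * 'rV[R]_d) := levy s (q.1 - q.2) * \1_C q.1.
pose G2 (q : 'rV[R]_d * 'rV[R]_d) := levy s (q.1 - q.2) * \1_C q.2.
have mG1 : measurable_fun setT G1 by exact: measurable_funM.
have mG2 : measurable_fun setT G2 by exact: measurable_funM.
have G10 q : 0 <= G1 q by rewrite mulr_ge0 ?levy_ge0 ?indic_ge0R.
have G20 q : 0 <= G2 q by rewrite mulr_ge0 ?levy_ge0 ?indic_ge0R.
have J y : (\int[mu d]_x (levy s (x - y))%:E = \int[mu d]_h (levy s h)%:E)%E.
  rewrite -(@int_rV_shift R d (fun h => (levy s h)%:E) (- y))//.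
    by apply/measurable_EFinP; exact: meas_levy.
  by move=> x; rewrite lee_fin levy_ge0.
have I0 : (0 <= \int[mu d]_h (levy s h)%:E)%E by apply: int_ge0 => h; exact: levy_ge0.
have Ifin : (\int[mu d]_h (levy s (h : 'rV[R]_d))%:E)%E \is a fin_num.
  by rewrite ge0_fin_numE//; exact: levy_lty.
have iC : (\int[mu d]_y (\1_C y)%:E < +oo)%E by rewrite integral_indic ?setIT.
have E2 : (\int[mu d \x mu d]_q (G2 q)%:E < +oo)%E.
  rewrite tonelli2; [|by apply/measurable_EFinP|by move=> q; rewrite lee_fin].
  have inner y : (\int[mu d]_x (G2 (x, y))%:E = (\1_C y)%:E * \int[mu d]_h (levy s h)%:E)%E.
    rewrite -(J y) -ge0_intZ; [by apply: eq_integral => x _; rewrite /G2/= mulrC| | |exact: indic_ge0R].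
    - by apply: (meas_comp (@meas_levy R d s)); apply: meas_rVB; meas.
    - by move=> x; exact: levy_ge0.
  under eq_integral do rewrite inner.
  rewrite ge0_integralZr//; last by meas.
  have Ilt : (\int[mu d]_h (levy s (h : 'rV[R]_d))%:E < +oo)%E by exact: levy_lty.
  apply: lte_mul_pinfty => //; first by apply: int_ge0 => x; exact: indic_ge0R.
  by rewrite ge0_fin_numE//; apply: int_ge0 => x; exact: indic_ge0R.
have E1 : (\int[mu d \x mu d]_q (G1 q)%:E < +oo)%E.
  rewrite tonelli1; [|by apply/measurable_EFinP|by move=> q; rewrite lee_fin].
  have inner x : (\int[mu d]_y (G1 (x, y))%:E = (\1_C x)%:E * \int[mu d]_h (levy s h)%:E)%E.
    rewrite -(J x) -ge0_intZ; [|  | |exact: indic_ge0R].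
    - by apply: eq_integral => y _; rewrite /G1/= mulrC -levyN opprB.
    - by apply: (meas_comp (@meas_levy R d s)); apply: meas_rVB; meas.
    - by move=> y; exact: levy_ge0.
  under eq_integral do rewrite inner.
  rewrite ge0_integralZr//; last by meas.
  have Ilt : (\int[mu d]_h (levy s (h : 'rV[R]_d))%:E < +oo)%E by exact: levy_lty.
  apply: lte_mul_pinfty => //; first by apply: int_ge0 => x; exact: indic_ge0R.
  by rewrite ge0_fin_numE//; apply: int_ge0 => x; exact: indic_ge0R.
apply: (@le_lt_trans _ _ (\int[mu d \x mu d]_q (K * (G1 q + G2 q))%:E)%E); last first.
  rewrite ge0_intZ//; [|by apply: measurable_funD|by move=> q; rewrite addr_ge0].
  rewrite ge0_intD// lte_mul_pinfty ?lee_fin//.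
  by rewrite lte_add_pinfty.
have mf1 : measurable_fun setT (fun q : 'rV[R]_d * 'rV[R]_d => f q.1) by apply: (meas_comp mf); meas.
have mf2 : measurable_fun setT (fun q : 'rV[R]_d * 'rV[R]_d => f q.2) by apply: (meas_comp mf); meas.
apply: ge0_le_intR.
- apply: measurable_funM; first by apply: measurable_funX; exact: (measurable_funB mf1 mf2).
  by apply: (meas_comp (@meas_inv_pow R d (d%:R + 2 * s))); apply: meas_rVB; meas.
- by apply: measurable_funM => //; exact: (measurable_funD mG1 mG2).
- by move=> q; rewrite mulr_ge0 ?sqr_ge0 ?invr_ge0 ?powR_ge0.
move=> -[x y]; rewrite /G1 /G2 -mulrDr /levy/=.
rewrite (_ : K * _ = (K * Num.min 4 (enorm (x - y) ^+ 2) * (\1_C x + \1_C y)) / enorm (x - y) `^ (d%:R + 2 * s)); last by ring.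
rewrite ler_wpM2r ?invr_ge0 ?powR_ge0//.
have m0 : 0 <= Num.min 4 (enorm (x - y) ^+ 2) by rewrite le_min sqr_ge0 andbT.
have H : (f x - f y) ^+ 2 <= K * Num.min 4 (enorm (x - y) ^+ 2).
  have a := f01 x; have b := f01 y.
  case: (leP 4 (enorm (x - y) ^+ 2)) => _.
    have h : (f x - f y) ^+ 2 <= 1 by rewrite -real_normK ?num_real// exprn_ile1// ler_norml; apply/andP; split; lra.
    by rewrite (le_trans h)// /K; have := sqr_ge0 L; lra.
  apply: (@le_trans _ _ (L ^+ 2 * enorm (x - y) ^+ 2)).
    rewrite -exprMn -real_normK ?num_real// lerXn2r ?nnegrE//.
    exact: le_trans (normr_ge0 _) (fL x y).
  by rewrite ler_wpM2r ?sqr_ge0// lerDl.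
have [Cx|Cx] := boolP (x \in C).
  rewrite indicE Cx; apply: le_trans H _; rewrite -[leLHS]mulr1 ler_wpM2l ?mulr_ge0//.
  by rewrite lerDl indic_ge0R.
have [Cy|Cy] := boolP (y \in C).
  rewrite [\1_C y]indicE Cy; apply: le_trans H _; rewrite -[leLHS]mulr1 ler_wpM2l ?mulr_ge0//.
  by rewrite lerDr indic_ge0R.
have fx : f x = 0 by apply: fC; move: Cx; rewrite notin_setE.
have fy : f y = 0 by apply: fC; move: Cy; rewrite notin_setE.
rewrite fx fy subrr expr0n/= mulr_ge0 ?addr_ge0 ?indic_ge0R//.
by rewrite mulr_ge0.
Qed.

End gag_lipschitz.

Section cutoff.
Variable R : realType.
Local Notation mu := (lebesgue_rV R).
Variables (k : nat) (s : R) (B : set 'rV[R]_k).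
Hypotheses (hs : 0 < s < 1) (k0 : (0 < k)%N).
Hypotheses (oB : open B) (bB : bounded_set B).

Definition dist_compl (t : 'rV[R]_k) : R := inf [set `|t - y| | y in ~` B].

(** Boundedness together with [0 < k] provides a point outside [B]; the infimum over an empty set
    would be a default value. *)
Let compl_nonempty : (~` B) !=set0.
Proof.
have [L L0 BL] := bounded_setP bB; exists (const_mx (L + 1)) => /BL /(_ (Ordinal k0)).
by rewrite mxE gtr0_norm ?addr_gt0// gerDl ler10.
Qed.

Lemma dist_compl_le t y : ~ B y -> dist_compl t <= `|t - y|.
Proof.
move=> By; apply: ge_inf; last by exists y.
by exists 0 => _ [z _ <-]; exact: normr_ge0.
Qed.

Lemma dist_compl_ge t c : (forall y, ~ B y -> c <= `|t - y|) -> c <= dist_compl t.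
Proof.
move=> H; apply: lb_le_inf; last by move=> _ [y By <-]; exact: H.
by have [y By] := compl_nonempty; exists `|t - y|; exists y.
Qed.

Lemma dist_compl_ge0 t : 0 <= dist_compl t.
Proof. by apply: dist_compl_ge => y _; exact: normr_ge0. Qed.

Lemma dist_compl_lip t t' : `|dist_compl t - dist_compl t'| <= `|t - t'|.
Proof.
have H a b : dist_compl a - dist_compl b <= `|a - b|.
  rewrite lerBlDl -lerBlDr; apply: dist_compl_ge => y By; rewrite lerBlDr.
  apply: le_trans (dist_compl_le a By) _.
  by rewrite (_ : a - y = (b - y) + (a - b)) ?ler_normD// [RHS]addrC subrKA.
by rewrite ler_norml H andbT lerNl opprB distrC H.
Qed.

Lemma dist_compl_out t : ~ B t -> dist_compl t = 0.
Proof.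
move=> Bt; apply/eqP; rewrite eq_le dist_compl_ge0 andbT.
by have := dist_compl_le t Bt; rewrite subrr normr0.
Qed.

Lemma dist_compl_gt0 t : B t -> 0 < dist_compl t.
Proof.
move=> Bt; have /nbhs_ballP[e/= e0 eB] : nbhs (t : 'rV[R]_k) B by exact: open_nbhs_nbhs.
apply: lt_le_trans e0 _; apply: dist_compl_ge => y By; rewrite leNgt; apply/negP => ty.
by apply: By; apply: eB; rewrite -ball_normE.
Qed.

(** Lipschitz with constant [N], and increasing to the indicator of [B] as [N] grows. *)
Definition cutoff (N : nat) t : R := Num.min 1 (N%:R * dist_compl t).

Lemma cutoff01 N t : 0 <= cutoff N t <= 1.
Proof. by rewrite ge_min lexx le_min ler01 mulr_ge0// dist_compl_ge0. Qed.

Lemma cutoff_out N t : ~ B t -> cutoff N t = 0.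
Proof. by move=> /dist_compl_out tB; rewrite /cutoff tB mulr0 min_r. Qed.

Lemma cutoff_lip N t t' : `|cutoff N t - cutoff N t'| <= N%:R * enorm (t - t').
Proof.
apply: (@le_trans _ _ (N%:R * `|dist_compl t - dist_compl t'|)); last first.
  by rewrite ler_wpM2l// (le_trans (dist_compl_lip t t'))// norm_le_enorm.
rewrite -[X in X * _](@ger0_norm _ N%:R)// -normrM mulrBr /cutoff.
move: (N%:R * dist_compl t) (N%:R * dist_compl t') => a b.
by rewrite !minEle ler_norml; case: (ltP 0 (a - b)) => h; [rewrite (gtr0_norm h)|rewrite (ler0_norm h)];
  case: (leP 1 a) => ?; case: (leP 1 b) => ?; apply/andP; split; lra.
Qed.

Lemma meas_cutoff N : measurable_fun setT (cutoff N).
Proof.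
have := lipschitz_measurable dist_compl_lip => m.
by apply: measurable_minr; meas.
Qed.

Let mB : measurable B := rV_open_measurable oB.
Let Boo : (mu k B < +oo)%E := mu_bounded_lty mB bB.

Lemma nice_cutoff N : nice (mu k) (cutoff N).
Proof.
have m := meas_cutoff N.
have L (g : 'rV[R]_k -> R) : measurable_fun setT g -> (forall t, 0 <= g t) ->
    (forall t, g t <= \1_B t) -> (\int[mu k]_t (g t)%:E < +oo)%E.
  move=> mg g0 gB; apply: (@le_lt_trans _ _ (\int[mu k]_t (\1_B t)%:E)%E).
    by apply: ge0_le_intR => //; exact: measurable_indic.
  by rewrite integral_indic ?setIT.
have cB t : cutoff N t <= \1_B t.
  rewrite indicE; have [|] := boolP (t \in B); first by have /andP[] := cutoff01 N t.
  by rewrite notin_setE => /cutoff_out ->.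
split.
  apply: integrableR => //; apply: L; [by meas|by []|move=> t].
  by rewrite ger0_norm//; have /andP[] := cutoff01 N t.
apply: L; [by meas|by move=> t; exact: sqr_ge0|move=> t].
by apply: le_trans (cB t); have := cutoff01 N t; nra.
Qed.

Lemma fen_cutoff N : (fen s (cutoff N) < +oo)%E.
Proof.
apply: (fen_energy hs k0 (nice_cutoff N)).
have c0 : 0 < C_frac k s / 2 by rewrite divr_gt0// C_frac_gt0.
rewrite energyE lte_mul_pinfty ?lee_fin ?(ltW c0)//.
exact: (gag_lipschitz_lty hs (meas_cutoff N) mB Boo (@cutoff_out N) (cutoff01 N) (cutoff_lip N)).
Qed.

(** [2 q - q^2 = 1 - (1 - q)^2] on [B], so the missing mass is the integral of [f N]. It tends to 0
    by dominated convergence: at each [t] of the open set [B], eventually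
    [N * dist_compl t >= 1]. *)
Lemma cutoff_mass (e : R) : 0 < e -> exists N,
  fine (mu k B) - e <= \int[mu k]_t (2 * cutoff N t - cutoff N t ^+ 2).
Proof.
move=> e0; pose f N t := \1_B t * (1 - cutoff N t) ^+ 2.
have iI := integrable_indicR mB Boo.
have mf N : measurable_fun setT (f N).
  have m := meas_cutoff N; have mI := measurable_indic (R := R) mB.
  by rewrite /f; meas.
have f0 N t : 0 <= f N t by rewrite mulr_ge0 ?indic_ge0R ?sqr_ge0.
have fI N t : `|f N t| <= \1_B t.
  rewrite ger0_norm// ler_piMr ?indic_ge0R//.
  by have := cutoff01 N t; nra.
have lim : {ae mu k, forall t, f ^~ t @ \oo --> (0 : R)}.
  apply: aeW => t; have [tB|tB] := pselect (B t); last first.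
    rewrite /f indicE memNset//; under eq_fun do rewrite mul0r; exact: cvg_cst.
  have d0 := dist_compl_gt0 tB.
  apply: cvg_near_cst; exists (Num.bound (dist_compl t)^-1) => //= N HN.
  rewrite /f /cutoff min_l ?subrr ?expr0n/= ?mulr0//.
  rewrite -ler_pdivrMr// mul1r; apply: (@le_trans _ _ (Num.bound (dist_compl t)^-1)%:R).
    by apply/ltW/archi_boundP; rewrite invr_ge0 ltW.
  by rewrite ler_nat.
have := cvge0_near (dct0 mf lim iI fI) e0 => -[N _ /(_ N (leqnn N)) HN]; exists N.
have nc := nice_cutoff N; have i2 := nice_sqr nc.
have i1 := integrableZR 2 nc.1; have i12 := integrableDR i1 (integrableNR i2).
have if_ : (mu k).-integrable setT (EFin \o f N).
  by apply: (integrable_le (mf N) iI) => t; exact: fI.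
move: HN; rewrite (Rint_EFin if_) lee_fin => HN.
have E : \int[mu k]_t f N t = fine (mu k B) - \int[mu k]_t (2 * cutoff N t - cutoff N t ^+ 2).
  rewrite -(Rint_indic (mu k) mB) -RintegralB//; apply: eq_Rintegral => t _.
  rewrite /f indicE; have [|] := boolP (t \in B); first by move=> _ /=; ring.
  by rewrite notin_setE => /cutoff_out ->; rewrite expr0n/= mulr0; ring.
by move: HN; rewrite E; lra.
Qed.

End cutoff.

(** * Comparison of the average with the limit problem *)

(** With [int_sqr_ae0] this carries null sets between dimensions: vanishing almost everywhere is
    read as a zero square integral, to which [average_sqr] and [int_tensor_sqr] apply. *)
Lemma int_sqr_le0_ae d (T : measurableType d) (R : realType) (m : {measure set T -> \bar R})
    (g : T -> R) : measurable_fun setT g -> (\int[m]_x (g x ^+ 2)%:E <= 0)%E ->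
  {ae m, forall x, g x = 0}.
Proof.
move=> mg g0; have mg2 : measurable_fun setT (fun x => (g x ^+ 2)%:E) by meas.
have /(ae_eq_integral_abs m measurableT mg2) : (\int[m]_x `|(g x ^+ 2)%:E| = 0)%E.
  apply/eqP; rewrite eq_le integral_ge0// andbT; apply: le_trans g0.
  by rewrite le_eqVlt; apply/orP; left; apply/eqP; apply: eq_integral => x _; rewrite gee0_abs// lee_fin sqr_ge0.
apply: filterS => x /(_ I) /= [] /eqP; by rewrite sqrf_eq0 => /eqP.
Qed.

Lemma int_sqr_ae0 d (T : measurableType d) (R : realType) (m : {measure set T -> \bar R})
    (g : T -> R) : measurable_fun setT g -> {ae m, forall x, g x = 0} ->
  (\int[m]_x (g x ^+ 2)%:E = 0)%E.
Proof.
move=> mg g0; transitivity (\int[m]_x (0 : R)%:E)%E; last by rewrite integral0.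
apply: ae_eq_intR; [by meas|exact: measurable_cst|].
by move: g0; apply: filterS => x ->; rewrite expr0n.
Qed.

Section cylinder.
Variable R : realType.
Local Notation mu := (lebesgue_rV R).
Variables (n k : nat).

Lemma closure_cylinder (A : set 'rV[R]_n) (B : set 'rV[R]_k) z :
  closure (cylinder A B) z -> closure A (lsubmx z).
Proof.
move=> cz N /nbhs_ballP[e/= e0 eN]; have [y [[Ay _] zy]] := cz _ (nbhsx_ballx z e e0).
exists (lsubmx y); split => //; apply: eN; move: zy; rewrite -!ball_normE /ball_/= => zy.
apply: norm_lt_coord => // i; rewrite !mxE; apply: le_lt_trans zy.
by have := coord_le_norm (z - y) (lshift k i); rewrite !mxE.
Qed.

Lemma cylinder_closure (A : set 'rV[R]_n) (B : set 'rV[R]_k) z :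
  closure A (lsubmx z) -> B (rsubmx z) -> closure (cylinder A B) z.
Proof.
move=> cA Bz N /nbhs_ballP[e/= e0 eN]; have [y [Ay zy]] := cA _ (nbhsx_ballx (lsubmx z) e e0).
exists (row_mx y (rsubmx z)); split; first by split; rewrite ?row_mxKl ?row_mxKr.
apply: eN; move: zy; rewrite -!ball_normE /ball_/= => zy.
have -> : z - row_mx y (rsubmx z) = row_mx (lsubmx z - y) 0.
  by rewrite -{1}(hsubmxK z) opp_row_mx add_row_mx subrr.
apply: norm_lt_coord => // i; case: (splitP i) => j ij.
  have -> : i = lshift k j by exact: val_inj.
  by rewrite row_mxEl; apply: le_lt_trans zy; exact: coord_le_norm.
have -> : i = rshift n j by exact: val_inj.
by rewrite row_mxEr mxE normr0.
Qed.

Lemma bounded_cylinder (A : set 'rV[R]_n) (B : set 'rV[R]_k) :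
  bounded_set A -> bounded_set B -> bounded_set (cylinder A B).
Proof.
move=> /bounded_setP[L L0 AL] /bounded_setP[M M0 BM].
have LM : 0 < L + M by rewrite addr_gt0.
exists (L + M); split; first exact: gtr0_real.
move=> x Lx z [Az Bz]; apply/ltW; apply: norm_lt_coord; first exact: lt_trans Lx.
move=> i; apply: le_lt_trans Lx; case: (splitP i) => j ij.
  have -> : i = lshift k j by exact: val_inj.
  by have := AL _ Az j; rewrite mxE => /le_trans; apply; rewrite lerDl ltW.
have -> : i = rshift n j by exact: val_inj.
by have := BM _ Bz j; rewrite mxE => /le_trans; apply; rewrite lerDr ltW.
Qed.

Lemma closed_rV_measurable d (A : set 'rV[R]_d) : closed A -> measurable A.
Proof.
by move=> cA; rewrite -(setCK A); apply: measurableC; apply: rV_open_measurable; exact: closed_openC.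
Qed.

End cylinder.

(** * The energy estimate for one cylinder *)

Section key.
Variable R : realType.
Local Notation mu := (lebesgue_rV R).
Variables (n k : nat) (s : R).
Hypotheses (hs : 0 < s < 1) (hn : (0 < n)%N).
Variables (omega : set 'rV[R]_n) (f v : 'rV[R]_n -> R).
Hypotheses (bomega : bounded_set omega) (hf : L2 omega f).
Hypothesis hv : weak_solution s omega f v.
Variables (B : set 'rV[R]_k) (u : 'rV[R]_(n + k) -> R).
Hypotheses (mB : measurable B) (bB : bounded_set B) (B0 : (0 < mu k B)%E).
Hypothesis hu : weak_solution s (cylinder omega B) (fun z => f (lsubmx z)) u.

Local Notation m12 := (prodm (mu n) (mu k)).
Let Boo : (mu k B < +oo)%E := mu_bounded_lty mB bB.
Let b := fine (mu k B).
Let b0 : 0 < b := fine_meas_gt0 B0 Boo.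
Let nk0 : (0 < n + k)%N. Proof. by rewrite addn_gt0 hn. Qed.
Let F := f \_ omega.
Let w := average B u.
Let bU := bounded_cylinder bomega bB.
Let nv : nice (mu n) v := Htilde_nice bomega hv.1.
Let nu : nice (mu (n + k)) u := Htilde_nice bU hu.1.
Let fv : (fen s v < +oo)%E := fen_energy hs hn nv hv.1.1.2.
Let fu : (fen s u < +oo)%E := fen_energy hs nk0 nu hu.1.1.2.
Let nw : nice (mu n) w := nice_average nu mB B0 Boo.

Let kE d : exists2 c : R, 0 < c & c = (2 * pi) ^+ d.
Proof. by exists ((2 * pi) ^+ d) => //; rewrite exprn_gt0// mulr_gt0// pi_gt0. Qed.

Let fw : (fen s w < +oo)%E.
Proof.
have [c c0 cE] := kE k; have /andP[s0 _] := hs.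
apply: (@lt_mul_pinfty_inv R (b * c)); [by rewrite mulr_gt0|exact: fen_ge0|].
exact: le_lt_trans (fen_average nu mB B0 Boo s0 cE) fu.
Qed.

Let nF : nice (mu n) F.
Proof.
have [mF F2] := (Lfun2P F).1 hf; have [L L0 oL] := bounded_setP bomega.
apply: (@nice_of_L2 _ _ F L) => //; apply: aeW => z zL.
rewrite /F patchE; case: ifPn => //; rewrite inE => /oL zo.
by case: zL => i /=; rewrite in_itv/= -ler_norml.
Qed.

Let nI : nice (mu k) (\1_B).
Proof.
split; first exact: integrable_indicR.
apply: (@le_lt_trans _ _ (\int[mu k]_t (\1_B t)%:E)%E); last by rewrite integral_indic ?setIT.
have mI := measurable_indic (R := R) mB.
apply: ge0_le_intR; [by meas|by []|by move=> t; exact: sqr_ge0|move=> t].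
by have := @indic_le1R R _ B t; have := @indic_ge0R R _ B t; nra.
Qed.

(** The datum of the cylinder problem, extended by 0 to the whole space. *)
Let G := tensor F (\1_B : 'rV[R]_k -> R).
Let nG : nice (mu (n + k)) G := nice_tensor nF nI.

Let rhs_omega phi : \int[mu n]_(z in omega) (f z * phi z) = \int[mu n]_z (F z * phi z).
Proof.
rewrite Rintegral_mkcond; apply: eq_Rintegral => z _; rewrite /F !patchE.
by case: ifP => _ //; rewrite mul0r.
Qed.

Let rhs_cylinder phi : \int[mu (n + k)]_(z in cylinder omega B) (f (lsubmx z) * phi z) =
  \int[mu (n + k)]_z (G z * phi z).
Proof.
rewrite Rintegral_mkcond; apply: eq_Rintegral => z _; rewrite /G /tensor /F !patchE indicE.
have [zU|] := boolP (z \in cylinder omega B).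
  move: zU; rewrite inE => -[zo zB]; rewrite mem_set// mem_set//= mulr1//.
rewrite notin_setE => zU; have [zo|_] := boolP (lsubmx z \in omega); last by rewrite !mul0r.
have [zB|_] := boolP (rsubmx z \in B); last by rewrite mulr0 mul0r.
by case: zU; split; rewrite -inE.
Qed.

Let closure_omega_meas : measurable (closure omega).
Proof. by apply: closed_rV_measurable; exact: closed_closure. Qed.

Lemma average_Htilde : Htilde s omega w.
Proof.
split; first split.
- by apply/L2_setTP; split; [exact: nice_meas nw|case: nw].
- exact: energy_fen.
(* Multiplied by this indicator, [u] vanishes almost everywhere, hence so does the average of the
   product; at points [x] off the closure that average is the average of [u]. *)
pose c (z : 'rV[R]_(n + k)) : R := \1_(~` closure omega) (lsubmx z).
have mI : measurable_fun setT (\1_(~` closure omega) : _ -> R).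
  by apply: measurable_indic; exact: measurableC.
have mc : measurable_fun setT c by apply: (meas_comp mI); apply: meas_lsubmx; meas.
have ng : nice (mu (n + k)) (fun z => u z * c z).
  by apply: (nice_mulb nu mc) => z; rewrite ger0_norm ?indic_ge0R ?indic_le1R.
have mg := nice_meas ng.
have g0 : {ae mu (n + k), forall z, u z * c z = 0}.
  move: hu.1.2; apply: filterS => z uz; rewrite /c indicE.
  have [|_] := boolP (lsubmx z \in _); last by rewrite mulr0.
  by rewrite inE => zo; rewrite uz ?mul0r// => /closure_cylinder.
have := average_sqr ng mB B0 Boo; rewrite (int_sqr_ae0 mg g0) => H.
have mwg := integrableR_meas (integrable_average ng mB).
have {}H : (\int[mu n]_x (average B (fun z => u z * c z) x ^+ 2)%:E <= 0)%E.
  rewrite -(@lee_pmul2l _ b%:E) ?mule0// ?lte_fin//.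
move: (int_sqr_le0_ae mwg H); apply: filterS => x wx xo.
rewrite -wx averageE /w averageE; congr (_ * _); apply: eq_Rintegral => t _.
have cx : c (row_mx x t) = 1 by rewrite /c row_mxKl indicE mem_set.
by rewrite /pair_fun/= cx mulr1.
Qed.

Variable q : 'rV[R]_k -> R.
Hypotheses (nq : nice (mu k) q) (fq : (fen s q < +oo)%E) (q0 : forall t, ~ B t -> q t = 0).
Let T := tensor v q.
Let nT : nice (mu (n + k)) T := nice_tensor nv nq.

Let fT : (fen s T < +oo)%E.
Proof.
have [c1 c10 c1E] := kE n; have [c2 c20 c2E] := kE k.
apply: le_lt_trans (fen_tensor nv nq hs c1E c2E) _.
apply: lte_add_pinfty; apply: lte_mul_pinfty => //; rewrite ?fen_ge0//.
- by rewrite (ge0_fin_numE (fen_ge0 s v)); exact: fv.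
- by apply: lte_mul_pinfty; [rewrite lee_fin ltW|by []|case: nq].
- by rewrite mule_ge0 ?lee_fin ?(ltW c10)//; apply: int_ge0 => x; exact: sqr_ge0.
- rewrite fin_numM// ge0_fin_numE; [by case: nv|by apply: int_ge0 => x; exact: sqr_ge0].
Qed.

Lemma tensor_Htilde : Htilde s (cylinder omega B) T.
Proof.
split; first split.
- by apply/L2_setTP; split; [exact: nice_meas nT|case: nT].
- exact: energy_fen.
have mI : measurable_fun setT (\1_(~` closure omega) : _ -> R).
  by apply: measurable_indic; exact: measurableC.
have nvc : nice (mu n) (fun x => v x * \1_(~` closure omega) x).
  by apply: (nice_mulb nv mI) => z; rewrite ger0_norm ?indic_ge0R ?indic_le1R.
have v0 : {ae mu n, forall x, v x * \1_(~` closure omega) x = 0}.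
  move: hv.1.2; apply: filterS => x vx; rewrite indicE.
  by have [|_] := boolP (x \in _); rewrite ?mulr0// inE => /vx ->; rewrite mul0r.
have := int_tensor_sqr nvc nq; rewrite (int_sqr_ae0 (nice_meas nvc) v0) mul0e => H.
have : {ae mu (n + k), forall z, tensor (fun x => v x * \1_(~` closure omega) x) q z = 0}.
  by apply: int_sqr_le0_ae; [exact: (nice_meas (nice_tensor nvc nq))|rewrite H].
apply: filterS => z; rewrite /T /tensor => z0 zU.
have [zB|/q0 ->] := pselect (B (rsubmx z)); last by rewrite mulr0.
rewrite -z0 indicE mem_set ?mulr1//= => zo; apply: zU; exact: cylinder_closure.
Qed.

Let row_int (g : 'rV[R]_(n + k) -> R) : (mu (n + k)).-integrable setT (EFin \o g) ->
  \int[mu (n + k)]_z g z = \int[m12]_p g (row_mx p.1 p.2).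
Proof. by move=> ig; rewrite (Rint_transfer (@meas_row R n k) (@mu_rowE R n k) ig). Qed.

Let int_Gu : \int[mu (n + k)]_z (G z * u z) = b * \int[mu n]_x (F x * w x).
Proof.
have iGu := nice_mul nG nu; rewrite (row_int iGu).
have E (p : 'rV[R]_n * 'rV[R]_k) : G (row_mx p.1 p.2) * u (row_mx p.1 p.2) =
    pair_fun u p * \1_B p.2 * F p.1 by rewrite /G tensor_row /pair_fun; ring.
have i := integrable_transfer (@meas_row R n k) (@mu_rowE R n k) iGu.
have {}i : m12.-integrable setT (EFin \o (fun p => pair_fun u p * \1_B p.2 * F p.1)).
  by apply: eq_integrable i => // p _ /=; rewrite E.
under eq_Rintegral do rewrite E.
under [in RHS]eq_Rintegral do rewrite mulrC.
by rewrite (Rint_average nu mB (nice_meas nF) i) mulVKf// gt_eqF.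
Qed.

Let int_GT : \int[mu (n + k)]_z (G z * T z) = (\int[mu n]_x (F x * v x)) * (\int[mu k]_t q t).
Proof.
rewrite (row_int (nice_mul nG nT)).
rewrite -(Rint_tensor (m1 := mu n) (m2 := mu k) (nice_mul nF nv) nq.1).
apply: eq_Rintegral => p _; rewrite /G /T !tensor_row.
have [pB|/q0 ->] := pselect (B p.2); last by rewrite !mulr0.
by rewrite indicE mem_set//=; ring.
Qed.

Lemma fen_average_sub (k1 k2 : R) : k1 = (2 * pi) ^+ n -> k2 = (2 * pi) ^+ k ->
  (fen s (fun x => (w x - v x)%R) <=
   (k1 / b * (\int[mu n]_(x in omega) (f x * v x) * (b - \int[mu k]_t (2 * q t - q t ^+ 2))
     + (\int[mu n]_x (v x ^+ 2)) / k2 * fine (fen s q)))%:E)%E.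
Proof.
move=> k1E k2E.
have k10 : 0 < k1 by rewrite k1E exprn_gt0// mulr_gt0// pi_gt0.
have k20 : 0 < k2 by rewrite k2E exprn_gt0// mulr_gt0// pi_gt0.
have k12E : k1 * k2 = (2 * pi) ^+ (n + k) by rewrite k1E k2E exprD.
have /andP[s0 _] := hs.
have ev := weak_bil hv hv.1 nv nv fv fv.
have ew := weak_bil hv average_Htilde nv nw fv fw.
have eu := weak_bil hu hu.1 nu nu fu fu.
have eT := weak_bil hu tensor_Htilde nu nT fu fT.
rewrite rhs_omega (fourier_cstE k1E) in ev.
rewrite rhs_omega (fourier_cstE k1E) in ew.
rewrite rhs_cylinder (fourier_cstE k12E) int_Gu in eu.
rewrite rhs_cylinder (fourier_cstE k12E) int_GT in eT.
have Hw := fen_average nu mB B0 Boo s0 k2E.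
rewrite (fen_fin nw fw) (fen_fin nu fu) -EFinM lee_fin in Hw.
have HT := fen_tensor nv nq hs k1E k2E.
rewrite (fen_fin nT fT) (fen_fin nv fv) (fen_fin nq fq) in HT.
rewrite (Rint_EFin (nice_sqr nv)) (Rint_EFin (nice_sqr nq)) -!EFinM -EFinD lee_fin in HT.
have Hc := bil_le nu nT fu fT.
rewrite (fen_sub nw nv fw fv) (fen_fin nq fq) lee_fin /= rhs_omega.
rewrite (RintegralB measurableT (integrableZR 2 nq.1) (nice_sqr nq)).
rewrite (RintegralZl 2 measurableT nq.1).
move: ev ew eu eT Hw HT Hc.
rewrite -/b -/w.
move: (\int[mu n]_x (F x * v x)) (\int[mu n]_x (F x * w x)) (\int[mu k]_t q t).
move: (\int[mu n]_x (v x ^+ 2)) (\int[mu k]_t (q t ^+ 2)).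
move: (bil s v v) (bil s v w) (bil s u u) (bil s u T) (bil s w w) (bil s T T) (bil s q q).
(* [E] and [M] are the pairings of the datum with [v] and with [w], [Q1] and [Q2] the integrals of
   [q] and of [q^2]; what remains is real algebra. *)
move=> vv vw uu uT ww TT qq V2 Q2 E M Q1 ev ew eu eT Hw HT Hc.
have {}ev : vv = k1 * E by rewrite -ev mulVKf// gt_eqF.
have {}ew : vw = k1 * M by rewrite -ew mulVKf// gt_eqF.
have k12 : k1 * k2 != 0 by rewrite gt_eqF// mulr_gt0.
have {}eu : uu = k1 * k2 * (b * M) by rewrite -eu mulVKf.
have {}eT : uT = k1 * k2 * (E * Q1) by rewrite -eT mulVKf.
(* Since [uu] is [k1 * k2 * (b * M)], the energy bound for averages becomes a bound on [ww] in which
   the size of [B] cancels. *)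
have h1 : ww <= k1 * M.
  have bk : 0 < b * k2 by rewrite mulr_gt0.
  by rewrite -(ler_pM2l bk) (le_trans Hw)// eu le_eqVlt; apply/orP; left; apply/eqP; ring.
have kn0 : 0 < k1 / b by rewrite divr_gt0.
apply: (@le_trans _ _ (k1 * (E - M))); first by rewrite ev ew; lra.
have -> : k1 * (E - M) = k1 / b * (b * E - b * M) by field; rewrite gt_eqF.
rewrite ler_pM2l//.
(* This is [bil_le] for [u] and [T], with [uu] and [uT] evaluated by the equation and [TT] bounded
   by [fen_tensor]; divided by [k1 * k2] it bounds [M] from below. *)
have h2 : k1 * k2 * (2 * (E * Q1)) <= k1 * k2 * (b * M + E * Q2 + V2 / k2 * qq).
  rewrite (_ : k1 * k2 * (2 * _) = 2 * uT); last by rewrite eT; ring.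
  rewrite (le_trans Hc)// eu (le_trans (lerD (lexx _) HT))// ev.
  by rewrite le_eqVlt; apply/orP; left; apply/eqP; field; rewrite gt_eqF.
have {}h2 : 2 * (E * Q1) <= b * M + E * Q2 + V2 / k2 * qq by move: h2; rewrite ler_pM2l// mulr_gt0.
by move: h2; move: (V2 / k2 * qq) (b * M) => x y; lra.
Qed.

End key.

Section dilate.
Variable R : realType.
Local Notation mu := (lebesgue_rV R).
Variables (k : nat) (B : set 'rV[R]_k) (l : R).
Hypothesis l0 : 0 < l.
Let ln0 : l != 0. Proof. by rewrite gt_eqF. Qed.

Lemma dilateE t : dilate l B t <-> B (l^-1 *: t).
Proof.
split=> [[y By <-]|Bt]; first by rewrite scalerA mulVf// scale1r.
by exists (l^-1 *: t) => //; rewrite scalerA divff// scale1r.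
Qed.

Lemma dilate_open : open B -> open (dilate l B).
Proof.
rewrite !openE => oB t /dilateE Bt; apply/nbhs_ballP.
have /nbhs_ballP[e/= e0 eB] := oB _ Bt; exists (l * e) => /=; first by rewrite mulr_gt0.
move=> y; rewrite -ball_normE /ball_/= => ty; apply/dilateE; apply: eB.
by rewrite -ball_normE /ball_/= -scalerBr normrZ gtr0_norm ?invr_gt0// ltr_pdivrMl.
Qed.

Lemma dilate_bounded : bounded_set B -> bounded_set (dilate l B).
Proof.
move=> [M [Mr HM]]; exists (l * (`|M| + 1)); split; first by rewrite num_real.
move=> x Mx _ [y By <-]; rewrite /= normrZ (gtr0_norm l0) (le_trans _ (ltW Mx))//.
rewrite ler_pM2l//; apply: (HM (`|M| + 1)) => //.
by rewrite (le_lt_trans (ler_norm M))// ltrDl.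
Qed.

Lemma mu_dilate : measurable B -> measurable (dilate l B) ->
  mu k (dilate l B) = ((l ^+ k)%:E * mu k B)%E.
Proof.
move=> mB mlB; have li : 0 < l^-1 by rewrite invr_gt0.
have E D : measurable D -> mu k D = (\int[mu k]_t (\1_D t)%:E)%E.
  by move=> mD; rewrite integral_indic ?setIT.
rewrite !E//.
have := @int_rV_scale R k (fun t => (\1_B t)%:E) _ li.
rewrite exprVn invrK => <-.
- apply: eq_integral => t _; rewrite !indicE.
  have -> // : (t \in dilate l B) = (l^-1 *: t \in B).
  by apply/idP/idP; rewrite !inE => /dilateE.
- by apply/measurable_EFinP; exact: measurable_indic.
- by move=> t; rewrite lee_fin indic_ge0R.
Qed.

End dilate.

Lemma powR_inv_small (R : realType) (p e : R) : 0 < p -> 0 < e ->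
  \forall l \near +oo, l^-1 `^ p <= e.
Proof.
move=> p0 e0; exists (e^-1 `^ p^-1); split; first by rewrite num_real.
move=> l el; have l0 : 0 < l by rewrite (le_lt_trans _ el)// powR_ge0.
rewrite -[leRHS]powRr1 ?(ltW e0)// -(mulVf (lt0r_neq0 p0)) powRrM.
apply: ge0_ler_powR; rewrite ?nnegrE ?powR_ge0 ?invr_ge0 ?(ltW p0) ?(ltW l0)//.
rewrite invf_ple ?posrE ?powR_gt0//; apply: le_trans (ltW el).
by rewrite -powRN -[e^-1]powR_inv1 ?(ltW e0)// -powRrM mulN1r.
Qed.

Theorem theorem1p2 (R : realType) (n k : nat) (s : R)
    (omega : set 'rV[R]_n) (B1 : set 'rV[R]_k)
    (finfty : 'rV[R]_n -> R)
    (u : R -> 'rV[R]_(n + k) -> R) (uinfty : 'rV[R]_n -> R)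
    (hn : (1 <= n)%N) (hk : (1 <= k)%N) (hs : 0 < s < 1)
    (homega : lipschitz_domain omega) (bomega : bounded_set omega)
    (bB1 : bounded_set B1) (oB1 : open B1) (cB1 : convex_set B1)
    (B10 : B1 0)
    (hf : L2 omega finfty)
    (hu : forall l : R, 0 < l ->
      weak_solution s (cylinder omega (dilate l B1))
        (fun z => finfty (lsubmx z)) (u l))
    (huinfty : weak_solution s omega finfty uinfty) :
  (forall l : R, 0 < l -> Htilde s omega (average (dilate l B1) (u l))) /\
  Htilde_norm s (fun x => average (dilate l B1) (u l) x - uinfty x)
    @[l --> +oo] --> 0%E.
Proof.
pose mu := lebesgue_rV R.
have mB1 : measurable B1 := rV_open_measurable oB1.
have mB l : 0 < l -> measurable (dilate l B1).
  by move=> l0; apply: rV_open_measurable; exact: dilate_open.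
have bB l : 0 < l -> bounded_set (dilate l B1) by move=> l0; exact: dilate_bounded.
have muB l : 0 < l -> mu k (dilate l B1) = ((l ^+ k)%:E * mu k B1)%E.
  by move=> l0; exact: mu_dilate l0 mB1 (mB l l0).
have B1gt0 : (0 < mu k B1)%E by exact: mu_open_gt0.
have B1oo : (mu k B1 < +oo)%E by exact: mu_bounded_lty.
have Bgt0 l : 0 < l -> (0 < mu k (dilate l B1))%E.
  by move=> l0; rewrite muB// mule_gt0// lte_fin exprn_gt0.
split=> [l l0|].
  exact: (average_Htilde hs hn bomega (mB l l0) (bB l l0) (Bgt0 l l0) (hu l l0)).
have [k1 k10 k1E] : exists2 c : R, 0 < c & c = (2 * pi) ^+ n.
  by exists ((2 * pi) ^+ n) => //; rewrite exprn_gt0// mulr_gt0// pi_gt0.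
have [k2 k20 k2E] : exists2 c : R, 0 < c & c = (2 * pi) ^+ k.
  by exists ((2 * pi) ^+ k) => //; rewrite exprn_gt0// mulr_gt0// pi_gt0.
have [A A0 HA] := energy_le_fen n hs.
pose b1 := fine (mu k B1); have b10 : 0 < b1 by rewrite fine_gt0// B1gt0 B1oo.
pose E := \int[mu n]_(x in omega) (finfty x * uinfty x).
pose V := (\int[mu n]_x (uinfty x ^+ 2)) / k2.
have nv := Htilde_nice bomega huinfty.1.
have s2 : 0 < 2 * s by rewrite mulr_gt0//; case/andP: hs.
(* [fen_average_sub] for the dilated cutoff [q (l^-1 t)]: the factors [l ^ k] of the measure of the
   base, of the integral of [2 q - q^2] and of the energy cancel, and [l ^ (- 2 s)] remains on the
   cutoff term. *)
have key q : nice (mu k) q -> (fen s q < +oo)%E -> (forall t, ~ B1 t -> q t = 0) ->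
    forall l, 0 < l -> (energy s (fun x => average (dilate l B1) (u l) x - uinfty x)%R <=
    (A * (k1 / b1 * (E * (b1 - \int[mu k]_t (2 * q t - q t ^+ 2))
      + V * (l^-1 `^ (2 * s) * fine (fen s q)))))%:E)%E.
  move=> nq fq q0 l l0; have li : 0 < l^-1 by rewrite invr_gt0.
  have nw := nice_average (Htilde_nice (bounded_cylinder bomega (bB l l0)) (hu l l0).1)
    (mB l l0) (Bgt0 l l0) (mu_bounded_lty (mB l l0) (bB l l0)).
  apply: le_trans (HA _ (niceB nw nv)) _.
  rewrite EFinM; apply: lee_wpmul2l; first by rewrite lee_fin.
  have nql := nice_scale li nq.
  have fql : (fen s (fun t => q (l^-1 *: t)%R) < +oo)%E.
    by rewrite fen_scale// lte_mul_pinfty// lee_fin divr_ge0 ?powR_ge0 ?exprn_ge0// ltW.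
  have ql0 t : ~ dilate l B1 t -> q (l^-1 *: t) = 0.
    by move=> lt; apply: q0 => qt; apply: lt; exact/dilateE.
  have := fen_average_sub hs hn bomega hf huinfty (mB l l0) (bB l l0) (Bgt0 l l0) (hu l l0) nql fql ql0 k1E k2E.
  move=> /le_trans; apply; rewrite lee_fin.
  have iq : (mu k).-integrable setT (EFin \o (fun t => 2 * q t - q t ^+ 2)).
    by apply: integrableDR; [exact: (integrableZR 2 nq.1)|apply: integrableNR; exact: nice_sqr].
  rewrite (Rint_rV_scale li iq) fen_scale// muB// fineM//; last by rewrite ge0_fin_numE// ltW.
  rewrite fineM; [|by []|by rewrite (ge0_fin_numE (fen_ge0 s q)); exact: fq].
  rewrite /= -/b1 -/E -/V exprVn invrK -/mu.
  have lk : l ^+ k != 0 by rewrite expf_neq0// gt_eqF.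
  have bn : b1 != 0 by rewrite gt_eqF.
  move: (\int[mu k]_t _) (l^-1 `^ _) (fine (fen s q)) => Q p Fq.
  move: (l ^+ k) lk => L L0; rewrite le_eqVlt; apply/orP; left; apply/eqP; field.
  by rewrite L0 bn.
apply: cvge0_le => [l|e e0]; first exact: poweR_ge0.
pose c := A * (k1 / b1); have c0 : 0 <= c by rewrite mulr_ge0// divr_ge0// ltW.
(* Tested with itself, [uinfty] shows that [E] is its Fourier energy up to a nonnegative factor; the
   sign allows multiplying the mass estimate by [c * E]. *)
have E0 : 0 <= E.
  have fv := fen_energy hs hn nv huinfty.1.1.2.
  rewrite /E -(weak_bil huinfty huinfty.1 nv nv fv fv) mulr_ge0 ?sqr_ge0//.
  by rewrite -lee_fin -fen_fin// fen_ge0.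
have V0 : 0 <= V.
  rewrite divr_ge0 ?(ltW k20)// /Rintegral fine_ge0//.
  by apply: int_ge0 => x; exact: sqr_ge0.
(* The norm is the square root of the energy, so the target for the energy is [e ^+ 2], one half for
   each error term. *)
have e2 : 0 < e ^+ 2 / 2 by rewrite divr_gt0// exprn_gt0.
(* Adding 1 to the denominator covers [a = 0]. *)
have small (a : R) : 0 <= a -> a * (e ^+ 2 / 2 / (a + 1)) <= e ^+ 2 / 2.
  move=> a0; have a1 : 0 < a + 1 by rewrite ltr_wpDl.
  by rewrite mulrCA ler_piMr ?(ltW e2)// ler_pdivrMr// mul1r lerDl.
have cE0 : 0 <= c * E by rewrite mulr_ge0.
have cE1 : 0 < c * E + 1 by rewrite ltr_wpDl.
(* The choice of [N] does not depend on [l]; the threshold for [l] is taken afterwards, in terms of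
   the energy of this cutoff. *)
have [N HN] := cutoff_mass hk oB1 bB1 (divr_gt0 e2 cE1).
have nq := nice_cutoff hk oB1 bB1 N.
have fq := fen_cutoff hs hk oB1 bB1 N.
have Fq0 : 0 <= fine (fen s (cutoff B1 N)) by rewrite fine_ge0// fen_ge0.
have cV0 : 0 <= c * (V * fine (fen s (cutoff B1 N))) by rewrite mulr_ge0// mulr_ge0.
have cV1 : 0 < c * (V * fine (fen s (cutoff B1 N))) + 1 by rewrite ltr_wpDl.
have := powR_inv_small s2 (divr_gt0 e2 cV1).
apply: filterS2 (nbhs_pinfty_gt (num_real 0)) => l l0 lp.
have Hl := key _ nq fq (cutoff_out hk bB1 N) l l0.
have {}Hl : (energy s (fun x => average (dilate l B1) (u l) x - uinfty x)%R <= (e ^+ 2)%:E)%E.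
  apply: le_trans Hl _; rewrite lee_fin mulrA -/c mulrDr.
  rewrite [leRHS]splitr; apply: lerD.
    apply: le_trans (small _ cE0); rewrite [leLHS]mulrA ler_wpM2l//.
    by rewrite lerBlDr -lerBlDl; exact: HN.
  apply: le_trans (small _ cV0).
  rewrite [leLHS](_ : _ = c * (V * fine (fen s (cutoff B1 N))) * l^-1 `^ (2 * s)); last by ring.
  by apply: ler_wpM2l.
rewrite /Htilde_norm -[leRHS](_ : ((e ^+ 2)%:E `^ 2^-1)%E = e%:E); last first.
  by rewrite poweR_EFin powR12_sqrt ?sqr_ge0// sqrtr_sqr gtr0_norm.
apply: gt0_ler_poweR => //; rewrite ?in_itv/= ?energy_ge0 ?leey ?lee_fin ?sqr_ge0//.
Qed.
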